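(* Let $q\in\mathbb{C}$ with $\xi:=\Re(q)>0$ and $q\neq 1/2$. Then the equation \[ (M+N_q-I)\phi=(I-M-N_q)\chi_{-1} \] has a nonzero solution $\phi\in L^2(m_\xi)$ if and only if there exists a nonzero infinite vector $\Phi=(\Phi_n)_{n\in\mathbb{N}_0}$ of complex numbers satisfying \[ \sum_{n=0}^\infty|\Phi_n|^2\,\frac{\Gamma(n+2\xi)}{n!}<\infty\qquad\text{and}\qquad A_q^+\Phi=D_q\Phi+D_q\Psi, \] where $A_q^+=(a^+_{kn}(q))_{k,n\in\mathbb{N}_0}$ and $D_q=(d_{kn}(q))_{k,n\in\mathbb{N}_0}$ are the infinite matrices with entries \[ \begin{aligned} a^+_{kn}(q)=\;&\frac{\Gamma(k+n+2\xi)}{k!\,n!}\,2^{-(k+n+2\xi)}+\frac{\Gamma(n+2\xi)\,\Gamma(k+2\xi)}{2^{k+2\xi}}\sum_{\ell=0}^n\frac{(-1)^\ell\,\Gamma(\ell+2q)}{(n-\ell)!\,\Gamma(\ell+2\xi)}\\ &\cdot\left(\sum_{j=0}^{\min\{\ell,k\}}\frac{2^{-j}}{j!\,(\ell-j)!\,(k-j)!\,\Gamma(j+2q)}\;{}_2F_1\!\left(-\ell+j,\,2\xi+j;\,2q+j;\,\tfrac12\right)\right),\\ d_{kn}(q)=\;&\frac{\Gamma(k+2\xi)}{k!}\,\delta_{k,n}, \end{aligned} \] and $\Psi=(\Psi_n)_{n\in\mathbb{N}_0}$ is the infinite vector given by \[ \begin{aligned} \Psi_n=\;&\int_{1/2}^1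 t^{2\xi-2}(1-t)^n\,dt\\ &-\frac{1}{2q-1}\int_0^1\frac{t^{n+2q-2}}{(1+t)^{n+2\xi+1}}\left((2\xi+4q)\,t-n-2(2\xi+1)\,\frac{t^2}{1+t}+2n\,\frac{t}{1+t}\right)dt . \end{aligned} \] Moreover, if a solution $\Phi=(\Phi_n)$ of this system exists, then the solution of $(M+N_q-I)\phi=(I-M-N_q)\chi_{-1}$ can be written as \[ \phi(t)=\sum_{n=0}^\infty\Phi_n\,L_n^{2\xi-1}(t), \] and vice versa.
   Context: Here $\mathbb{N}_0=\{0,1,2,\dots\}$, $\Gamma$ is the Gamma function, $\delta_{k,n}$ is the Kronecker delta, $I$ is the identity operator, and $\chi_{-1}:\mathbb{R}^+\to\mathbb{C}$ is the function $\chi_{-1}(t)=t^{-1}$ on $\mathbb{R}^+=(0,\infty)$. For $a\in\mathbb{C}$, $m_a$ denotes the absolutely continuous (complex, if $a\notin\mathbb{R}$) measure on $\mathbb{R}^+$ with density $dm_a(t)=t^{2a-1}e^{-t}\,dt$. For $\xi>0$, $L^2(m_\xi)$ is the Hilbert space of functions $\phi:\mathbb{R}^+\to\mathbb{C}$ with $\int_0^\infty|\phi(t)|^2\,dm_\xi(t)<\infty$, with scalar product $(f,g)_\xi=\int_0^\infty f(t)\overline{g(t)}\,dm_\xi(t)$. The operators $M$ and $N_q$ (bounded on $L^2(m_\xi)$ when $\xi=\Re(q)>0$, $q\ne1/2$) are defined by \[ M(\psi)(t)=e^{-t}\psi(t),\qquad N_q(\psi)(t)=\int_0^\infty\frac{J_{2q-1}(2\sqrt{st})}{(st)^{q-1/2}}\,\psi(s)\,dm_q(s),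 \] where $J_\nu$ is the Bessel function of the first kind, $J_\nu(t)=\frac{t^\nu}{2^\nu}\sum_{m=0}^\infty\frac{(-1)^mt^{2m}}{2^{2m}\,m!\,\Gamma(m+\nu+1)}$ for $\Re(\nu)>-1$. The function $N_q(\chi_{-1})$ is \[ N_q(\chi_{-1})(t)=\sum_{m=0}^\infty\frac{(-1)^m}{m!\,(m+2q-1)}\,t^m, \] which agrees with the integral when $\Re(q)>1/2$ and is its extension to all $q$ with $\Re(q)>0$, $q\neq1/2$. One has $(I-M)\chi_{-1}\in L^2(m_\xi)$ and $N_q(\chi_{-1})\in L^2(m_\xi)$, so $(I-M-N_q)\chi_{-1}:=(I-M)\chi_{-1}-N_q(\chi_{-1})\in L^2(m_\xi)$. The generalised Laguerre polynomials are \[ L_n^{2\xi-1}(t)=\sum_{\ell=0}^n\frac{\Gamma(n+2\xi)}{(n-\ell)!\,\Gamma(\ell+2\xi)}\,\frac{(-1)^\ell}{\ell!}\,t^\ell,\qquad n\in\mathbb{N}_0; \] they form an orthogonal basis of $L^2(m_\xi)$ with $(L_n^{2\xi-1},L_m^{2\xi-1})_\xi=\frac{\Gamma(n+2\xi)}{n!}\delta_{n,m}$. Series $\sum_n\Phi_nL_n^{2\xi-1}$ converge in $L^2(m_\xi)$. The hypergeometric function is, for $|z|<1$, \[ {}_2F_1(\alpha,\beta;\gamma;z)=\sum_{i=0}^\infty\frac{\Gamma(\alpha+i)\,\Gamma(\beta+i)\,\Gamma(\gamma)}{\Gamma(\alpha)\,\Gamma(\beta)\,\Gamma(\gamma+i)}\,\frac{z^i}{i!},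 \] where the ratio $\Gamma(\alpha+i)/\Gamma(\alpha)$ is understood as the product $\alpha(\alpha+1)\cdots(\alpha+i-1)$ (so the series terminates when $\alpha$ is a non-positive integer). *)

(* Defs.v *)
From HB Require Import structures.
From mathcomp Require Import all_boot all_order all_algebra.
From mathcomp Require Import all_classical all_reals all_analysis.
From mathcomp Require Export complex.

Set Implicit Arguments.
Unset Strict Implicit.
Unset Printing Implicit Defensive.

Import Order.TTheory GRing.Theory Num.Theory.
Import numFieldNormedType.Exports.

Local Open Scope classical_set_scope.
Local Open Scope ring_scope.
Local Open Scope complex_scope.

Section complex_analysis.
Variable R : realType.
Implicit Types (D : set R) (f : R -> R[i]) (u : nat -> R[i]).

(* The library puts no topology or measurable structure on [R[i]]; limits of
   series, measurability and integrals are taken on real and imaginary parts. *)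
Definition cvg_cseries u : Prop :=
  cvgn (series (fun n => complex.Re (u n))) /\
  cvgn (series (fun n => complex.Im (u n))).

Definition csum u : R[i] :=
  limn (series (fun n => complex.Re (u n))) +i*
  limn (series (fun n => complex.Im (u n))).

Definition cmeasurable D f : Prop :=
  measurable_fun D (fun t => complex.Re (f t)) /\
  measurable_fun D (fun t => complex.Im (f t)).

Definition cintegral D f : R[i] :=
  (\int[lebesgue_measure]_(t in D) complex.Re (f t)) +i*
  (\int[lebesgue_measure]_(t in D) complex.Im (f t)).

(* x ^ z = exp (z ln x), meaningful for 0 < x only *)
Definition cpow (x : R) (z : R[i]) : R[i] :=
  (expR (complex.Re z * ln x) * cos (complex.Im z * ln x)) +i*
  (expR (complex.Re z * ln x) * sin (complex.Im z * ln x)).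

Definition Rpos : set R := `]0, +oo[.

End complex_analysis.
Arguments Rpos {R}.

Section special_functions.
Variable R : realType.

(* Euler's integral: this is the Gamma function on the half-plane 0 < Re z, and
   all the arguments to which it is applied below lie there. *)
Definition Gamma (z : R[i]) : R[i] :=
  cintegral Rpos (fun t => cpow t (z - 1) * (expR (- t))%:C).

Definition rGamma (x : R) : R :=
  \int[lebesgue_measure]_(t in Rpos) (t `^ (x - 1) * expR (- t)).

Definition besselJ (nu : R[i]) (t : R) : R[i] :=
  cpow t nu / cpow 2 nu *
  csum (fun m => (-1) ^+ m * (t ^+ (2 * m))%:C /
                 (2 ^+ (2 * m) * m`!%:R * Gamma (m%:R + nu + 1))).

Definition pochhammer (a : R[i]) (i : nat) : R[i] := \prod_(j < i) (a + j%:R).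

Definition hyp2F1 (a b c z : R[i]) : R[i] :=
  csum (fun i => pochhammer a i * pochhammer b i / pochhammer c i *
                 (z ^+ i / i`!%:R)).

Definition laguerre (xi : R) (n : nat) (t : R) : R :=
  \sum_(l < n.+1)
    rGamma (n%:R + 2 * xi) / ((n - l)`!%:R * rGamma (l%:R + 2 * xi)) *
    ((-1) ^+ l / l`!%:R) * t ^+ l.

End special_functions.

Section L2.
Variable R : realType.

(* density of m_a with respect to the Lebesgue measure on the positive reals;
   these measures have the same null sets there when a is real *)
Definition dens (a : R[i]) (t : R) : R[i] :=
  cpow t (2 * a - 1) * (expR (- t))%:C.

Definition rdens (xi t : R) : R := t `^ (2 * xi - 1) * expR (- t).

Definition sqnorm (xi : R) (f : R -> R[i]) : \bar R :=
  (\int[lebesgue_measure]_(t in Rpos)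
     (ComplexField.Normc.normc (f t) ^+ 2 * rdens xi t)%:E)%E.

(* Elements of L^2(m_xi) are represented by functions on the whole of R, whose
   values outside the positive reals are irrelevant. *)
Definition in_L2 (xi : R) (f : R -> R[i]) : Prop :=
  cmeasurable Rpos f /\ (sqnorm xi f < +oo)%E.

Definition ae_eq_pos (f g : R -> R[i]) : Prop :=
  {ae lebesgue_measure, forall t : R, 0 < t -> f t = g t}.

Definition nonzero_L2 (f : R -> R[i]) : Prop := ~ ae_eq_pos f (fun=> 0).

Definition laguerre_sum (xi : R) (Phi : nat -> R[i]) (f : R -> R[i]) : Prop :=
  (fun n : nat => sqnorm xi (fun t =>
     f t - \sum_(i < n) Phi i * (laguerre xi i t)%:C)) @ \oo --> 0%E.

End L2.

Section operators.
Variable R : realType.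

Definition opM (psi : R -> R[i]) (t : R) : R[i] := (expR (- t))%:C * psi t.

Definition opN (q : R[i]) (psi : R -> R[i]) (t : R) : R[i] :=
  cintegral Rpos (fun s =>
    besselJ (2 * q - 1) (2 * Num.sqrt (s * t)) / cpow (s * t) (q - 2^-1) *
    psi s * dens q s).

Definition chi_m1 (t : R) : R[i] := (t^-1)%:C.

(* N_q(chi_{-1}): the integral [opN q chi_m1] diverges when Re q <= 1/2, this
   is its extension to Re q > 0 *)
Definition opN_chi (q : R[i]) (t : R) : R[i] :=
  csum (fun m => (-1) ^+ m / (m`!%:R * (m%:R + 2 * q - 1)) * (t ^+ m)%:C).

Definition L2_solution (q : R[i]) (phi : R -> R[i]) : Prop :=
  in_L2 (complex.Re q) phi /\
  ae_eq_pos (fun t => opM phi t + opN q phi t - phi t)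
            (fun t => chi_m1 t - opM chi_m1 t - opN_chi q t).

End operators.

Section matrices.
Variable R : realType.

Definition Aplus (q : R[i]) (k n : nat) : R[i] :=
  let xi := complex.Re q in
  (rGamma ((k + n)%:R + 2 * xi) / (k`!%:R * n`!%:R) *
     2 `^ (- ((k + n)%:R + 2 * xi)))%:C +
  (rGamma (n%:R + 2 * xi) * rGamma (k%:R + 2 * xi) /
     2 `^ (k%:R + 2 * xi))%:C *
  \sum_(l < n.+1)
    (-1) ^+ l * Gamma (l%:R + 2 * q) /
      ((n - l)`!%:R * (rGamma (l%:R + 2 * xi))%:C) *
    \sum_(j < (minn l k).+1)
      2 ^- j / (j`!%:R * (l - j)`!%:R * (k - j)`!%:R * Gamma (j%:R + 2 * q)) *
      hyp2F1 (- l%:R + j%:R) ((2 * xi)%:C + j%:R) (2 * q + j%:R) 2^-1.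

Definition Dmx (q : R[i]) (k n : nat) : R[i] :=
  (rGamma (k%:R + 2 * complex.Re q) / k`!%:R * (k == n)%:R)%:C.

Definition Psi (q : R[i]) (n : nat) : R[i] :=
  let xi := complex.Re q in
  (\int[lebesgue_measure]_(t in `[2^-1, 1])
     (t `^ (2 * xi - 2) * (1 - t) ^+ n))%:C -
  (2 * q - 1)^-1 *
  cintegral `]0, 1[ (fun t =>
    cpow t (n%:R + 2 * q - 2) / ((1 + t) `^ (n%:R + 2 * xi + 1))%:C *
    (((2 * xi)%:C + 4 * q) * t%:C - n%:R
     - (2 * (2 * xi + 1) * (t ^+ 2 / (1 + t)))%:C
     + (2 * n%:R * (t / (1 + t)))%:C)).

Definition cvg_mulmv (A : nat -> nat -> R[i]) (x : nat -> R[i]) : Prop :=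
  forall k, cvg_cseries (fun n => A k n * x n).

Definition mulmv (A : nat -> nat -> R[i]) (x : nat -> R[i]) (k : nat) : R[i] :=
  csum (fun n => A k n * x n).

Definition matrix_solution (q : R[i]) (Phi : nat -> R[i]) : Prop :=
  (\sum_(0 <= n <oo)
     (ComplexField.Normc.normc (Phi n) ^+ 2 *
        (rGamma (n%:R + 2 * complex.Re q) / n`!%:R))%:E < +oo)%E /\
  cvg_mulmv (Aplus q) Phi /\
  forall k, mulmv (Aplus q) Phi k = mulmv (Dmx q) Phi k + mulmv (Dmx q) (Psi q) k.

End matrices.

(* Main.v *)
(** Both equations say that two elements of L^2(m_xi) have the same Laguerre
coefficients: the Laguerre polynomials are complete, because a function of
L^2(m_xi) that is orthogonal to all of them has vanishing moments.  Writing
phi = sum_n Phi_n L_n, it remains to compare the pairings with L_k.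

- The kernel of N_q is 1/Gamma(2q) times f(st), with f = 0F1(; 2q; - .).
  An energy argument gives |f(x)| <= C (1 + x) for x >= 0, so N_q phi is at most
  C (1 + t) times a weighted L^1 norm of phi, and N_q can be applied termwise
  to the Laguerre series.
- N_q maps t^l to a polynomial times e^{-t}, and the pairing of t^r e^{-t} with
  L_k is explicit, as the Laplace transform of L_k m_xi is (Chu-Vandermonde).
  Summing up, the pairing of (M + N_q) L_n with L_k is a^+_{kn}(q).
- With T_z(t) = int_0^1 u^{z-1} e^{-ut} du, the right-hand side is
  T_1(t) - (e^{-t} + t T_{2q}(t)) / (2q - 1).  By Fubini its pairing with L_k is
  an integral over ]0, 1[, which becomes Gamma(k + 2 xi) / k! Psi_k after
  adding the derivative of 2 u^{k+2q} (1 + u)^{-k-2xi-1}, to absorb the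
  contribution of e^{-t}. *)

From HB Require Import structures.
Require Import Defs.
From mathcomp Require Import all_boot all_order all_algebra.
From mathcomp Require Import all_classical all_reals all_analysis.
From mathcomp Require Import measurable_realfun complex ring lra.
Set Implicit Arguments.
Unset Strict Implicit.
Unset Printing Implicit Defensive.
Import Order.TTheory GRing.Theory Num.Theory.
Import numFieldNormedType.Exports.
Local Open Scope classical_set_scope.
Local Open Scope ring_scope.
Local Open Scope complex_scope.
Local Notation Re := complex.Re.
Local Notation Im := complex.Im.
Local Notation normc := ComplexField.Normc.normc.
Local Notation leb := lebesgue_measure.
Local Arguments cpow : simpl never.
Local Arguments Gamma : simpl never.
Local Arguments rGamma : simpl never.
Local Arguments csum : simpl never.
Local Arguments cintegral : simpl never.
Local Arguments ComplexField.Normc.normc : simpl never.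

(** * Complex numbers and limits of complex sequences *)

Section complex_numbers.
Variable R : realType.
Implicit Types (x y z : R[i]) (a b : R) (u v : nat -> R[i]).

(** For complex [q] the density inside [N_q] is complex, whereas the Hilbert space and the Laguerre
    polynomials belong to the real measure with [xi = Re q]. The two are compared only through
    [|dens q s| = rdens xi s]; this is why parameters [2 q] and [2 xi] stand side by side in the
    matrix. Functions are treated through their real and imaginary parts, so that the expansion
    theory is that of a real Hilbert space. The analysis rests on the fact that [1 + t] lies in
    [L^2(m_xi)]: a linear growth bound then controls every pairing with a Laguerre polynomial, for
    all [Re q > 0] at once. Convergence of the rows of [A_q^+ Phi], which belongs to the notion of a
    solution, thereby becomes a consequence of the convergence of the Laguerre series. Moments
    determine a function [f] of [L^2(m_xi)] because [exp (t / 4)] is square integrable for [m_xi]: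
    the product of [f] and the density stays integrable after multiplication by [exp (t / 4)], so
    exponential series may be integrated term by term against it. *)

Lemma complex_ext x y : Re x = Re y -> Im x = Im y -> x = y.
Proof. by case: x => a b; case: y => c d /= -> ->. Qed.

Lemma ReD x y : Re (x + y) = Re x + Re y. Proof. by case: x; case: y. Qed.
Lemma ImD x y : Im (x + y) = Im x + Im y. Proof. by case: x; case: y. Qed.
Lemma ReN x : Re (- x) = - Re x. Proof. by case: x. Qed.
Lemma ImN x : Im (- x) = - Im x. Proof. by case: x. Qed.
Lemma ReB x y : Re (x - y) = Re x - Re y. Proof. by rewrite ReD ReN. Qed.
Lemma ImB x y : Im (x - y) = Im x - Im y. Proof. by rewrite ImD ImN. Qed.
Lemma ReM x y : Re (x * y) = Re x * Re y - Im x * Im y.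
Proof. by case: x; case: y. Qed.
Lemma ImM x y : Im (x * y) = Re x * Im y + Im x * Re y.
Proof. by case: x; case: y. Qed.
Lemma Re_nat n : Re (n%:R : R[i]) = n%:R.
Proof. by elim: n => // n ih; rewrite -natr1 ReD ih -natr1. Qed.
Lemma Im_nat n : Im (n%:R : R[i]) = 0.
Proof. by elim: n => // n ih; rewrite -natr1 ImD ih addr0. Qed.
Lemma ReZ a x : Re (a%:C * x) = a * Re x.
Proof. by rewrite ReM /= mul0r subr0. Qed.
Lemma ImZ a x : Im (a%:C * x) = a * Im x.
Proof. by rewrite ImM /= mul0r addr0. Qed.
Lemma ReZr a x : Re (x * a%:C) = Re x * a. Proof. by rewrite mulrC ReZ mulrC. Qed.
Lemma ImZr a x : Im (x * a%:C) = Im x * a. Proof. by rewrite mulrC ImZ mulrC. Qed.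
Lemma Re_sum I (r : seq I) (P : pred I) (F : I -> R[i]) :
  Re (\sum_(i <- r | P i) F i) = \sum_(i <- r | P i) Re (F i).
Proof. by apply: (big_morph (fun x => Re x)) => //; exact: ReD. Qed.
Lemma Im_sum I (r : seq I) (P : pred I) (F : I -> R[i]) :
  Im (\sum_(i <- r | P i) F i) = \sum_(i <- r | P i) Im (F i).
Proof. by apply: (big_morph (fun x => Im x)) => //; exact: ImD. Qed.

Lemma realcD a b : (a + b)%:C = a%:C + b%:C :> R[i].
Proof. by apply: complex_ext; rewrite /= ?addr0. Qed.
Lemma realcN a : (- a)%:C = - a%:C :> R[i].
Proof. by apply: complex_ext; rewrite /= ?oppr0. Qed.
Lemma realcM a b : (a * b)%:C = a%:C * b%:C :> R[i].
Proof. by apply: complex_ext; rewrite /= ?(mulr0, mul0r, subr0, addr0). Qed.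
Lemma realcB a b : (a - b)%:C = a%:C - b%:C :> R[i].
Proof. by rewrite realcD realcN. Qed.
Lemma realcX a n : (a ^+ n)%:C = a%:C ^+ n :> R[i].
Proof. by elim: n => // n ih; rewrite !exprS realcM ih. Qed.
Lemma realc_nat n : (n%:R)%:C = n%:R :> R[i].
Proof. by apply: complex_ext; rewrite ?Re_nat ?Im_nat. Qed.
Lemma realcV a : (a^-1)%:C = (a%:C)^-1 :> R[i].
Proof.
have [->|a0] := eqVneq a 0; first by rewrite !invr0.
have a0' : a%:C != 0 :> R[i] by rewrite eq_complex /= eqxx andbT.
by apply: (mulIf a0'); rewrite mulVf// -realcM mulVf.
Qed.
Lemma realc_sum I (r : seq I) (P : pred I) (F : I -> R) :
  (\sum_(i <- r | P i) F i)%:C = \sum_(i <- r | P i) (F i)%:C :> R[i].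
Proof. by apply: (big_morph (fun a : R => a%:C)) => //; exact: realcD. Qed.
Lemma realc_prod I (r : seq I) (P : pred I) (F : I -> R) :
  (\prod_(i <- r | P i) F i)%:C = \prod_(i <- r | P i) (F i)%:C :> R[i].
Proof. by apply: (big_morph (fun a : R => a%:C)) => //; exact: realcM. Qed.

Lemma normcE x : normc x = Num.sqrt (Re x ^+ 2 + Im x ^+ 2).
Proof. by case: x. Qed.
Lemma normc_ge0 x : 0 <= normc x. Proof. by rewrite normcE sqrtr_ge0. Qed.
Lemma sqr_normc x : normc x ^+ 2 = Re x ^+ 2 + Im x ^+ 2.
Proof. by rewrite normcE sqr_sqrtr// addr_ge0 ?sqr_ge0. Qed.
Lemma Re_le_normc x : `|Re x| <= normc x.
Proof. by rewrite normcE -sqrtr_sqr ler_sqrt ?lerDl ?addr_ge0 ?sqr_ge0. Qed.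
Lemma Im_le_normc x : `|Im x| <= normc x.
Proof. by rewrite normcE -sqrtr_sqr ler_sqrt ?lerDr ?addr_ge0 ?sqr_ge0. Qed.
Lemma normc_real a : normc a%:C = `|a|.
Proof. by rewrite normcE /= expr0n addr0 sqrtr_sqr. Qed.
Lemma normc_le_ReIm x : normc x <= `|Re x| + `|Im x|.
Proof.
rewrite -[leRHS]ger0_norm ?addr_ge0// -sqrtr_sqr normcE ler_sqrt ?sqr_ge0//.
by rewrite sqrrD !real_normK ?num_real// addrAC lerDl mulrn_wge0// mulr_ge0.
Qed.
Lemma normcX x n : normc (x ^+ n) = normc x ^+ n.
Proof.
by elim: n => [|n ih]; rewrite ?ComplexField.Normc.normc1// !exprS ComplexField.Normc.normcM ih.
Qed.
Lemma normc_nat n : normc (n%:R : R[i]) = n%:R.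
Proof. by rewrite -realc_nat normc_real ger0_norm. Qed.
Lemma normc_sum I (r : seq I) (P : pred I) (F : I -> R[i]) :
  normc (\sum_(i <- r | P i) F i) <= \sum_(i <- r | P i) normc (F i).
Proof.
elim/big_ind2 : _ => //; first by rewrite ComplexField.Normc.normc0.
by move=> a b c d ab cd; rewrite (le_trans (le_normcD _ _))// lerD.
Qed.
Lemma Re_neq0 x : 0 < Re x -> x != 0.
Proof. by move=> x0; apply: contraTneq x0 => ->; rewrite ltxx. Qed.

Definition ccvg u z : Prop :=
  ((Re (u n)) @[n --> \oo] --> Re z) /\ ((Im (u n)) @[n --> \oo] --> Im z).

Lemma ccvg_unique u x y : ccvg u x -> ccvg u y -> x = y.
Proof.
by move=> [a b] [c d]; apply: complex_ext; [exact: (cvg_unique _ a c)|exact: (cvg_unique _ b d)].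
Qed.
Lemma ccvg_eq u v z : (forall n, u n = v n) -> ccvg v z -> ccvg u z.
Proof. by move=> /funext ->. Qed.
Lemma ccvg_cst z : ccvg (fun=> z) z. Proof. by split; exact: cvg_cst. Qed.
Lemma ccvgD u v x y : ccvg u x -> ccvg v y -> ccvg (fun n => u n + v n) (x + y).
Proof.
by move=> [a b] [c d]; split; [under eq_fun do rewrite ReD|under eq_fun do rewrite ImD];
  rewrite ?ReD ?ImD; exact: cvgD.
Qed.
Lemma ccvgM u v x y : ccvg u x -> ccvg v y -> ccvg (fun n => u n * v n) (x * y).
Proof.
move=> [a b] [c d]; split.
  by under eq_fun do rewrite ReM; rewrite ReM; apply: cvgB; exact: cvgM.
by under eq_fun do rewrite ImM; rewrite ImM; apply: cvgD; exact: cvgM.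
Qed.
Lemma ccvgZ (c : R[i]) u x : ccvg u x -> ccvg (fun n => c * u n) (c * x).
Proof. by apply: ccvgM; exact: ccvg_cst. Qed.
Lemma ccvgB u v x y : ccvg u x -> ccvg v y -> ccvg (fun n => u n - v n) (x - y).
Proof.
move=> ux vy; apply: (@ccvg_eq _ (fun n => u n + -1 * v n)) => [n|]; first by rewrite mulN1r.
by rewrite -[- y]mulN1r; apply: ccvgD => //; exact: ccvgZ.
Qed.
Lemma ccvg_shift u z : ccvg (fun n => u n.+1) z <-> ccvg u z.
Proof.
rewrite /ccvg -(cvg_shiftS (fun n => Re (u n))).
by rewrite -(cvg_shiftS (fun n => Im (u n))).
Qed.
Lemma ccvg_norm0 u z (e : nat -> R) : (forall n, normc (u n - z) <= e n) ->
  e n @[n --> \oo] --> 0 -> ccvg u z.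
Proof.
move=> ue e0; split.
  apply/cvgrPdist_le => d d0; move/cvgrPdist_le: e0 => /(_ d d0).
  apply: filterS => n /=; rewrite sub0r normrN => h.
  rewrite distrC -ReB (le_trans (Re_le_normc _))// (le_trans (ue n))//.
  by rewrite (le_trans (ler_norm _)).
apply/cvgrPdist_le => d d0; move/cvgrPdist_le: e0 => /(_ d d0).
apply: filterS => n /=; rewrite sub0r normrN => h.
rewrite distrC -ImB (le_trans (Im_le_normc _))// (le_trans (ue n))//.
by rewrite (le_trans (ler_norm _)).
Qed.

(** Passes from a limit of complex partial sums to [csum], which is made of two real limits; every
    infinite sum that has a closed form is evaluated this way. *)
Lemma ccvg_csum u z : ccvg (fun n => \sum_(i < n) u i) z ->
  cvg_cseries u /\ csum u = z.
Proof.
move=> [h1 h2].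
have e1 : series (fun n => Re (u n)) = (fun n => Re (\sum_(i < n) u i)).
  by apply/funext => n; rewrite /series /= big_mkord Re_sum.
have e2 : series (fun n => Im (u n)) = (fun n => Im (\sum_(i < n) u i)).
  by apply/funext => n; rewrite /series /= big_mkord Im_sum.
split.
  by rewrite /cvg_cseries e1 e2; split; apply/cvg_ex; eexists; [exact: h1|exact: h2].
by apply: complex_ext; rewrite /csum /= ?e1 ?e2; exact/cvg_lim.
Qed.

Lemma csum_ccvg u : cvg_cseries u -> ccvg (fun n => \sum_(i < n) u i) (csum u).
Proof.
move=> [h1 h2].
have e1 : series (fun n => Re (u n)) = (fun n => Re (\sum_(i < n) u i)).
  by apply/funext => n; rewrite /series /= big_mkord Re_sum.
have e2 : series (fun n => Im (u n)) = (fun n => Im (\sum_(i < n) u i)).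
  by apply/funext => n; rewrite /series /= big_mkord Im_sum.
by rewrite /ccvg -e1 -e2; split; [exact: h1|exact: h2].
Qed.

Lemma csum_eq u v : (forall n, u n = v n) -> csum u = csum v.
Proof. by move=> /funext ->. Qed.

(** Serves for terminating hypergeometric series and for products with the diagonal matrix [Dmx]. *)
Lemma csum_finite u N : (forall n, (N <= n)%N -> u n = 0) -> csum u = \sum_(i < N) u i.
Proof.
move=> u0; apply: (proj2 (ccvg_csum _)).
have h : \forall n \near \oo, \sum_(i < N) u i = \sum_(i < n) u i.
  exists N => // n /= Nn; rewrite (big_ord_widen _ u Nn) big_mkcond /=.
  by apply: eq_bigr => i _; case: ltnP => // /u0.
by split; apply: cvg_near_cst; apply: filterS h => n /= ->.
Qed.

Lemma cvg_cseries_norm u (e : nat -> R) : (forall n, normc (u n) <= e n) ->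
  cvgn (series e) -> cvg_cseries u.
Proof.
move=> ue ce; split; apply: normed_cvg;
  (apply: (series_le_cvg _ _ _ ce) => n //=; last first).
- exact: le_trans (Re_le_normc _) (ue n).
- exact: le_trans (normc_ge0 _) (ue n).
- exact: le_trans (Im_le_normc _) (ue n).
- exact: le_trans (normc_ge0 _) (ue n).
Qed.

Lemma csumZ (c : R[i]) u : cvg_cseries u -> csum (fun n => c * u n) = c * csum u.
Proof.
move=> /csum_ccvg cu; apply: (proj2 (ccvg_csum _)).
by apply: (@ccvg_eq _ (fun n => c * \sum_(i < n) u i)) => [n|];
  [rewrite mulr_sumr|exact: ccvgZ].
Qed.

End complex_numbers.

(** * Integrals over subsets of the real line *)

Notation rint D f := (lebesgue_measure.-integrable D (EFin \o f)).

Section real_integrals.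
Variable R : realType.
Implicit Types (D : set R) (f g F : R -> R) (a b : nat -> R).

Lemma rint_measurable D f : rint D f -> measurable_fun D f.
Proof. by move=> /integrableP[/measurable_EFinP]. Qed.

Lemma rint_dom D f g : measurable D -> measurable_fun D f ->
  (forall x, D x -> `|f x| <= g x) -> rint D g -> rint D f.
Proof.
move=> mD mf fg; apply: le_integrable => //; first exact/measurable_EFinP.
by move=> x Dx /=; rewrite lee_fin (le_trans (fg x Dx))// ler_norm.
Qed.

Lemma rintS D E f : measurable D -> measurable E -> E `<=` D -> rint D f -> rint E f.
Proof. by move=> mD mE ED; apply: integrableS. Qed.

Lemma rint_eq D f g : measurable D ->
  (forall x, D x -> f x = g x) -> rint D f -> rint D g.
Proof.
by move=> mD fg; apply: eq_integrable => //= x; rewrite inE => /fg ->.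
Qed.

Lemma rintD D f g : measurable D -> rint D f -> rint D g -> rint D (fun x => f x + g x).
Proof. by move=> mD rf rg; have := integrableD (mu := leb) mD rf rg. Qed.

Lemma rintZ D f c : measurable D -> rint D f -> rint D (fun x => c * f x).
Proof. by move=> mD rf; have := integrableZl (mu := leb) mD c rf. Qed.

Lemma rintB D f g : measurable D -> rint D f -> rint D g -> rint D (fun x => f x - g x).
Proof.
by move=> mD rf rg; under eq_fun do rewrite -[- g _]mulN1r; apply: rintD => //; exact: rintZ.
Qed.

Lemma rint_sum D I (s : seq I) (F : I -> R -> R) : measurable D ->
  (forall i, rint D (F i)) -> rint D (fun x => \sum_(i <- s) F i x).
Proof.
move=> mD rF; elim: s => [|i s ih].
  under eq_fun do rewrite big_nil; apply: integrable0 => //.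
by under eq_fun do rewrite big_cons; exact: rintD.
Qed.

Lemma RintZ D f c : measurable D -> rint D f ->
  \int[leb]_(x in D) (c * f x) = c * \int[leb]_(x in D) f x.
Proof. by move=> mD rf; rewrite RintegralZl. Qed.

Lemma RintD D f g : measurable D -> rint D f -> rint D g ->
  \int[leb]_(x in D) (f x + g x) = \int[leb]_(x in D) f x + \int[leb]_(x in D) g x.
Proof. by move=> mD rf rg; rewrite RintegralD. Qed.

Lemma RintB D f g : measurable D -> rint D f -> rint D g ->
  \int[leb]_(x in D) (f x - g x) = \int[leb]_(x in D) f x - \int[leb]_(x in D) g x.
Proof. by move=> mD rf rg; rewrite RintegralB. Qed.

Lemma Rint_le D f g : measurable D -> rint D f -> rint D g ->
  (forall x, D x -> f x <= g x) -> \int[leb]_(x in D) f x <= \int[leb]_(x in D) g x.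
Proof. by move=> mD rf rg fg; exact: le_Rintegral. Qed.

Lemma rint_norm D f : measurable D -> rint D f -> rint D (fun x => `|f x|).
Proof. by move=> mD rf; have := integrable_norm rf. Qed.

Lemma Rint0 D : \int[leb]_(x in D) (0 : R) = 0 :> R.
Proof. by rewrite /Rintegral integral0. Qed.

Lemma Rint_sum D I (s : seq I) (F : I -> R -> R) : measurable D ->
  (forall i, rint D (F i)) ->
  \int[leb]_(x in D) (\sum_(i <- s) F i x) = \sum_(i <- s) \int[leb]_(x in D) F i x.
Proof.
move=> mD rF; elim: s => [|i s ih].
  by rewrite big_nil; under eq_Rintegral do rewrite big_nil; rewrite Rint0.
under eq_Rintegral do rewrite big_cons.
by rewrite RintegralD// ?big_cons ?ih//; exact: rint_sum.
Qed.

Lemma Rint_eq D f g : (forall x, D x -> f x = g x) ->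
  \int[leb]_(x in D) f x = \int[leb]_(x in D) g x.
Proof. by move=> fg; apply: eq_Rintegral => x; rewrite inE => /fg. Qed.

Lemma Rint_norm_le D f g : measurable D -> measurable_fun D f ->
  (forall x, D x -> `|f x| <= g x) -> rint D g ->
  `|\int[leb]_(x in D) f x| <= \int[leb]_(x in D) g x.
Proof.
move=> mD mf fg rg; have rf := rint_dom mD mf fg rg.
by rewrite (le_trans (le_normr_Rintegral (mu := leb) mD rf))//; apply: le_Rintegral => //; exact: rint_norm.
Qed.

(** Dominated convergence with convergence at every point of [D], so that measurability of the limit
    is a conclusion and not a premise. *)
Lemma rdct D (f_ : nat -> R -> R) f g : measurable D ->
  (forall n, measurable_fun D (f_ n)) ->
  (forall n x, D x -> `|f_ n x| <= g x) -> rint D g ->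
  (forall x, D x -> f_ n x @[n --> \oo] --> f x) ->
  rint D f /\ \int[leb]_(x in D) f_ n x @[n --> \oo] --> \int[leb]_(x in D) f x.
Proof.
move=> mD mf_ fg rg ff.
have mf : measurable_fun D f by exact: (measurable_fun_cvg (fun n => mf_ n)).
have ff' x : D x -> (EFin \o f_ n) x @[n --> \oo] --> (EFin \o f) x.
  by move=> Dx; apply: cvg_EFin; [exact: nearW|exact: ff].
have h1 : {ae leb, forall x, D x -> (EFin \o f_ n) x @[n --> \oo] --> (EFin \o f) x}.
  exact: aeW.
have h2 : {ae leb, forall x n, D x -> (`|(EFin \o f_ n) x| <= (EFin \o g) x)%E}.
  by apply: aeW => x n Dx; exact: fg.
have [rf _ h] := @dominated_convergence _ _ _ leb D mD (fun n => EFin \o f_ n)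
   (EFin \o f) (EFin \o g) (fun n => (measurable_EFinP _ _).2 (mf_ n))
   ((measurable_EFinP _ _).2 mf) h1 rg h2.
split => //; apply: fine_cvg; rewrite fineK//.
exact: integrable_fin_num.
Qed.

Lemma Eint_Rint D f : measurable D -> rint D f ->
  (\int[leb]_(x in D) (f x)%:E = (\int[leb]_(x in D) f x)%:E)%E.
Proof. by move=> mD rf; rewrite /Rintegral fineK//; have := integrable_fin_num (mu := leb) mD rf. Qed.

Lemma Eint_le D f g : measurable D -> measurable_fun D f -> measurable_fun D g ->
  (forall x, D x -> 0 <= f x) -> (forall x, D x -> f x <= g x) ->
  (\int[leb]_(x in D) (f x)%:E <= \int[leb]_(x in D) (g x)%:E)%E.
Proof.
move=> mD mf mg f0 fg.
have h1 x : D x -> (0 <= (EFin \o f) x)%E by move=> /f0 /=; rewrite lee_fin.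
have h2 x : D x -> ((EFin \o f) x <= (EFin \o g) x)%E by move=> /fg /=; rewrite lee_fin.
have h3 x : D x -> (0 <= (EFin \o g) x)%E by move=> Dx; exact: le_trans (h1 x Dx) (h2 x Dx).
apply: ge0_le_integral => //; exact/measurable_EFinP.
Qed.

Lemma ge0_rint D f (B : R) : measurable D -> measurable_fun D f -> (forall x, D x -> 0 <= f x) ->
  (\int[leb]_(x in D) (f x)%:E <= B%:E)%E -> rint D f /\ \int[leb]_(x in D) f x <= B.
Proof.
move=> mD mf f0 fB.
have rf : rint D f.
  apply/integrableP; split; first exact/measurable_EFinP.
  apply: le_lt_trans (ltry B); apply: le_trans fB.
  rewrite le_eqVlt; apply/orP; left; apply/eqP; apply: eq_integral => t.
  by rewrite inE => /f0 h; rewrite /= ger0_norm.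
by split => //; rewrite -lee_fin -Eint_Rint.
Qed.

Lemma ae_imp (P Q : set R) : almost_everywhere leb P -> (forall x, P x -> Q x) ->
  almost_everywhere leb Q.
Proof.
by move=> hP PQ; apply: filterS hP => //; exact: (ae_filter_ringOfSetsType leb).
Qed.

Lemma Eint_ae_eq D f g : measurable D -> measurable_fun D f -> measurable_fun D g ->
  (forall x, D x -> 0 <= f x) -> (forall x, D x -> 0 <= g x) ->
  {ae leb, forall x, D x -> f x = g x} ->
  (\int[leb]_(x in D) (f x)%:E = \int[leb]_(x in D) (g x)%:E)%E.
Proof.
move=> mD mf mg f0 g0 fg.
have h1 x : D x -> (0 <= (EFin \o f) x)%E by move=> /f0 /=; rewrite lee_fin.
have h2 x : D x -> (0 <= (EFin \o g) x)%E by move=> /g0 /=; rewrite lee_fin.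
apply: (ge0_ae_eq_integral (mu := leb) mD ((measurable_EFinP _ _).2 mf)
  ((measurable_EFinP _ _).2 mg) h1 h2).
apply: (ae_imp fg).
by move=> x h Dx; rewrite /= h.
Qed.

Lemma limn_einf_le (u v : nat -> \bar R) l : (forall n, (u n <= v n)%E) ->
  v n @[n --> \oo] --> l -> (limn_einf u <= l)%E.
Proof.
move=> uv vl; rewrite limn_einf_lim -(cvg_lim _ vl)//; apply: lee_lim.
- exact: is_cvg_einfs.
- by apply/cvg_ex; exists l.
- near=> n; apply: le_trans (uv n); apply: ereal_inf_lbound.
  by exists n => /=.
Unshelve. all: by end_near. Qed.

(** Compact intervals increasing to [D]. Integrals over an open or unbounded interval are limits of
    integrals over [[a n, b n]], where the fundamental theorem of calculus applies. *)
Definition exhausts a b D :=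
  [/\ forall n, a n < b n, forall n, `[a n, b n] `<=` D,
      forall x, D x -> \forall n \near \oo, a n <= x <= b n,
      {homo a : m n / (m <= n)%N >-> n <= m} & {homo b : m n / (m <= n)%N >-> m <= n}].

Lemma exhausts_cvg a b D f : measurable D -> exhausts a b D -> rint D f ->
  \int[leb]_(x in `[a n, b n]) f x @[n --> \oo] --> \int[leb]_(x in D) f x.
Proof.
move=> mD [ab abD Dab _ _] rf.
have mf := rint_measurable rf.
have [||||_] := @rdct D (fun n => f \_ [set` `[a n, b n]]) f (fun x => `|f x|) mD.
- move=> n; apply/measurable_restrict => //.
  by apply: measurable_funS mf => // x [].
- by move=> n x Dx; rewrite patchE; case: ifPn => //; rewrite normr0.
- exact: rint_norm.
- move=> x Dx; apply: cvg_near_cst; apply: filterS (Dab x Dx) => n h.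
  by rewrite patchE ifT// inE /= in_itv.
- apply: cvg_trans; apply: near_eq_cvg; near=> n.
  rewrite -Rintegral_mkcondr; congr Rintegral; apply/seteqP; split => x /=; first by case.
  by move=> h; split => //; exact: abD h.
Unshelve. all: by end_near. Qed.

Lemma ge0_exhausts_rint a b D f (B : R) : measurable D -> exhausts a b D ->
  measurable_fun D f -> (forall x, D x -> 0 <= f x) ->
  (forall n, (\int[leb]_(x in `[a n, b n]) (f x)%:E <= B%:E)%E) -> rint D f.
Proof.
move=> mD [ab abD Dab adec binc] mf f0 fB.
have DE : \bigcup_n [set` `[a n, b n]] = D.
  apply/seteqP; split => [x [n _ /abD]//|x Dx].
  have [N _ /(_ N (leqnn N)) h] := Dab x Dx.
  by exists N => //=; rewrite in_itv.
apply/integrableP; split; first exact/measurable_EFinP.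
have -> : (\int[leb]_(x in D) `|(EFin \o f) x| = \int[leb]_(x in D) (f x)%:E)%E.
  by apply: eq_integral => x; rewrite inE => /f0 h /=; rewrite ger0_norm.
have h : (\int[leb]_(x in `[a n, b n]) (f x)%:E @[n --> \oo] -->
    \int[leb]_(x in D) (f x)%:E)%E.
  have nd : {homo (fun n => [set` `[a n, b n]]) : m n / (m <= n)%N >-> (m <= n)%O}.
    move=> m n mn; rewrite subsetEset => x /=; rewrite !in_itv /= => /andP[ax xb].
    by rewrite (le_trans (adec _ _ mn))//= (le_trans xb)// binc.
  have mf' n : measurable_fun [set` `[a n, b n]] (EFin \o f).
    by apply/measurable_EFinP; exact: measurable_funS mf.
  have f0' n x : [set` `[a n, b n]] x -> (0 <= (EFin \o f) x)%E.
    by move=> /abD /f0; rewrite /= lee_fin.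
  have := @ge0_nondecreasing_set_cvg_integral _ _ _ _ _ (@lebesgue_measure R) nd
    (fun n => measurable_itv _) mf' f0'.
  by rewrite DE.
rewrite (le_lt_trans _ (ltry B))//.
rewrite -(cvg_lim _ h)//; apply: lime_le; first by apply/cvg_ex; eexists; exact: h.
exact: nearW.
Qed.

End real_integrals.

(** * Integrals of complex-valued functions *)

Section complex_integrals.
Variable R : realType.
Implicit Types (D : set R) (f g : R -> R[i]).

Definition cint D f := rint D (fun x => Re (f x)) /\ rint D (fun x => Im (f x)).

Lemma cint_measurable D f : cint D f -> cmeasurable D f.
Proof. by move=> [/rint_measurable ? /rint_measurable ?]. Qed.

Lemma cint_dom D f (g : R -> R) : measurable D -> cmeasurable D f ->
  (forall x, D x -> normc (f x) <= g x) -> rint D g -> cint D f.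
Proof.
move=> mD [m1 m2] fg rg; split; apply: (@rint_dom _ _ _ g) => // x Dx.
  exact: le_trans (Re_le_normc _) (fg x Dx).
exact: le_trans (Im_le_normc _) (fg x Dx).
Qed.

Lemma cint_eq D f g : measurable D -> (forall x, D x -> f x = g x) -> cint D f -> cint D g.
Proof. by move=> mD fg [] h1 h2; split; [apply: rint_eq h1|apply: rint_eq h2] => // x /fg ->. Qed.

Lemma cintegral_eq D f g : (forall x, D x -> f x = g x) -> cintegral D f = cintegral D g.
Proof. by move=> fg; rewrite /cintegral; congr (_ +i* _); apply: Rint_eq => x /fg ->. Qed.

Lemma cmeasurable_eq D f g : (forall x, D x -> f x = g x) -> cmeasurable D f -> cmeasurable D g.
Proof.
move=> fg [h1 h2]; split; [apply: eq_measurable_fun h1|apply: eq_measurable_fun h2];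
  by move=> x; rewrite inE => /fg ->.
Qed.

Lemma cintD D f g : measurable D -> cint D f -> cint D g -> cint D (fun x => f x + g x).
Proof.
by move=> mD [a b] [c d]; split; [under eq_fun do rewrite ReD|under eq_fun do rewrite ImD];
  exact: rintD.
Qed.

Lemma cintZ D (c : R[i]) f : measurable D -> cint D f -> cint D (fun x => c * f x).
Proof.
move=> mD [a b]; split.
  by under eq_fun do rewrite ReM; apply: rintB => //; exact: rintZ.
by under eq_fun do rewrite ImM; apply: rintD => //; exact: rintZ.
Qed.

Lemma cintB D f g : measurable D -> cint D f -> cint D g -> cint D (fun x => f x - g x).
Proof.
move=> mD h1 h2; apply: (@cint_eq _ (fun x => f x + -1 * g x)) => //.
  by move=> x _; rewrite mulN1r.
by apply: cintD => //; exact: cintZ.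
Qed.

Lemma cint_sum D I (s : seq I) (F : I -> R -> R[i]) : measurable D ->
  (forall i, cint D (F i)) -> cint D (fun x => \sum_(i <- s) F i x).
Proof.
move=> mD rF; split; [under eq_fun do rewrite Re_sum|under eq_fun do rewrite Im_sum];
  by apply: rint_sum => // i; have [] := rF i.
Qed.

Lemma cintegralD D f g : measurable D -> cint D f -> cint D g ->
  cintegral D (fun x => f x + g x) = cintegral D f + cintegral D g.
Proof.
move=> mD [a b] [c d]; apply: complex_ext; rewrite /cintegral /=.
  by rewrite -RintegralD//; apply: Rint_eq => x _; rewrite ReD.
by rewrite -RintegralD//; apply: Rint_eq => x _; rewrite ImD.
Qed.

Lemma cintegralZ D (c : R[i]) f : measurable D -> cint D f ->
  cintegral D (fun x => c * f x) = c * cintegral D f.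
Proof.
move=> mD [a b]; apply: complex_ext; rewrite /cintegral ?ReM ?ImM /=.
  rewrite -!(RintegralZl (mu := leb))// -RintegralB//; [|exact: rintZ|exact: rintZ].
  by apply: Rint_eq => x _; rewrite ReM.
rewrite -!(RintegralZl (mu := leb))// -RintegralD//; [|exact: rintZ|exact: rintZ].
by apply: Rint_eq => x _; rewrite ImM.
Qed.

Lemma cintegralB D f g : measurable D -> cint D f -> cint D g ->
  cintegral D (fun x => f x - g x) = cintegral D f - cintegral D g.
Proof.
move=> mD a b; rewrite -[- cintegral D g]mulN1r -cintegralZ// -cintegralD//; last exact: cintZ.
by apply: cintegral_eq => x _; rewrite mulN1r.
Qed.

Lemma cintegral_sum D I (s : seq I) (F : I -> R -> R[i]) : measurable D ->
  (forall i, cint D (F i)) ->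
  cintegral D (fun x => \sum_(i <- s) F i x) = \sum_(i <- s) cintegral D (F i).
Proof.
move=> mD rF; apply: complex_ext; rewrite ?Re_sum ?Im_sum /cintegral /= -Rint_sum// ?Re_sum//.
- by apply: Rint_eq => x _; rewrite Re_sum.
- by move=> i; have [] := rF i.
- by apply: Rint_eq => x _; rewrite Im_sum.
- by move=> i; have [] := rF i.
Qed.

Lemma cintegral_real D (f : R -> R) :
  cintegral D (fun x => (f x)%:C) = (\int[leb]_(x in D) f x)%:C.
Proof. by apply: complex_ext; rewrite /cintegral /= ?Rint0. Qed.

Lemma cmeasurableM D f g : measurable D -> cmeasurable D f -> cmeasurable D g ->
  cmeasurable D (fun x => f x * g x).
Proof.
move=> mD [a b] [c d]; split.
  under eq_fun do rewrite ReM; apply: measurable_funB => //; exact: measurable_funM.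
under eq_fun do rewrite ImM; apply: measurable_funD => //; exact: measurable_funM.
Qed.

Lemma cmeasurableD D f g : measurable D -> cmeasurable D f -> cmeasurable D g ->
  cmeasurable D (fun x => f x + g x).
Proof.
by move=> mD [a b] [c d]; split; [under eq_fun do rewrite ReD|under eq_fun do rewrite ImD];
  exact: measurable_funD.
Qed.

Lemma cmeasurable_cst D (c : R[i]) : cmeasurable D (fun=> c).
Proof. by split; exact: measurable_cst. Qed.

Lemma cmeasurable_real D (f : R -> R) : measurable_fun D f -> cmeasurable D (fun x => (f x)%:C).
Proof. by move=> mf; split => //=; exact: measurable_cst. Qed.

(** The factor 2 is the price of bounding the real and the imaginary part separately. *)
Lemma cintegral_norm_le D f (g : R -> R) : measurable D -> cmeasurable D f ->
  (forall x, D x -> normc (f x) <= g x) -> rint D g ->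
  normc (cintegral D f) <= 2 * \int[leb]_(x in D) g x.
Proof.
move=> mD [m1 m2] fg rg; apply: le_trans (normc_le_ReIm _) _.
rewrite mulr2n mulrDl mul1r; apply: lerD; apply: Rint_norm_le => // x Dx.
  exact: le_trans (Re_le_normc _) (fg x Dx).
exact: le_trans (Im_le_normc _) (fg x Dx).
Qed.

Lemma cdct D (f_ : nat -> R -> R[i]) f (g : R -> R) : measurable D ->
  (forall n, cmeasurable D (f_ n)) ->
  (forall n x, D x -> normc (f_ n x) <= g x) -> rint D g ->
  (forall x, D x -> ccvg (f_ ^~ x) (f x)) ->
  cint D f /\ ccvg (fun n => cintegral D (f_ n)) (cintegral D f).
Proof.
move=> mD mf fg rg ff.
have [||||r1 c1] := @rdct R D (fun n x => Re (f_ n x)) (fun x => Re (f x)) g mD => //.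
- by move=> n; have [] := mf n.
- by move=> n x Dx; exact: le_trans (Re_le_normc _) (fg n x Dx).
- by move=> x Dx; have [] := ff x Dx.
have [||||r2 c2] := @rdct R D (fun n x => Im (f_ n x)) (fun x => Im (f x)) g mD => //.
- by move=> n; have [] := mf n.
- by move=> n x Dx; exact: le_trans (Im_le_normc _) (fg n x Dx).
- by move=> x Dx; have [] := ff x Dx.
Qed.

End complex_integrals.

(** * The fundamental theorem of calculus for improper integrals *)

Section improper_FTC.
Variable R : realType.
Implicit Types (D : set R) (f F : R -> R) (a b : nat -> R).

Lemma is_derive_continuous F (x l : R) : is_derive x 1 F l -> {for x, continuous F}.
Proof. by move=> [h _]; exact/differentiable_continuous/derivable1_diffP. Qed.

Lemma FTC_itv f F (a b : R) : a < b ->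
  (forall x, a <= x <= b -> is_derive x 1 F (f x)) ->
  (forall x, a <= x <= b -> {for x, continuous f}) ->
  (\int[leb]_(x in `[a, b]) (f x)%:E = (F b - F a)%:E)%E.
Proof.
move=> ab dF cf; rewrite (@continuous_FTC2 _ f F)//.
- apply: continuous_in_subspaceT => x; rewrite inE /= in_itv /= => h; exact: cf.
- split.
  + move=> x; rewrite in_itv /= => /andP[ax xb].
    by have [] := dF x (introT andP (conj (ltW ax) (ltW xb))).
  + apply: cvg_at_right_filter; apply: (is_derive_continuous (dF _ _)).
    by rewrite lexx ltW.
  + apply: cvg_at_left_filter; apply: (is_derive_continuous (dF _ _)).
    by rewrite lexx ltW.
- move=> x; rewrite in_itv /= => /andP[ax xb].
  have := dF x (introT andP (conj (ltW ax) (ltW xb))).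
  by move=> [_ <-]; rewrite derive1E.
Qed.

Lemma FTC_exhausts a b D f F (l0 l1 : R) : measurable D -> exhausts a b D ->
  (forall x, D x -> is_derive x 1 F (f x)) ->
  (forall x, D x -> {for x, continuous f}) ->
  F (a n) @[n --> \oo] --> l0 -> F (b n) @[n --> \oo] --> l1 ->
  rint D f -> \int[leb]_(x in D) f x = l1 - l0.
Proof.
move=> mD ex dF cf Fa Fb rf.
apply: (cvg_unique _ (exhausts_cvg mD ex rf)) => //.
have [ab abD _ _ _] := ex.
have E n : \int[leb]_(x in `[a n, b n]) f x = F (b n) - F (a n).
  rewrite /Rintegral (@FTC_itv f F _ _ (ab n) (fun x h => dF x (abD n x _))
    (fun x h => cf x (abD n x _)))//; by rewrite /= in_itv.
by move: (funext E) => /= ->; exact: cvgB.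
Qed.

(** For a nonnegative integrand a bound on the increments of an antiderivative already gives
    integrability, by monotone convergence. All basic integrability facts below start from here. *)
Lemma ge0_FTC_exhausts a b D f F (B : R) : measurable D -> exhausts a b D ->
  measurable_fun D f -> (forall x, D x -> 0 <= f x) ->
  (forall x, D x -> is_derive x 1 F (f x)) ->
  (forall x, D x -> {for x, continuous f}) ->
  (forall n, F (b n) - F (a n) <= B) -> rint D f.
Proof.
move=> mD ex mf f0 dF cf FB.
have [ab abD _ _ _] := ex.
apply: (@ge0_exhausts_rint _ a b D f B) => // n.
rewrite (@FTC_itv f F _ _ (ab n) (fun x h => dF x (abD n x _))
    (fun x h => cf x (abD n x _)))// ?lee_fin ?FB//; try by rewrite /= in_itv.
Qed.

Lemma measurable_Rpos : measurable (@Rpos R).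
Proof. exact: measurable_itv. Qed.

Lemma Rpos_gt0 (t : R) : Rpos t -> 0 < t.
Proof. by rewrite /Rpos /= in_itv /= andbT. Qed.

(** The offset between [n.+1] and [n.+2] keeps the first interval, [[1, 2]], nondegenerate. *)
Lemma exhausts_Rpos : exhausts (fun n => n.+1%:R^-1) (fun n => n.+2%:R) (@Rpos R).
Proof.
split.
- move=> n; apply: (@le_lt_trans _ _ 1); first by rewrite invf_le1 ?ler1n ?ltr0n.
  by rewrite ltr1n.
- move=> n x; rewrite /Rpos /= !in_itv /= andbT => /andP[h _]; apply: lt_le_trans h.
  by rewrite invr_gt0.
- move=> x; rewrite /Rpos /= in_itv /= andbT => x0; near=> n; apply/andP; split.
    near: n; have := near_infty_natSinv_lt (PosNum x0) => /=.
    by apply: filterS => n /ltW.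
  near: n; have [N _ h] := nbhs_infty_ger x; exists N => // n Nn /=.
  by apply: le_trans (h n Nn) _; rewrite ler_nat; do 2 apply: ltnW.
- by move=> m n mn; rewrite lef_pV2 ?posrE// ler_nat ltnS.
- by move=> m n mn; rewrite ler_nat !ltnS.
Unshelve. all: by end_near. Qed.

(** Starting with [1 / 3] keeps the left endpoint below [1 / 2] and the right one above it. *)
Lemma exhausts_01 :
  exhausts (fun n => n.+3%:R^-1) (fun n => 1 - n.+3%:R^-1) (`]0, 1[%classic : set R).
Proof.
have h2 n : n.+3%:R^-1 < 2^-1 :> R by rewrite ltf_pV2 ?posrE// ltr_nat.
have h0 n : 0 < n.+3%:R^-1 :> R by rewrite invr_gt0.
have key x : 0 < x -> \forall n \near \oo, n.+3%:R^-1 <= x :> R.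
  move=> x0; have := near_infty_natSinv_lt (PosNum x0) => /=.
  move=> [N _ h]; exists N => // n Nn /=; apply: ltW; have := h n.+2; apply.
  by rewrite /=; apply: (leq_trans Nn); do 2 apply: ltnW.
split.
- by move=> n; have := h2 n; move: (n.+3%:R^-1) => y; lra.
- move=> n x; rewrite /= !in_itv /= => /andP[]; have := h2 n; have := h0 n; move: (n.+3%:R^-1) => y *.
  by apply/andP; split; lra.
- move=> x; rewrite /= in_itv /= => /andP[x0 x1]; near=> n; apply/andP; split.
    by near: n; exact: key.
  suff : n.+3%:R^-1 <= 1 - x by move: (n.+3%:R^-1) => y; lra.
  by near: n; apply: key; lra.
- by move=> m n mn; rewrite lef_pV2 ?posrE// ler_nat !ltnS.
- by move=> m n mn; rewrite lerB// lef_pV2 ?posrE// ler_nat !ltnS.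
Unshelve. all: by end_near. Qed.

Lemma measurable_01 : measurable (`]0, 1[%classic : set R).
Proof. exact: measurable_itv. Qed.

End improper_FTC.
#[global] Hint Resolve measurable_Rpos measurable_01 : core.

(** * Derivatives, real and complex powers *)

Section derivatives.
Variable R : realType.
Implicit Types (f g : R -> R) (x a b : R).

Lemma deriv_eq f x a b : is_derive x 1 f a -> a = b -> is_derive x 1 f b.
Proof. by move=> + <-. Qed.
Lemma deriv_mul f g x a b : is_derive x 1 f a -> is_derive x 1 g b ->
  is_derive x 1 (fun t => f t * g t) (a * g x + f x * b).
Proof.
move=> fa gb; apply: (@deriv_eq _ _ (f x *: b + g x *: a)).
by rewrite addrC; congr (_ + _); rewrite /GRing.scale /= mulrC.
Qed.
Lemma deriv_add f g x a b : is_derive x 1 f a -> is_derive x 1 g b ->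
  is_derive x 1 (fun t => f t + g t) (a + b).
Proof. by move=> fa gb; exact: (is_deriveD fa gb). Qed.
Lemma deriv_opp f x a : is_derive x 1 f a -> is_derive x 1 (fun t => - f t) (- a).
Proof. by move=> fa; exact: (is_deriveN fa). Qed.
Lemma deriv_sub f g x a b : is_derive x 1 f a -> is_derive x 1 g b ->
  is_derive x 1 (fun t => f t - g t) (a - b).
Proof. by move=> fa gb; apply: deriv_add => //; exact: deriv_opp. Qed.
Lemma deriv_cst x a : is_derive x 1 (fun=> a) 0.
Proof. exact: is_derive_cst. Qed.
Lemma deriv_id x : is_derive x 1 (fun t : R => t) 1.
Proof. exact: is_derive_id. Qed.
Lemma deriv_scale c f x a : is_derive x 1 f a -> is_derive x 1 (fun t => c * f t) (c * a).
Proof.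
move=> fa; apply: deriv_eq (deriv_mul (deriv_cst x c) fa) _.
by rewrite mul0r add0r.
Qed.
Lemma deriv_comp f g x a b : is_derive (g x) 1 f a -> is_derive x 1 g b ->
  is_derive x 1 (fun t => f (g t)) (a * b).
Proof. by move=> fa gb; exact: (is_derive1_comp fa gb). Qed.
Lemma deriv_expR f x a : is_derive x 1 f a ->
  is_derive x 1 (fun t => expR (f t)) (expR (f x) * a).
Proof. by move=> fa; exact: (deriv_comp (is_derive_expR (f x)) fa). Qed.

Lemma continuous_mul f g x : {for x, continuous f} -> {for x, continuous g} ->
  {for x, continuous (fun t => f t * g t)}.
Proof. by move=> cf cg; exact: cvgM. Qed.
Lemma continuous_add f g x : {for x, continuous f} -> {for x, continuous g} ->
  {for x, continuous (fun t => f t + g t)}.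
Proof. by move=> cf cg; exact: cvgD. Qed.
Lemma continuous_sub f g x : {for x, continuous f} -> {for x, continuous g} ->
  {for x, continuous (fun t => f t - g t)}.
Proof. by move=> cf cg; exact: cvgB. Qed.

Lemma expR_ge_exp n x : 0 <= x -> x ^+ n <= n`!%:R * expR x.
Proof.
move=> x0; case: n => [|n].
  rewrite expr0 fact0 mul1r; apply: le_trans (expR_ge1Dx x).
  by rewrite lerDl.
have := expR_ge1Dxn n x0 => h.
rewrite mulrC -ler_pdivrMr ?ltr0n ?fact_gt0//; apply: le_trans h.
by rewrite lerDr.
Qed.

End derivatives.

Section complex_power.
Variable R : realType.
Implicit Types (x y t : R) (z w : R[i]).

Lemma cpowD x z w : cpow x (z + w) = cpow x z * cpow x w.
Proof.
apply: complex_ext; rewrite ?ReM ?ImM /cpow /= ReD ImD !mulrDl expRD ?cosD ?sinD; ring.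
Qed.
Lemma cpow0 x : cpow x 0 = 1.
Proof. by apply: complex_ext; rewrite /cpow /= !mul0r expR0 ?cos0 ?sin0 ?mulr1 ?mulr0. Qed.
Lemma cpow1 x : 0 < x -> cpow x 1 = x%:C.
Proof.
by move=> x0; apply: complex_ext; rewrite /cpow /= mul0r mul1r lnK ?posrE// ?cos0 ?sin0 ?mulr1 ?mulr0.
Qed.
Lemma cpow_nat x n : 0 < x -> cpow x n%:R = (x ^+ n)%:C.
Proof.
by move=> x0; elim: n => [|n ih]; rewrite ?cpow0// -natr1 cpowD ih cpow1// exprSr realcM.
Qed.
Lemma cpow_real x a : 0 < x -> cpow x a%:C = (x `^ a)%:C.
Proof.
move=> x0; apply: complex_ext; rewrite /cpow /= mul0r ?cos0 ?sin0 ?mulr1 ?mulr0//.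
by rewrite /powR gt_eqF.
Qed.
Lemma normc_cpow x z : 0 < x -> normc (cpow x z) = x `^ Re z.
Proof.
move=> x0; rewrite normcE /cpow /= !exprMn -mulrDr cos2Dsin2 mulr1 sqrtr_sqr.
by rewrite ger0_norm ?expR_ge0// /powR gt_eqF.
Qed.
Lemma cpowM x y z : 0 < x -> 0 < y -> cpow (x * y) z = cpow x z * cpow y z.
Proof.
move=> x0 y0; apply: complex_ext; rewrite ?ReM ?ImM /cpow /= lnM ?posrE//;
  rewrite !mulrDr expRD ?cosD ?sinD; ring.
Qed.
Lemma cpow_sqrt x z : 0 < x -> cpow (Num.sqrt x) (z + z) = cpow x z.
Proof.
by move=> x0; rewrite -{2}(sqr_sqrtr (ltW x0)) expr2 cpowM ?sqrtr_gt0// cpowD.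
Qed.
Lemma cpow_neq0 x z : 0 < x -> cpow x z != 0.
Proof.
move=> x0; apply/eqP => h; have := normc_cpow z x0.
by rewrite h ComplexField.Normc.normc0 => /esym/eqP; rewrite gt_eqF// powR_gt0.
Qed.
Lemma cpowB1 x z : 0 < x -> cpow x (z - 1) = cpow x z * (x^-1)%:C.
Proof.
move=> x0; have -> : cpow x z = cpow x (z - 1) * cpow x 1 by rewrite -cpowD subrK.
rewrite cpow1// -mulrA -realcM mulfV ?gt_eqF//.
by rewrite mulr1.
Qed.
Lemma cpow1r z : cpow 1 z = 1.
Proof. by apply: complex_ext; rewrite /cpow /= ln1 !mulr0 expR0 ?cos0 ?sin0 ?mulr1 ?mulr0. Qed.

Lemma deriv_Re_cpow z x : 0 < x ->
  is_derive x 1 (fun t => Re (cpow t z)) (Re (z * cpow x (z - 1))).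
Proof.
move=> x0; rewrite cpowB1//.
have dl a : is_derive x 1 (fun t => a * ln t) (a * x^-1).
  by apply: deriv_scale; exact: is_derive1_ln.
apply: deriv_eq (deriv_mul (deriv_expR (dl (Re z)))
   (@deriv_comp _ cos _ _ _ _ (is_derive_cos _) (dl (Im z)))) _.
by rewrite [z * _]mulrA ReZr ReM /cpow /=; ring.
Qed.
Lemma deriv_Im_cpow z x : 0 < x ->
  is_derive x 1 (fun t => Im (cpow t z)) (Im (z * cpow x (z - 1))).
Proof.
move=> x0; rewrite cpowB1//.
have dl a : is_derive x 1 (fun t => a * ln t) (a * x^-1).
  by apply: deriv_scale; exact: is_derive1_ln.
apply: deriv_eq (deriv_mul (deriv_expR (dl (Re z)))
   (@deriv_comp _ sin _ _ _ _ (is_derive_sin _) (dl (Im z)))) _.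
by rewrite [z * _]mulrA ImZr ImM /cpow /=; ring.
Qed.

Lemma measurable_lincomp D (h : R -> R) a : measurable_fun setT h ->
  measurable_fun D (fun t => h (a * t)).
Proof.
move=> mh; apply: (@measurable_funS _ _ _ _ setT) => //.
by apply: measurableT_comp mh _; exact: measurable_funM.
Qed.
Lemma measurable_expN D x : measurable_fun D (fun t : R => expR (- (x * t))).
Proof.
have := @measurable_lincomp D expR (- x) (@measurable_expR R).
by under eq_fun do rewrite mulNr.
Qed.
Lemma measurable_powR_on D a : measurable_fun D (fun t : R => t `^ a).
Proof. by apply: (@measurable_funS _ _ _ _ setT) => //; exact: measurable_powR. Qed.
Lemma cmeasurable_cpow D z : cmeasurable D (fun t => cpow t z).
Proof.
have m (h : R -> R) a : measurable_fun setT h -> measurable_fun D (fun t : R => h (a * ln t)).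
  move=> mh; apply: (@measurable_funS _ _ _ _ setT) => //.
  apply: measurableT_comp mh _; apply: measurable_funM => //; exact: measurable_ln.
by split; apply: measurable_funM; apply: m;
  [exact: measurable_expR|apply: continuous_measurable_fun; exact: continuous_cos|
   exact: measurable_expR|apply: continuous_measurable_fun; exact: continuous_sin].
Qed.

Lemma powR_natinv_cvg0 (a : R) : 0 < a -> (n.+1%:R^-1 : R) `^ a @[n --> \oo] --> 0.
Proof.
move=> a0; apply/cvgrPdist_le => e e0; near=> n.
rewrite sub0r normrN ger0_norm ?powR_ge0//.
have -> : e = (e `^ a^-1) `^ a by rewrite -powRrM mulVf ?gt_eqF// powRr1// ltW.
apply: ge0_ler_powR; rewrite ?nnegrE ?powR_ge0// ?invr_ge0// ?ltW//.
near: n; have := near_infty_natSinv_lt (PosNum (powR_gt0 a^-1 e0)) => /=.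
by apply: filterS => n; rewrite ?ltW.
Unshelve. all: by end_near. Qed.

Lemma powR_le_expR (a c : R) : 0 <= a -> 0 < c ->
  exists2 C, 0 <= C & forall t, 0 < t -> (1 + t) `^ a <= C * expR (c * t).
Proof.
move=> a0 c0; have := archi_boundP a0; set N := Num.bound a => /ltW aN.
(* The exponent [a] is raised to a natural number [N], and then
   [(c (1 + t)) ^ N <= N! exp (c (1 + t))]. *)
exists (N`!%:R * (c^-1) ^+ N * expR c).
  by rewrite !mulr_ge0// ?exprn_ge0 ?invr_ge0 ?ltW// expR_gt0.
move=> t t0; have t1 : 0 <= 1 + t by rewrite addr_ge0// ltW.
have h : (1 + t) `^ a <= (1 + t) ^+ N.
  rewrite -powR_mulrn//; apply: ler_powR => //; by rewrite lerDl ltW.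
apply: le_trans h _.
have := expR_ge_exp N (mulr_ge0 (ltW c0) t1).
rewrite exprMn mulrDr mulr1 expRD => h.
rewrite -(@ler_pM2l _ (c ^+ N)) ?exprn_gt0//; apply: le_trans h _.
have E : c ^+ N * c^-1 ^+ N = 1 by rewrite -exprMn mulfV ?gt_eqF// expr1n.
rewrite [leRHS](_ : _ = c ^+ N * c^-1 ^+ N * (N`!%:R * (expR c * expR (c * t)))); last by ring.
by rewrite E mul1r.
Qed.

End complex_power.

(** * The Gamma function *)

Section Gamma_function.
Variable R : realType.
Implicit Types (a x t : R) (z w : R[i]).

Lemma continuous_powR a t : 0 < t -> {for t, continuous (fun s : R => s `^ a)}.
Proof. by move=> t0; exact: is_derive_continuous (is_derive1_powR a t0). Qed.

(** The integrand is the derivative of [(t / (1 + t)) ^ a / a], which stays below [1 / a]. It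
    behaves like [t ^ (a - 1)] at 0 and like [t ^ -2] at infinity, so one antiderivative yields a
    majorant of the Gamma integrand at both ends. *)
Lemma rint_beta_tail a : 0 < a -> rint (@Rpos R) (fun t => t `^ (a - 1) * (1 + t) `^ (- a - 1)).
Proof.
move=> a0.
have pos t : (@Rpos R) t -> 0 < t /\ 0 < 1 + t.
  by rewrite /Rpos /= in_itv /= andbT => t0; split => //; lra.
have d1 (t : R) : is_derive t 1 (fun s : R => 1 + s) 1.
  by apply: deriv_eq (deriv_add (deriv_cst t 1) (deriv_id t)) _; rewrite add0r.
have dF t : (@Rpos R) t -> is_derive t 1 (fun s => a^-1 * (s `^ a * (1 + s) `^ (- a)))
    (t `^ (a - 1) * (1 + t) `^ (- a - 1)).
  move=> /pos[t0 t1].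
  apply: deriv_eq (deriv_scale a^-1 (deriv_mul (is_derive1_powR a t0)
    (deriv_comp (is_derive1_powR (- a) t1) (d1 t)))) _.
  rewrite mulr1.
  have -> : (1 + t) `^ (- a) = (1 + t) `^ (- a - 1) * (1 + t).
    by rewrite -{3}[1 + t]powRr1 ?ltW// -powRD ?subrK//; apply/implyP => _; rewrite gt_eqF.
  have -> : t `^ a = t `^ (a - 1) * t.
    by rewrite -{3}[t]powRr1 ?ltW// -powRD ?subrK//; apply/implyP => _; rewrite gt_eqF.
  by field; rewrite gt_eqF.
have cf t : (@Rpos R) t -> {for t, continuous (fun t : R => t `^ (a - 1) * (1 + t) `^ (- a - 1))}.
  move=> /pos[t0 t1]; apply: continuous_mul; first exact: continuous_powR.
  exact: is_derive_continuous (deriv_comp (is_derive1_powR (- a - 1) t1) (d1 t)).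
apply: (@ge0_FTC_exhausts R _ _ _ _ (fun s => a^-1 * (s `^ a * (1 + s) `^ (- a))) a^-1 _ (exhausts_Rpos R)) => //.
- apply: measurable_funM; first exact: measurable_powR_on.
  apply: (@measurable_funS _ _ _ _ setT) => //.
  by apply: measurableT_comp (measurable_powR _) _; exact: measurable_funD.
- by move=> t _; rewrite mulr_ge0// powR_ge0.
move=> n; rewrite lerBlDr -[leLHS]addr0; apply: lerD; last first.
  by rewrite !mulr_ge0 ?invr_ge0 ?powR_ge0 ?(ltW a0).
rewrite -[leRHS]mulr1 ler_pM2l ?invr_gt0// powRN ler_pdivrMr ?powR_gt0// mul1r.
by apply: ge0_ler_powR; rewrite ?nnegrE ?(ltW a0)// lerDr.
Qed.

Lemma rint_gamma a x : 0 < a -> 0 < x ->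
  rint (@Rpos R) (fun t => t `^ (a - 1) * expR (- (x * t))).
Proof.
move=> a0 x0; have [C C0 hC] := powR_le_expR (a := a + 1) (ltW (addr_gt0 a0 ltr01)) x0.
apply: (@rint_dom _ _ _ (fun t => C * (t `^ (a - 1) * (1 + t) `^ (- a - 1)))) => //.
- by apply: measurable_funM; [exact: measurable_powR_on|exact: measurable_expN].
- move=> t; rewrite /Rpos /= in_itv /= andbT => t0.
  rewrite ger0_norm ?mulr_ge0 ?powR_ge0 ?expR_ge0//.
  rewrite mulrCA ler_wpM2l ?powR_ge0//.
  rewrite -opprD powRN expRN ler_pdivlMr ?powR_gt0 ?addr_gt0// mulrC.
  by rewrite ler_pdivrMr ?expR_gt0// hC.
- by apply: rintZ => //; exact: rint_beta_tail.
Qed.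

Lemma cint_gamma z x : 0 < Re z -> 0 < x ->
  cint (@Rpos R) (fun t => cpow t (z - 1) * (expR (- (x * t)))%:C).
Proof.
move=> z0 x0; apply: (@cint_dom _ _ _ (fun t => t `^ (Re z - 1) * expR (- (x * t)))) => //.
- apply: cmeasurableM => //; first exact: cmeasurable_cpow.
  apply: cmeasurable_real; exact: measurable_expN.
- move=> t; rewrite /Rpos /= in_itv /= andbT => t0.
  rewrite ComplexField.Normc.normcM normc_cpow// normc_real ger0_norm ?expR_ge0//.
  by rewrite ReB.
- exact: rint_gamma.
Qed.

Lemma Gamma_real a : 0 < a -> Gamma a%:C = (rGamma a)%:C.
Proof.
move=> a0; rewrite /Gamma /rGamma -cintegral_real; apply: cintegral_eq => t.
rewrite /Rpos /= in_itv /= andbT => t0.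
by rewrite realcM -cpow_real// realcB.
Qed.

Lemma powR_exp_cvg0 (a : R) : 0 <= a ->
  (n.+2%:R `^ a * expR (- n.+2%:R) : R) @[n --> \oo] --> 0.
Proof.
(* Half of the exponential decay absorbs the power; the other half leaves the bound
   [2 C / (n + 1)]. *)
move=> a0; have [C C0 hC] := powR_le_expR (c := 2^-1) a0 (ltac:(by [])).
apply: (@squeeze_cvgr _ _ _ _ (fun=> 0) (fun n => C * (2 * n.+1%:R^-1))).
- near=> n; rewrite mulr_ge0 ?powR_ge0 ?expR_ge0//=.
  have n0 : 0 < n.+1%:R :> R by rewrite ltr0n.
  have h : n.+2%:R `^ a <= C * expR (2^-1 * n.+1%:R) by have := hC _ n0; rewrite nat1r.
  apply: (@le_trans _ _ (C * expR (2^-1 * n.+1%:R) * expR (- n.+1%:R))).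
    by apply: ler_pM; rewrite ?powR_ge0 ?expR_ge0// ler_expR lerN2 ler_nat.
  rewrite -mulrA ler_wpM2l// -expRD.
  have -> : 2^-1 * n.+1%:R - n.+1%:R = - (2^-1 * n.+1%:R) :> R by field.
  rewrite expRN -[leRHS]invrK lef_pV2 ?posrE ?expR_gt0 ?invr_gt0 ?mulr_gt0 ?invr_gt0//.
  rewrite invfM invrK; apply: le_trans (expR_ge1Dx _); by rewrite lerDr.
- exact: cvg_cst.
- rewrite -[X in _ --> X](mulr0 C); apply: cvgMr; rewrite -[X in _ --> X](mulr0 2); apply: cvgMr.
  exact: cvg_harmonic.
Unshelve. all: by end_near. Qed.

Lemma GammaS z : 0 < Re z -> Gamma (z + 1) = z * Gamma z.
Proof.
move=> z0.
have i0 := cint_gamma z0 (ltr01 : 0 < 1 :> R).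
have z1 : 0 < Re (z + 1) by rewrite ReD /= addr_gt0.
have j0 := cint_gamma z1 (ltr01 : 0 < 1 :> R).
(* [f] is the derivative of [t ^ z exp (- t)], which tends to zero at both ends of the half-line
   because [0 < Re z]. *)
pose f t := z * (cpow t (z - 1) * (expR (- (1 * t)))%:C) -
            cpow t (z + 1 - 1) * (expR (- (1 * t)))%:C.
have fint : cint (@Rpos R) f by apply: cintB => //; exact: cintZ.
have pos t : (@Rpos R) t -> 0 < t by rewrite /Rpos /= in_itv /= andbT.
have de (t : R) : is_derive t 1 (fun s : R => expR (- s)) (- expR (- t)).
  by apply: deriv_eq (deriv_expR (deriv_opp (deriv_id t))) _; rewrite mulrN1.
have ce (t : R) : {for t, continuous (fun s : R => expR (- s))} by exact: is_derive_continuous (de t).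
have ReF t : Re (f t) = Re (z * cpow t (z - 1)) * expR (- t) - Re (cpow t z) * expR (- t).
  by rewrite /f mul1r addrK mulrA ReB !ReZr.
have ImF t : Im (f t) = Im (z * cpow t (z - 1)) * expR (- t) - Im (cpow t z) * expR (- t).
  by rewrite /f mul1r addrK mulrA ImB !ImZr.
have cR w t : 0 < t -> {for t, continuous (fun s => Re (cpow s w))}.
  by move=> t0; exact: is_derive_continuous (deriv_Re_cpow w t0).
have cI w t : 0 < t -> {for t, continuous (fun s => Im (cpow s w))}.
  by move=> t0; exact: is_derive_continuous (deriv_Im_cpow w t0).
have lim0 : ccvg (fun n => cpow n.+1%:R^-1 z * (expR (- n.+1%:R^-1))%:C) 0.
  apply: (@ccvg_norm0 _ _ _ (fun n => n.+1%:R^-1 `^ Re z)); last exact: powR_natinv_cvg0.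
  move=> n; rewrite subr0 ComplexField.Normc.normcM normc_cpow// normc_real.
  have e1 : expR (- n.+1%:R^-1) <= 1 :> R.
    by rewrite -[leRHS](@expR0 R) ler_expR oppr_le0 invr_ge0.
  by rewrite ger0_norm ?expR_ge0// ler_piMr ?powR_ge0.
have lim1 : ccvg (fun n => cpow n.+2%:R z * (expR (- n.+2%:R))%:C) 0.
  apply: (@ccvg_norm0 _ _ _ (fun n => n.+2%:R `^ Re z * expR (- n.+2%:R))); last first.
    exact: powR_exp_cvg0 (ltW z0).
  move=> n; rewrite subr0 ComplexField.Normc.normcM normc_cpow// normc_real.
  by rewrite ger0_norm ?expR_ge0.
have dR t : (@Rpos R) t -> is_derive t 1 (fun t => Re (cpow t z) * expR (- t)) (Re (f t)).
  move=> /pos t0; rewrite ReF; apply: deriv_eq (deriv_mul (deriv_Re_cpow z t0) (de t)) _.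
  by rewrite mulrN.
have dI t : (@Rpos R) t -> is_derive t 1 (fun t => Im (cpow t z) * expR (- t)) (Im (f t)).
  move=> /pos t0; rewrite ImF; apply: deriv_eq (deriv_mul (deriv_Im_cpow z t0) (de t)) _.
  by rewrite mulrN.
have cfR t : (@Rpos R) t -> {for t, continuous (fun t => Re (f t))}.
  move=> /pos t0; rewrite (funext ReF); apply: continuous_sub; apply: continuous_mul => //; last exact: cR.
  rewrite (funext (fun s => ReM z (cpow s (z - 1)))).
  by apply: continuous_sub; apply: continuous_mul; (try exact: cst_continuous); [exact: cR|exact: cI].
have cfI t : (@Rpos R) t -> {for t, continuous (fun t => Im (f t))}.
  move=> /pos t0; rewrite (funext ImF); apply: continuous_sub; apply: continuous_mul => //; last exact: cI.
  rewrite (funext (fun s => ImM z (cpow s (z - 1)))).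
  by apply: continuous_add; apply: continuous_mul; (try exact: cst_continuous); [exact: cI|exact: cR].
have E : cintegral (@Rpos R) f = 0.
  move: lim0 lim1 => [l0R l0I] [l1R l1I]; move: fint => [fR fI].
  have {}l0R : Re (cpow n.+1%:R^-1 z) * expR (- n.+1%:R^-1) @[n --> \oo] --> (0 : R).
    by move: l0R; under eq_fun do rewrite ReZr.
  have {}l1R : Re (cpow n.+2%:R z) * expR (- n.+2%:R) @[n --> \oo] --> (0 : R).
    by move: l1R; under eq_fun do rewrite ReZr.
  have {}l0I : Im (cpow n.+1%:R^-1 z) * expR (- n.+1%:R^-1) @[n --> \oo] --> (0 : R).
    by move: l0I; under eq_fun do rewrite ImZr.
  have {}l1I : Im (cpow n.+2%:R z) * expR (- n.+2%:R) @[n --> \oo] --> (0 : R).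
    by move: l1I; under eq_fun do rewrite ImZr.
  apply: complex_ext; rewrite /cintegral /=.
    by rewrite (FTC_exhausts (@measurable_Rpos R) (exhausts_Rpos R) dR cfR l0R l1R fR) subr0.
  by rewrite (FTC_exhausts (@measurable_Rpos R) (exhausts_Rpos R) dI cfI l0I l1I fI) subr0.
move: E; rewrite /f cintegralB//; last exact: cintZ.
rewrite cintegralZ// => /eqP; rewrite subr_eq0 => /eqP h.
rewrite /Gamma; transitivity (z * cintegral Rpos (fun t : R => cpow t (z - 1) * (expR (- (1 * t)))%:C)).
  by rewrite h; apply: cintegral_eq => t _; rewrite mul1r.
apply: (congr1 (fun v => z * v)); apply: cintegral_eq => t _.
by rewrite mul1r.
Qed.

Lemma rGammaS a : 0 < a -> rGamma (a + 1) = a * rGamma a.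
Proof.
move=> a0; have := @GammaS a%:C a0.
rewrite -[1 in LHS]/(1%:C) -realcD !Gamma_real ?addr_gt0// -realcM => /(congr1 (@complex.Re R)).
by [].
Qed.

Lemma rGamma_gt0 a : 0 < a -> 0 < rGamma a.
Proof.
move=> a0; have a1 : 0 < a + 1 by rewrite addr_gt0.
(* After the shift the integrand is [t ^ a exp (- t)] with [a > 0], hence at least [exp (- 2)] on
   the interval [[1, 2]] of length one. *)
suff h : 0 < rGamma (a + 1) by move: h; rewrite rGammaS// pmulr_rgt0.
have r := rint_gamma a1 (ltr01 : 0 < 1 :> R).
rewrite -lte_fin (@lt_le_trans _ _ (expR (- 2))%:E)//; first by rewrite lte_fin expR_gt0.
have -> : (rGamma (a + 1))%:E = (\int[leb]_(t in Rpos) (t `^ (a + 1 - 1) * expR (- (1 * t)))%:E)%E.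
  rewrite /rGamma /Rintegral fineK.
    by apply: eq_integral => t _; rewrite mul1r.
  have := integrable_fin_num (mu := leb) (@measurable_Rpos R) r.
  by under eq_integral do rewrite /= mul1r.
have E : (expR (- 2))%:E = (\int[leb]_(t in (`[1%R, 2%R]%classic : set R)) (expR (- 2) : R)%:E)%E.
  have d2 (t : R) : (1 <= t <= 2)%R -> is_derive t 1 (fun t => expR (- 2) * t)%R (expR (- 2) : R).
    by move=> _; apply: deriv_eq (deriv_scale _ (deriv_id t)) _; rewrite mulr1.
  rewrite (FTC_itv (ltr1n R 2) d2) => [|t _]; last exact: cst_continuous.
  by rewrite mulr1 mulr_natr mulr2n addrK.
rewrite E; apply: (@le_trans _ _ (\int[leb]_(t in (`[1%R, 2%R]%classic : set R)) (t `^ (a + 1 - 1) * expR (- (1 * t)))%:E)%E).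
  apply: ge0_le_integral => //.
  - apply/measurable_EFinP; apply: measurable_funM; [exact: measurable_powR_on|exact: measurable_expN].
  - move=> t; rewrite /= in_itv /= => /andP[t1 t2]; rewrite lee_fin mul1r addrK.
    rewrite -[leLHS]mul1r; apply: ler_pM; rewrite ?expR_ge0 ?ler_expR ?lerN2//.
    have : 1 `^ a <= t `^ a.
      by apply: ge0_ler_powR; rewrite ?nnegrE ?(ltW a0) ?ler01 ?(le_trans ler01 t1).
    by rewrite powR1.
apply: ge0_subset_integral => //.
- exact: measurable_Rpos.
- apply/measurable_EFinP; apply: measurable_funM; [exact: measurable_powR_on|exact: measurable_expN].
- by move=> t _; rewrite lee_fin mulr_ge0 ?powR_ge0 ?expR_ge0.
- by move=> t; rewrite /Rpos /= !in_itv /= andbT => /andP[t1 _]; rewrite (lt_le_trans _ t1).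
Qed.

(** Substitution [s = x t] on the exhausting intervals; their images again exhaust the half-line, so
    both sides pass to the limit. *)
Lemma rGamma_scale a x : 0 < a -> 0 < x ->
  \int[leb]_(t in Rpos) (t `^ (a - 1) * expR (- (x * t))) = rGamma a * x `^ (- a).
Proof.
move=> a0 x0.
have r1 := rint_gamma a0 (ltr01 : 0 < 1 :> R).
have rx := rint_gamma a0 x0.
have [ab abD Dab adec binc] := exhausts_Rpos R.
have pos t : (@Rpos R) t -> 0 < t by rewrite /Rpos /= in_itv /= andbT.
pose aa n : R := n.+1%:R^-1; pose bb n : R := n.+2%:R.
have ex2 : exhausts (fun n => x * aa n) (fun n => x * bb n) Rpos.
  split.
  - by move=> n; rewrite ltr_pM2l//; exact: ab.
  - move=> n t; rewrite /Rpos /= !in_itv /= andbT => /andP[h _]; apply: lt_le_trans h.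
    by rewrite mulr_gt0// invr_gt0.
  - move=> t /pos t0; have : Rpos (x^-1 * t) by rewrite /Rpos /= in_itv /= andbT mulr_gt0// invr_gt0.
    move=> /Dab; apply: filterS => n /andP[h1 h2].
    by apply/andP; split; [have := h1|have := h2]; rewrite -(ler_pM2l x0) mulVKf ?gt_eqF.
  - by move=> m n mn; rewrite ler_pM2l// adec.
  - by move=> m n mn; rewrite ler_pM2l// binc.
have h1 := exhausts_cvg (@measurable_Rpos R) ex2 r1.
have h2 := exhausts_cvg (@measurable_Rpos R) (exhausts_Rpos R) rx.
have cc t : 0 < t -> {for t, continuous (fun t : R => t `^ (a - 1) * expR (- (1 * t)))}.
  move=> t0; apply: continuous_mul; first exact: continuous_powR.
  exact: is_derive_continuous (deriv_expR (deriv_opp (deriv_scale 1 (deriv_id t)))).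
have E n : \int[leb]_(t in `[x * aa n, x * bb n]) (t `^ (a - 1) * expR (- (1 * t))) =
    x `^ a * \int[leb]_(t in `[aa n, bb n]) (t `^ (a - 1) * expR (- (x * t))).
  rewrite -RintegralZl//; last first.
    by apply: (rintS _ _ (abD n) rx).
  have dx (t : R) : is_derive t 1 (fun t : R => x * t) x.
    by apply: deriv_eq (deriv_scale x (deriv_id t)) _; rewrite mulr1.
  have dxE : (fun t : R => x * t)^`()%classic = (fun=> x).
    by apply/funext => t; rewrite derive1E; have [_ ->] := dx t.
  rewrite /Rintegral (@integration_by_substitution_increasing R (fun t => x * t)
    (fun t => t `^ (a - 1) * expR (- (1 * t))) (aa n) (bb n)).
  - congr fine; apply: eq_integral => t; rewrite inE => /abD /pos t0 /=.
    rewrite dxE; congr (_%:E).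
    change ((x * t) `^ (a - 1) * expR (- (1 * (x * t))) * x = x `^ a * (t `^ (a - 1) * expR (- (x * t)))).
    rewrite powRM ?ltW// mul1r.
    have -> : x `^ a = x `^ (a - 1) * x.
      by rewrite -{3}[x]powRr1 ?ltW// -powRD ?subrK//; apply/implyP => _; rewrite gt_eqF.
    ring.
  - exact: ltW (ab n).
  - by move=> t s _ _; rewrite ltr_pM2l.
  - by move=> t _; rewrite dxE; exact: cst_continuous.
  - by rewrite dxE; apply/cvg_ex; exists x; exact: cvg_cst.
  - by rewrite dxE; apply/cvg_ex; exists x; exact: cvg_cst.
  - split; first by move=> t _; have [] := dx t.
      by apply: cvg_at_right_filter; exact: (is_derive_continuous (dx _)).
    by apply: cvg_at_left_filter; exact: (is_derive_continuous (dx _)).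
  - apply: continuous_in_subspaceT => t; rewrite inE /= in_itv /= => /andP[h _].
    have t0 : 0 < t by apply: lt_le_trans h; rewrite mulr_gt0// invr_gt0.
    exact: cc.
have h3 : x `^ a * \int[leb]_(t in `[aa n, bb n]) (t `^ (a - 1) * expR (- (x * t))) @[n --> \oo] -->
    x `^ a * \int[leb]_(t in Rpos) (t `^ (a - 1) * expR (- (x * t))) by apply: cvgMr; exact: h2.
move: h1; rewrite (funext E) => h1.
have := cvg_unique _ h1 h3 => h.
rewrite powRN; apply: (@mulfI _ (x `^ a)); first by rewrite gt_eqF ?powR_gt0.
rewrite -h// mulrCA mulfV ?gt_eqF ?powR_gt0// mulr1 /rGamma.
by apply: Rint_eq => t _; rewrite mul1r.
Qed.

End Gamma_function.

(** * Rising factorials and integrals of Laguerre polynomials *)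

Section rising_factorial.
Variable K : comNzRingType.
Implicit Types (a c y : K).

(** The Pochhammer symbol over any commutative ring, since both the real parameter [2 xi] and the
    complex parameter [2 q] occur; over [R[i]] it is convertible with [pochhammer]. *)
Definition rising a n : K := \prod_(j < n) (a + j%:R).

Lemma rising0 a : rising a 0 = 1. Proof. by rewrite /rising big_ord0. Qed.
Lemma risingSr a n : rising a n.+1 = rising a n * (a + n%:R).
Proof. by rewrite /rising big_ord_recr. Qed.
Lemma risingS a n : rising a n.+1 = a * rising (a + 1) n.
Proof.
rewrite /rising big_ord_recl addr0; congr (_ * _); apply: eq_bigr => i _.
by rewrite -addrA lift0 -nat1r.
Qed.
Lemma rising1 a : rising a 1 = a. Proof. by rewrite risingS rising0 mulr1. Qed.
Lemma rising_add a m n : rising a (m + n) = rising a m * rising (a + m%:R) n.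
Proof.
elim: n => [|n ih]; first by rewrite addn0 rising0 mulr1.
by rewrite addnS !risingSr ih natrD addrA mulrA.
Qed.
Lemma rising_diff a n : rising (a + 1) n.+1 - rising a n.+1 = n.+1%:R * rising (a + 1) n.
Proof. by rewrite risingSr risingS -natr1; ring. Qed.

(** Chu-Vandermonde, by induction on [m] through [c + (m + 1) = (c + 1) + m]. Written in falling
    factorials of [m], it turns sums over [m] against binomial coefficients or [1 / m!] into
    derivatives of [(1 + y) ^ k] or of the exponential. *)
Lemma rising_vandermonde c m l : rising (c + m%:R) l =
  \sum_(j < l.+1) ('C(l, j) * m ^_ j)%:R * rising (c + j%:R) (l - j).
Proof.
elim: m c l => [|m ih] c l.
  rewrite big_ord_recl /= big1 ?addr0 => [|i _]; last by rewrite ffact0n muln0 mul0r.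
  by rewrite bin0 ffactn0 muln1 mul1r subn0.
case: l => [|l].
  by rewrite big_ord1 bin0 ffactn0 muln1 mul1r !rising0.
have -> : c + m.+1%:R = c + 1 + m%:R by rewrite -nat1r addrA.
rewrite ih.
have -> : \sum_(j < l.+2) ('C(l.+1, j) * m.+1 ^_ j)%:R * rising (c + j%:R) (l.+1 - j) =
  \sum_(j < l.+2) ('C(l.+1, j) * m ^_ j)%:R * rising (c + j%:R) (l.+1 - j) +
  \sum_(j < l.+1) ('C(l.+1, j.+1) * (j.+1 * m ^_ j))%:R * rising (c + j.+1%:R) (l - j).
  rewrite !(big_ord_recl l.+1) /= !ffactn0 !addr0 -addrA; congr (_ + _).
  rewrite -big_split /=; apply: eq_bigr => i _.
  rewrite /bump leq0n add1n subSS -mulrDl -natrD -mulnDr; congr ((_ * _)%:R * _).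
  rewrite ffactSS ffactnSr; have [im|im] := leqP i m; last by rewrite ffact_small// !muln0 mul0n.
  by rewrite mulnC [(i.+1 * _)%N]mulnC -mulnDr addnS subnK.
apply/eqP; rewrite [X in _ == X]addrC -subr_eq -sumrB; apply/eqP.
rewrite big_ord_recr /= subnn !rising0 subrr addr0.
apply: eq_bigr => i _.
have il : (i <= l)%N by rewrite -ltnS.
rewrite -mulrBr subSn// [c + 1 + _]addrAC rising_diff mulrA -natrM.
have -> : c + i%:R + 1 = c + i.+1%:R by rewrite -natr1 addrA.
congr (_%:R * _).
have := mul_bin_left l.+1 i; rewrite subSn// => h.
by rewrite mulnAC [('C(_, _) * _)%N]mulnC -h mulnCA mulnA.
Qed.

(** This is [y ^ j] times the [j]-th derivative of the binomial formula for [(1 + y) ^ k]. *)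
Lemma binomial_ffact y k j :
  \sum_(l < k.+1) ('C(k, l) * l ^_ j)%:R * y ^+ l =
  (k ^_ j)%:R * y ^+ j * (1 + y) ^+ (k - j).
Proof.
elim: j k => [|j ih] k.
  rewrite ffactn0 mul1r expr0 mul1r subn0 exprDn.
  by apply: eq_bigr => i _; rewrite ffactn0 muln1 expr1n mul1r mulr_natl.
case: k => [|k].
  by rewrite big_ord1 !ffact0n muln0 !mul0r.
rewrite big_ord_recl /= ffact0n muln0 mul0r add0r subSS ffactSS natrM exprS.
have -> : k.+1%:R * (k ^_ j)%:R * (y * y ^+ j) * (1 + y) ^+ (k - j) =
  k.+1%:R * y * ((k ^_ j)%:R * y ^+ j * (1 + y) ^+ (k - j)) by ring.
rewrite -ih mulr_sumr; apply: eq_bigr => i _.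
rewrite /bump leq0n add1n ffactSS exprS mulnA [('C(_, _) * _)%N]mulnC -mul_bin_diag /=.
by rewrite !natrM; ring.
Qed.

Lemma binomial_rising c y k r :
  \sum_(l < k.+1) 'C(k, l)%:R * y ^+ l * rising (c + l%:R) r =
  \sum_(j < r.+1) 'C(r, j)%:R * rising (c + j%:R) (r - j) *
    ((k ^_ j)%:R * y ^+ j * (1 + y) ^+ (k - j)).
Proof.
under eq_bigr do rewrite rising_vandermonde mulr_sumr.
rewrite exchange_big /=; apply: eq_bigr => j _; rewrite -binomial_ffact mulr_sumr.
by apply: eq_bigr => l _; rewrite !natrM; ring.
Qed.

End rising_factorial.

(** * Laplace transforms, moments and orthogonality of Laguerre polynomials *)

Section laguerre_integrals.
Variable R : realType.
Variable xi : R.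
Hypothesis xi0 : 0 < xi.
Local Notation c := (2 * xi).
Local Notation w := (rdens xi).

Let c0 : 0 < c. Proof. by rewrite mulr_gt0. Qed.
Let cn0 n : 0 < n%:R + c. Proof. by rewrite ltr_wpDl. Qed.

Lemma measurable_rdens D : measurable_fun D w.
Proof.
apply: measurable_funM; first exact: measurable_powR_on.
by have := @measurable_expN R D 1; under eq_fun do rewrite mul1r.
Qed.

Lemma rdens_ge0 t : 0 <= w t. Proof. by rewrite mulr_ge0 ?powR_ge0 ?expR_ge0. Qed.
Lemma rdens_gt0 t : 0 < t -> 0 < w t.
Proof. by move=> t0; rewrite mulr_gt0 ?powR_gt0 ?expR_gt0. Qed.

Lemma moment_eq n x t : 0 < t -> t ^+ n * expR (- (x * t)) * w t =
  t `^ (n%:R + c - 1) * expR (- ((1 + x) * t)).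
Proof.
move=> t0; rewrite /rdens -addrA [in RHS]powRD; last by apply/implyP => _; rewrite gt_eqF.
have -> : expR (- ((1 + x) * t)) = expR (- (x * t)) * expR (- t).
  by rewrite -expRD; congr expR; ring.
by rewrite powR_mulrn ?ltW//; ring.
Qed.

Lemma rint_moment n x : -1 < x -> rint Rpos (fun t => t ^+ n * expR (- (x * t)) * w t).
Proof.
move=> x1; have x10 : 0 < 1 + x by lra.
apply: rint_eq (rint_gamma (cn0 n) x10) => // t.
by rewrite /Rpos /= in_itv /= andbT => /moment_eq ->.
Qed.

Lemma Rint_moment n x : -1 < x ->
  \int[leb]_(t in Rpos) (t ^+ n * expR (- (x * t)) * w t) =
  rGamma (n%:R + c) * (1 + x) `^ (- (n%:R + c)).
Proof.
move=> x1; have x10 : 0 < 1 + x by lra.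
rewrite -rGamma_scale//; apply: Rint_eq => t.
by rewrite /Rpos /= in_itv /= andbT => /moment_eq ->.
Qed.

Lemma rGamma_rising (a : R) n : 0 < a -> rGamma (a + n%:R) = rising a n * rGamma a.
Proof.
move=> a0; elim: n => [|n ih]; first by rewrite addr0 rising0 mul1r.
rewrite -natr1 addrA rGammaS ?ih ?risingSr; first by rewrite mulrCA mulrA.
by rewrite ltr_wpDr.
Qed.

(** Integrated term by term, the left-hand side is the sum in [binomial_rising] at
    [y = - 1 / (1 + x)], for which [1 + y = x / (1 + x)]. The value [x = 0] yields moments and
    orthogonality, [x = 1] the matrix entries, and [0 < x < 1] the inhomogeneous term. *)
Lemma laguerre_laplace k r x : -1 < x ->
  \int[leb]_(t in Rpos) (t ^+ r * expR (- (x * t)) * laguerre xi k t * w t) =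
  rGamma (k%:R + c) / k`!%:R * (1 + x) `^ (- (r%:R + c)) *
  \sum_(j < r.+1) 'C(r, j)%:R * rising (c + j%:R) (r - j) *
    ((k ^_ j)%:R * (- (1 + x)^-1) ^+ j * (x / (1 + x)) ^+ (k - j)).
Proof.
move=> x1; have x10 : 0 < 1 + x by lra.
have -> : x / (1 + x) = 1 + - (1 + x)^-1 by field; rewrite gt_eqF.
rewrite -binomial_rising.
pose coef l := rGamma (k%:R + c) / ((k - l)`!%:R * rGamma (l%:R + c)) * ((-1) ^+ l / l`!%:R).
rewrite (_ : \int[leb]_(t in Rpos) _ = \int[leb]_(t in Rpos)
   \sum_(l <- index_enum 'I_k.+1) coef l * (t ^+ (r + l) * expR (- (x * t)) * w t)); last first.
  apply: Rint_eq => t _; rewrite /laguerre mulr_sumr mulr_suml; apply: eq_bigr => l _.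
  by rewrite /coef exprD; ring.
rewrite Rint_sum//; last by move=> l; apply: rintZ => //; exact: rint_moment.
rewrite mulr_sumr; apply: eq_bigr => l _.
rewrite RintZ//; last exact: rint_moment.
rewrite Rint_moment// [(r + l)%:R]natrD.
have -> : r%:R + l%:R + c = l%:R + c + r%:R by ring.
rewrite rGamma_rising// [c + l%:R]addrC opprD powRD; last by apply/implyP => _; rewrite gt_eqF.
have lk : (l <= k)%N by rewrite -ltnS.
have g0 : rGamma (l%:R + c) != 0 by rewrite gt_eqF ?rGamma_gt0.
have f1 : (k - l)`!%:R != 0 :> R by rewrite pnatr_eq0 -lt0n fact_gt0.
have f2 : l`!%:R != 0 :> R by rewrite pnatr_eq0 -lt0n fact_gt0.
have f3 : k`!%:R != 0 :> R by rewrite pnatr_eq0 -lt0n fact_gt0.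
have -> : 'C(k, l)%:R = k`!%:R / (l`!%:R * (k - l)`!%:R) :> R.
  by rewrite -(bin_fact lk) natrM natrM mulfK// mulf_neq0.
rewrite opprD powRD; last by apply/implyP => _; rewrite gt_eqF.
rewrite [in RHS]opprD powRD; last by apply/implyP => _; rewrite gt_eqF.
rewrite (powRN _ l%:R) powR_mulrn ?ltW// exprNn exprVn /coef.
have y0 : (1 + x) ^+ l != 0 by rewrite expf_neq0// gt_eqF.
move: (rGamma (l%:R + c)) g0 (rGamma _) ((1 + x) ^+ l) y0 (rising _ _) (_ `^ _) (_ `^ _) ((-1) ^+ l).
move: (k`!%:R) f3 (l`!%:R) f2 ((k - l)`!%:R) f1 => a a0 b b0 d d0 g g0 h y y0 u v z s.
by field; rewrite a0 b0 d0 g0 y0.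
Qed.

Lemma rint_laguerre k r x : -1 < x ->
  rint Rpos (fun t => t ^+ r * expR (- (x * t)) * laguerre xi k t * w t).
Proof.
move=> x1.
pose coef l := rGamma (k%:R + c) / ((k - l)`!%:R * rGamma (l%:R + c)) * ((-1) ^+ l / l`!%:R).
apply: (@rint_eq _ _ (fun t => \sum_(l <- index_enum 'I_k.+1) coef l * (t ^+ (r + l) * expR (- (x * t)) * w t))) => //.
  move=> t _; rewrite /laguerre mulr_sumr mulr_suml; apply: eq_bigr => l _.
  by rewrite /coef exprD; ring.
by apply: rint_sum => // l; apply: rintZ => //; exact: rint_moment.
Qed.

(** At [x = 0] the terms with [j < k] contain a positive power of zero and those with [j > k] a
    vanishing falling factorial, so that only [j = k] survives. *)
Lemma laguerre_moment k r :
  \int[leb]_(t in Rpos) (t ^+ r * laguerre xi k t * w t) =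
  rGamma (k%:R + c) * (-1) ^+ k * 'C(r, k)%:R * rising (c + k%:R) (r - k).
Proof.
have := laguerre_laplace k r (ltrN10 R).
rewrite (_ : \int[leb]_(t in Rpos) _ = \int[leb]_(t in Rpos) (t ^+ r * laguerre xi k t * w t)); last first.
  by apply: Rint_eq => t _; rewrite mul0r oppr0 expR0 mulr1.
move=> ->; rewrite mul0r addr0 powR1 mulr1 invr1.
have f3 : k`!%:R != 0 :> R by rewrite pnatr_eq0 -lt0n fact_gt0.
have [kr|rk] := leqP k r; last first.
  rewrite bin_small// mulr0 mul0r big1 ?mulr0// => j _.
  by rewrite expr0n subn_eq0 leqNgt (leq_trans (ltn_ord j) rk) !mulr0.
rewrite (bigD1 (Ordinal (kr : (k < r.+1)%N)))//= big1 ?addr0 => [|j jk].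
  by rewrite subnn expr0 ffactnn; field.
have [kj|jk2] := ltnP k j; first by rewrite ffact_small// !mul0r mulr0.
rewrite expr0n subn_eq0 leqNgt ltn_neqAle jk2 andbT.
suff -> : j != k :> nat by rewrite /= !mulr0.
by apply: contraNneq jk => e; apply/eqP/val_inj.
Qed.

Lemma laguerre_orth n m :
  \int[leb]_(t in Rpos) (laguerre xi n t * laguerre xi m t * w t) =
  rGamma (n%:R + c) / n`!%:R * (n == m)%:R.
Proof.
wlog nm : n m / (n <= m)%N.
  move=> h; have [/h//|/ltnW mn] := leqP n m.
  rewrite (_ : \int[leb]_(t in Rpos) _ =
     \int[leb]_(t in Rpos) (laguerre xi m t * laguerre xi n t * w t)); last first.
    by apply: Rint_eq => t _; rewrite [laguerre xi n t * _]mulrC.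
  by rewrite h// eq_sym; have [->//|] := eqVneq m n; rewrite !mulr0.
pose coef l := rGamma (n%:R + c) / ((n - l)`!%:R * rGamma (l%:R + c)) * ((-1) ^+ l / l`!%:R).
have rl l : rint Rpos (fun t => t ^+ l * laguerre xi m t * w t).
  apply: rint_eq (rint_laguerre m l (ltrN10 R)) => // t _.
  by rewrite mul0r oppr0 expR0 mulr1.
rewrite (_ : \int[leb]_(t in Rpos) _ = \int[leb]_(t in Rpos)
   \sum_(l <- index_enum 'I_n.+1) coef l * (t ^+ l * laguerre xi m t * w t)); last first.
  apply: Rint_eq => t _; rewrite {1}/laguerre !mulr_suml; apply: eq_bigr => l _.
  by rewrite /coef !mulrA.
rewrite Rint_sum//; last by move=> l; exact: rintZ.
rewrite (eq_bigr (fun l : 'I_n.+1 => coef l * (rGamma (m%:R + c) * (-1) ^+ m * 'C(l, m)%:R * rising (c + m%:R) (l - m)))); last first.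
  by move=> l _; rewrite RintZ// laguerre_moment.
have [nm'|mn] := ltnP n m.
  rewrite big1 ?(ltn_eqF nm') ?mulr0// => l _.
  by rewrite bin_small ?mulr0 ?mul0r ?mulr0// (leq_trans _ nm')// ltnS -ltnS.
have <- : n = m by apply/eqP; rewrite eqn_leq nm mn.
rewrite big_ord_recr /= big1 => [|l _]; last by rewrite bin_small ?mulr0 ?mul0r ?mulr0.
have f3 : n`!%:R != 0 :> R by rewrite pnatr_eq0 -lt0n fact_gt0.
have g0 : rGamma (n%:R + c) != 0 by rewrite gt_eqF ?rGamma_gt0.
rewrite /coef subnn fact0 binn rising0 eqxx add0r !mulr1 mul1r.
have e : (-1) ^+ n * (-1) ^+ n = 1 :> R by rewrite -exprMn mulrNN mulr1 expr1n.
transitivity (rGamma (n%:R + c) / n`!%:R * ((-1) ^+ n * (-1) ^+ n)); last by rewrite e mulr1.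
by field; rewrite f3 g0.
Qed.

End laguerre_integrals.

(** * Uniqueness in the moment problem *)

Section exponential_sums.
Variable R : realType.
Implicit Types x y : R.

Definition exp_sum N x : R := \sum_(j < N) x ^+ j / j`!%:R.

Lemma exp_sumE N x : exp_sum N x = series (exp_coeff x) N.
Proof. by rewrite /series /= big_mkord. Qed.

Lemma exp_sum_cvg x : exp_sum N x @[N --> \oo] --> expR x.
Proof. by rewrite (funext (exp_sumE ^~ x)); exact: is_cvg_series_exp_coeff. Qed.

(** Provides the majorant, uniform in [N], whenever an exponential series is integrated term by
    term. *)
Lemma exp_sum_le N x : `|exp_sum N x| <= expR `|x|.
Proof.
apply: (@le_trans _ _ (exp_sum N `|x|)).
  rewrite (le_trans (ler_norm_sum _ _ _))//; apply: ler_sum => j _.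
  by rewrite normrM normfV normrX normr_nat.
have h : nondecreasing_seq (exp_sum ^~ `|x|).
  apply/nondecreasing_seqP => n; rewrite /exp_sum big_ord_recr /= lerDl.
  by rewrite divr_ge0 ?exprn_ge0.
have cv := exp_sum_cvg (x := `|x|).
rewrite -(cvg_lim _ cv)//; apply: nondecreasing_cvgn_le => //.
by apply/cvg_ex; eexists; exact: cv.
Qed.

End exponential_sums.

Section moment_uniqueness.
Variable R : realType.
Variable g : R -> R.
(** Exponential integrability is what makes the moment problem determinate. For [g = f w] with [f]
    in [L^2(m_xi)] the rate [1 / 4] is admissible, because the square of [exp (t / 4)] is
    [exp (t / 2)], which [m_xi] integrates. *)
Hypothesis rg : forall n, rint Rpos (fun t => t ^+ n * expR (4^-1 * t) * g t).
Hypothesis mom0 : forall n, \int[leb]_(t in Rpos) (t ^+ n * g t) = 0.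

Let mg : measurable_fun Rpos g.
Proof.
have h := rint_measurable (rg 0).
have : measurable_fun Rpos (fun t => expR (- (4^-1 * t)) * (t ^+ 0 * expR (4^-1 * t) * g t)).
  by apply: measurable_funM => //; exact: measurable_expN.
by under eq_fun do rewrite expr0 mul1r mulrA -expRD addNr expR0 mul1r.
Qed.

Let rexp n m : rint Rpos (fun t => t ^+ n * expR (- (m%:R * (4^-1 * t))) * g t).
Proof.
apply: (@rint_dom _ _ _ (fun t => `|t ^+ n * expR (4^-1 * t) * g t|)) => //.
- apply: measurable_funM => //; apply: measurable_funM; first exact: measurable_funX.
  have := @measurable_expN R Rpos (m%:R * 4^-1).
  by under eq_fun do rewrite -mulrA.
- move=> t /Rpos_gt0 t0; rewrite !normrM ler_wpM2r// ler_wpM2l// !ger0_norm ?expR_ge0// ler_expR.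
  by rewrite (@le_trans _ _ 0) ?oppr_le0 ?mulr_ge0// ?mulr_ge0 ?invr_ge0 ?ltW.
- exact: rint_norm.
Qed.

(* [g] is orthogonal to all [t ^ n exp (- m t / 4)], hence to
   [exp (- N exp (N (a - t) / 4))], which tends to the indicator of [a < t]. *)
Let step1 m n : \int[leb]_(t in Rpos) (t ^+ n * expR (- (m%:R * (4^-1 * t))) * g t) = 0.
Proof.
elim: m n => [|m ih] n.
  by rewrite -(mom0 n); apply: Rint_eq => t _; rewrite mul0r oppr0 expR0 mulr1.
pose f N t := exp_sum N (- (4^-1 * t)) * (t ^+ n * expR (- (m%:R * (4^-1 * t))) * g t).
have fE N t : f N t = \sum_(j <- index_enum 'I_N)
    ((- 4^-1) ^+ j / j`!%:R) * (t ^+ (n + j) * expR (- (m%:R * (4^-1 * t))) * g t).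
  rewrite /f /exp_sum mulr_suml; apply: eq_bigr => j _.
  by rewrite -mulNr exprMn exprD; ring.
have int0 N : \int[leb]_(t in Rpos) f N t = 0.
  under eq_Rintegral do rewrite fE.
  rewrite Rint_sum//; last by move=> j; exact: rintZ.
  by rewrite big1// => j _; rewrite RintZ// ih mulr0.
have [||||_ cv] := @rdct R Rpos f
    (fun t => t ^+ n * expR (- (m.+1%:R * (4^-1 * t))) * g t)
    (fun t => `|t ^+ n * expR (4^-1 * t) * g t|) (@measurable_Rpos R).
- move=> N; rewrite (funext (fE N)); apply: rint_measurable.
  by apply: rint_sum => // j; exact: rintZ.
- move=> N t /Rpos_gt0 t0; rewrite /f !normrM.
  have h1 : `|exp_sum N (- (4^-1 * t))| <= expR (4^-1 * t).
    by rewrite (le_trans (exp_sum_le _ _))// normrN ger0_norm// mulr_ge0 ?invr_ge0 ?ltW.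
  have h2 : `|expR (- (m%:R * (4^-1 * t)))| <= 1.
    rewrite ger0_norm ?expR_ge0// -[leRHS](@expR0 R) ler_expR oppr_le0.
    by rewrite mulr_ge0// mulr_ge0 ?invr_ge0 ?(ltW t0).
  apply: (@le_trans _ _ (expR (4^-1 * t) * (`|t ^+ n| * 1 * `|g t|))).
    by apply: ler_pM => //; rewrite ?mulr_ge0// ler_wpM2r// ler_wpM2l.
  by rewrite (ger0_norm (expR_ge0 _)) mulr1 mulrCA mulrA.
- exact: rint_norm.
- move=> t _; rewrite (_ : t ^+ n * expR (- (m.+1%:R * (4^-1 * t))) * g t =
    expR (- (4^-1 * t)) * (t ^+ n * expR (- (m%:R * (4^-1 * t))) * g t)); last first.
    by rewrite -nat1r mulrDl mul1r opprD expRD; ring.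
  by apply: cvgMl; exact: exp_sum_cvg.
move: cv; rewrite (_ : (fun N => _) = (fun=> 0)); last by apply/funext => N; rewrite int0.
by move=> /cvg_lim <- //; rewrite lim_cst.
Qed.

(** The outer exponential is expanded: the powers of its argument are multiples of the exponentials
    of [step1] with [m * N] in place of [m]. Since [t > 0], the inner exponential is at most
    [exp (N |a| / 4)], which bounds all partial sums by a constant. *)
Let step2 (a : R) N : \int[leb]_(t in Rpos)
   (expR (- (N%:R * expR (N%:R * (4^-1 * (a - t))))) * g t) = 0.
Proof.
pose y t := - (N%:R * expR (N%:R * (4^-1 * (a - t)))).
pose f M t := exp_sum M (y t) * g t.
have rg0 : rint Rpos g.
  apply: rint_eq (rexp 0 0) => // t _.
  by rewrite mul0r oppr0 expR0 mulr1 mul1r.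
have fE M t : f M t = \sum_(m <- index_enum 'I_M)
    ((- (N%:R * expR (N%:R * (4^-1 * a)))) ^+ m / m`!%:R) *
    (t ^+ 0 * expR (- ((m * N)%:R * (4^-1 * t))) * g t).
  rewrite /f /exp_sum mulr_suml; apply: eq_bigr => m _.
  have -> : y t = - (N%:R * expR (N%:R * (4^-1 * a))) * expR (- (N%:R * (4^-1 * t))).
    by rewrite /y mulNr -mulrA -expRD; congr (- (_ * expR _)); ring.
  rewrite exprMn -expRM_natl natrM expr0.
  have -> : m%:R * - (N%:R * (4^-1 * t)) = - (m%:R * N%:R * (4^-1 * t)) by ring.
  ring.
have int0 M : \int[leb]_(t in Rpos) f M t = 0.
  under eq_Rintegral do rewrite fE.
  rewrite Rint_sum//; last by move=> j; exact: rintZ.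
  by rewrite big1// => j _; rewrite RintZ// step1 mulr0.
have [||||_ cv] := @rdct R Rpos f (fun t => expR (y t) * g t)
    (fun t => expR (N%:R * expR (N%:R * (4^-1 * `|a|))) * `|g t|) (@measurable_Rpos R).
- move=> M; rewrite (funext (fE M)); apply: rint_measurable.
  by apply: rint_sum => // j; exact: rintZ.
- move=> M t /Rpos_gt0 t0; rewrite /f !normrM ler_wpM2r//.
  rewrite (le_trans (exp_sum_le _ _))// ler_expR normrN ger0_norm ?mulr_ge0 ?expR_ge0//.
  rewrite ler_wpM2l// ler_expR ler_wpM2l// ler_wpM2l ?invr_ge0//.
  by rewrite (le_trans _ (ler_norm a))// gerBl ltW.
- by apply: rintZ => //; exact: rint_norm.
- by move=> t _; apply: cvgMl; exact: exp_sum_cvg.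
move: cv; rewrite (_ : (fun M => _) = (fun=> 0)); last by apply/funext => M; rewrite int0.
by move=> /cvg_lim <- //; rewrite lim_cst.
Qed.

Let step_arg (s : R) N : R := expR (- (N%:R * expR (N%:R * (4^-1 * s)))).

Let lim_step_neg (s : R) : s < 0 -> step_arg s N @[N --> \oo] --> (1 : R).
Proof.
move=> s0; have sn : s != 0 by rewrite lt_eqF.
have h : N.+1%:R * expR (N.+1%:R * (4^-1 * s)) @[N --> \oo] --> (0 : R).
  (* With [x = N + 1] and [y = - x s / 4 > 0], the inequality [y ^ 2 <= 2 exp y] gives [x exp (- y)
     <= 2 x / y ^ 2 = 32 / (s ^ 2 x)]. *)
  apply: (@squeeze_cvgr _ _ _ _ (fun=> 0) (fun N => (32 / s ^+ 2) * N.+1%:R^-1)).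
  - near=> N; rewrite mulr_ge0 ?expR_ge0//=.
    set x : R := N.+1%:R.
    have x0 : 0 < x by rewrite /x ltr0n.
    have xn := lt0r_neq0 x0; clearbody x.
    have y0 : 0 < x * (4^-1 * - s) by rewrite !mulr_gt0 ?invr_gt0 ?oppr_gt0.
    have := expR_ge_exp 2 (ltW y0).
    have -> : expR (x * (4^-1 * s)) = (expR (x * (4^-1 * - s)))^-1.
      by rewrite -expRN; congr expR; ring.
    move=> h; set e := expR (x * (4^-1 * - s)) in h *.
    rewrite ler_pdivrMr ?expR_gt0//.
    have s2 : 0 < s ^+ 2 by rewrite exprn_even_gt0//= lt_eqF.
    have -> : 32 / s ^+ 2 * x^-1 * e = 16 / (s ^+ 2 * x) * (2 * e).
      by field; rewrite xn sn.
    apply: (@le_trans _ _ (16 / (s ^+ 2 * x) * (x * (4^-1 * - s)) ^+ 2)).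
      by rewrite le_eqVlt; apply/orP; left; apply/eqP; field; rewrite xn sn.
    by rewrite ler_wpM2l// divr_ge0// ltW// mulr_gt0.
  - exact: cvg_cst.
  - rewrite -[X in _ --> X](mulr0 (32 / s ^+ 2)); apply: cvgMr; exact: cvg_harmonic.
have e10 : expR (- 0) = 1 :> R by rewrite oppr0 expR0.
have h2 : [sequence step_arg s n.+1]_n @ \oo --> (expR (- 0) : R).
  apply: (@cvg_comp _ _ _ (fun N => - (N.+1%:R * expR (N.+1%:R * (4^-1 * s)))) expR
    \oo (nbhs (- 0 : R))).
    exact: (cvgN h).
  exact: continuous_expR.
by rewrite -(cvg_shiftS (step_arg s)) -e10.
Unshelve. all: by end_near. Qed.

(** The factor [N] outside the inner exponential forces the limit 0 also at [s = 0], so that the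
    limit is exactly an indicator function. *)
Let lim_step_pos (s : R) : 0 <= s -> step_arg s N @[N --> \oo] --> (0 : R).
Proof.
move=> s0.
suff h2 : [sequence step_arg s n.+1]_n @ \oo --> (0 : R).
  by rewrite -(cvg_shiftS (step_arg s)).
apply: (@squeeze_cvgr _ _ _ _ (fun=> 0) (fun N => N.+1%:R^-1)).
- near=> N; rewrite expR_ge0 /= /step_arg expRN lef_pV2 ?posrE ?expR_gt0 ?ltr0n//.
  apply: le_trans (expR_ge1Dx _); apply: ler_wpDl => //.
  rewrite ler_peMr// -[leLHS](@expR0 R) ler_expR.
  by rewrite mulr_ge0// mulr_ge0// invr_ge0.
- exact: cvg_cst.
- exact: cvg_harmonic.
Unshelve. all: by end_near. Qed.

(** The integrals of [g] over all half-lines vanish. The primitive of [g] is therefore zero, and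
    Lebesgue differentiation gives [g = 0] almost everywhere. *)
Lemma moments0_ae0 : {ae leb, forall t : R, 0 < t -> g t = 0}.
Proof.
have rg0 : rint Rpos g.
  apply: rint_eq (rexp 0 0) => // t _.
  by rewrite mul0r oppr0 expR0 mulr1 mul1r.
have g0 : \int[leb]_(t in Rpos) g t = 0.
  by rewrite -(mom0 0); apply: Rint_eq => t _; rewrite mul1r.
have step3 (a : R) : rint Rpos (fun t => (a < t)%R%:R * g t) /\
   \int[leb]_(t in Rpos) ((a < t)%R%:R * g t) = 0.
  have [||||rl cv] := @rdct R Rpos
    (fun N t => expR (- (N%:R * expR (N%:R * (4^-1 * (a - t))))) * g t)
    (fun t => (a < t)%R%:R * g t) (fun t => `|g t|) (@measurable_Rpos R).
  - move=> N; apply: measurable_funM => //.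
    apply: measurableT_comp (@measurable_expR R) _.
    apply: measurableT_comp => //; apply: measurable_funM => //.
    apply: measurableT_comp (@measurable_expR R) _.
    by do 2 apply: measurable_funM => //; exact: measurable_funB.
  - move=> N t _; rewrite normrM ler_piMl// ger0_norm ?expR_ge0//.
  - exact: rint_norm.
  - move=> t _; apply: cvgMl; have [at0|ta] := ltP a t.
      by apply: lim_step_neg; rewrite subr_lt0.
    by apply: lim_step_pos; rewrite subr_ge0.
  split => //.
  move: cv; rewrite (_ : (fun M => _) = (fun=> 0)); last by apply/funext => M; rewrite step2.
  by move=> /cvg_lim <- //; rewrite lim_cst.
have rT : rint setT (g \_ Rpos).
  by have := rg0; rewrite (integrable_mkcond (mu := leb) (EFin \o g) (@measurable_Rpos R)) restrict_EFin.
have F0 x : \int[leb]_(t in `]-oo, x]) (g \_ Rpos) t = 0.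
  rewrite -Rintegral_mkcondr setIC Rintegral_mkcondr.
  have [r3 i3] := step3 x.
  transitivity (\int[leb]_(t in Rpos) (g t - (x < t)%R%:R * g t)).
    apply: Rint_eq => t _; rewrite patchE mem_setE in_itv /=.
    by case: leP => _; rewrite ?mul1r ?mul0r ?subr0 ?subrr.
  by rewrite RintB// i3 g0 subrr.
have /= := FTC1Ny (fun y => rintS measurableT (measurable_itv _) (@subsetT _ _) rT)
   (integrable_locally (@measurable_Rpos R) rg0).
apply: filterS => [|t /= [_ +] t0]; first exact: (ae_filter_ringOfSetsType leb).
rewrite (funext F0) derive1_cst patchE ifT; first by move=> <-.
by rewrite inE /Rpos /= in_itv /= andbT.
Qed.

End moment_uniqueness.

(** * Laguerre expansions in weighted L2 spaces *)

Section weighted_L2.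
Variable R : realType.
Variable xi : R.
Hypothesis xi0 : 0 < xi.
Local Notation c := (2 * xi).
Local Notation w := (rdens xi).
Local Notation L := (laguerre xi).
Implicit Types (f g h : R -> R) (a : nat -> R).

Let mw : measurable_fun Rpos w. Proof. exact: measurable_rdens. Qed.

Let sw_ge0 x t : 0 <= x ^+ 2 * w t.
Proof. by apply: mulr_ge0; [exact: sqr_ge0|exact: rdens_ge0]. Qed.
Let nw_ge0 (x y t : R) : 0 <= `|x| * `|y| * w t.
Proof. by apply: mulr_ge0; [exact: mulr_ge0|exact: rdens_ge0]. Qed.

(** The squared norm of [L k], which is also the diagonal entry of [Dmx]. *)
Definition lagG k : R := rGamma (k%:R + c) / k`!%:R.
Definition rL2 f := measurable_fun Rpos f /\ rint Rpos (fun t => f t ^+ 2 * w t).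
Definition ip f g := \int[leb]_(t in Rpos) (f t * g t * w t).

Lemma lagG_gt0 k : 0 < lagG k.
Proof.
by rewrite divr_gt0 ?ltr0n ?fact_gt0// rGamma_gt0// ltr_wpDl// mulr_gt0.
Qed.

Lemma rL2_dom f g : measurable_fun Rpos f -> (forall t, 0 < t -> `|f t| <= `|g t|) ->
  rL2 g -> rL2 f.
Proof.
move=> mf fg [mg rg]; split => //; apply: rint_dom rg => //.
  by apply: measurable_funM => //; exact: measurable_funX.
move=> t /Rpos_gt0 t0; rewrite normrM (ger0_norm (rdens_ge0 _ _)) ler_wpM2r ?rdens_ge0//.
by rewrite normrX -[leRHS]real_normK ?num_real// lerXn2r ?nnegrE ?fg.
Qed.

Lemma rL2D f g : rL2 f -> rL2 g -> rL2 (fun t => f t + g t).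
Proof.
move=> [mf rf] [mg rg]; split; first exact: measurable_funD.
apply: (@rint_dom _ _ _ (fun t => 2 * (f t ^+ 2 * w t) + 2 * (g t ^+ 2 * w t))) => //.
- apply: measurable_funM => //; apply: measurable_funX; exact: measurable_funD.
- move=> t _; rewrite (ger0_norm (sw_ge0 _ _)).
  rewrite (_ : 2 * (f t ^+ 2 * w t) + 2 * (g t ^+ 2 * w t) =
    (2 * f t ^+ 2 + 2 * g t ^+ 2) * w t); last by ring.
  rewrite ler_wpM2r ?rdens_ge0// -subr_ge0.
  rewrite (_ : _ - _ = (f t - g t) ^+ 2) ?sqr_ge0//; ring.
- by apply: rintD => //; exact: rintZ.
Qed.

Lemma rL2Z k f : rL2 f -> rL2 (fun t => k * f t).
Proof.
move=> [mf rf]; split; first by apply: measurable_funM => //; exact: measurable_cst.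
by under eq_fun do rewrite exprMn -mulrA; exact: rintZ.
Qed.

Lemma rL2B f g : rL2 f -> rL2 g -> rL2 (fun t => f t - g t).
Proof.
move=> lf lg; under eq_fun do rewrite -[- g _]mulN1r.
by apply: rL2D => //; exact: rL2Z.
Qed.

(** The square is a moment integrand with [x = - 1 / 2], inside the range [-1 < x]. It dominates the
    powers of [t] and meets the integrability condition of [moments0_ae0]. *)
Lemma rL2_monoexp n : rL2 (fun t => t ^+ n * expR (4^-1 * t)).
Proof.
split.
  apply: measurable_funM; first exact: measurable_funX.
  by apply: measurable_lincomp; exact: measurable_expR.
have h : -1 < - 2^-1 :> R by rewrite ltrN2; lra.
apply: rint_eq (rint_moment xi0 (n + n) h) => // t _.
rewrite exprMn -exprM mulnC mul2n addnn expr2 -expRD; congr (_ * expR _ * _).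
by rewrite -mulNr opprK; field.
Qed.

Lemma rL2_mono n : rL2 (fun t => t ^+ n).
Proof.
apply: rL2_dom (rL2_monoexp n); first exact: measurable_funX.
move=> t t0; rewrite normrM ler_peMr// ger0_norm ?expR_ge0// -[leLHS](@expR0 R) ler_expR.
by rewrite mulr_ge0 ?invr_ge0 ?ltW.
Qed.

Lemma rL2_sum I (s : seq I) (F : I -> R -> R) : (forall i, rL2 (F i)) ->
  rL2 (fun t => \sum_(i <- s) F i t).
Proof.
move=> lF; elim: s => [|i s ih].
  under eq_fun do rewrite big_nil.
  have := rL2Z 0 (rL2_mono 0); by under eq_fun do rewrite mul0r.
by under eq_fun do rewrite big_cons; exact: rL2D.
Qed.

Lemma laguerreE k t : L k t = \sum_(l <- index_enum 'I_k.+1)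
   (rGamma (k%:R + c) / ((k - l)`!%:R * rGamma (l%:R + c)) * ((-1) ^+ l / l`!%:R)) * t ^+ l.
Proof. by []. Qed.

Lemma rL2_laguerre k : rL2 (L k).
Proof.
by rewrite (funext (laguerreE k)); apply: rL2_sum => l; apply: rL2Z; exact: rL2_mono.
Qed.

Lemma rL2_mul f g : rL2 f -> rL2 g -> rint Rpos (fun t => f t * g t * w t).
Proof.
move=> [mf rf] [mg rg].
apply: (@rint_dom _ _ _ (fun t => f t ^+ 2 * w t + g t ^+ 2 * w t)) => //.
- by do 2 apply: measurable_funM => //.
- move=> t _; rewrite normrM (ger0_norm (rdens_ge0 _ _)) -mulrDl ler_wpM2r ?rdens_ge0//.
  rewrite normrM -[f t ^+ 2]real_normK ?num_real// -[g t ^+ 2]real_normK ?num_real//.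
  rewrite -subr_ge0.
  rewrite (_ : _ - _ = 2^-1 * ((`|f t| - `|g t|) ^+ 2 + `|f t| ^+ 2 + `|g t| ^+ 2)); last by field.
  by rewrite mulr_ge0 ?invr_ge0// !addr_ge0 ?sqr_ge0.
- exact: rintD.
Qed.

Lemma ipC f g : ip f g = ip g f.
Proof. by apply: Rint_eq => t _; rewrite [f t * _]mulrC. Qed.
Lemma ipDl f g h : rL2 f -> rL2 g -> rL2 h -> ip (fun t => f t + g t) h = ip f h + ip g h.
Proof.
by move=> lf lg lh; rewrite /ip -RintD//; [|exact: rL2_mul|exact: rL2_mul];
  apply: Rint_eq => t _; rewrite !mulrDl.
Qed.
Lemma ipZl k f g : rL2 f -> rL2 g -> ip (fun t => k * f t) g = k * ip f g.
Proof.
by move=> lf lg; rewrite /ip -RintZ//; [|exact: rL2_mul]; apply: Rint_eq => t _; rewrite !mulrA.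
Qed.
Lemma ipBl f g h : rL2 f -> rL2 g -> rL2 h -> ip (fun t => f t - g t) h = ip f h - ip g h.
Proof.
by move=> lf lg lh; rewrite /ip -RintB//; [|exact: rL2_mul|exact: rL2_mul];
  apply: Rint_eq => t _; rewrite !mulrBl.
Qed.
Lemma ip_suml I (s : seq I) (F : I -> R -> R) g : (forall i, rL2 (F i)) -> rL2 g ->
  ip (fun t => \sum_(i <- s) F i t) g = \sum_(i <- s) ip (F i) g.
Proof.
move=> lF lg; elim: s => [|i s ih].
  by rewrite big_nil /ip; under eq_Rintegral do rewrite big_nil !mul0r; exact: Rint0.
rewrite big_cons -ih -ipDl//; last exact: rL2_sum.
by apply: Rint_eq => t _; rewrite big_cons.
Qed.
Lemma ip_ge0 f : 0 <= ip f f.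
Proof.
by apply: Rintegral_ge0 => t _; rewrite -expr2 sw_ge0.
Qed.

Lemma L2_pair_cvg0 (f : nat -> R -> R) g : (forall n, rL2 (f n)) -> rL2 g ->
  ip (f n) (f n) @[n --> \oo] --> 0 ->
  \int[leb]_(t in Rpos) (`|f n t| * `|g t| * w t) @[n --> \oo] --> 0.
Proof.
move=> lf lg f0; apply/cvgrPdist_le => e e0.
have G1 : 0 < ip g g + 1 by rewrite ltr_wpDl// ip_ge0.
(* In [|f g| <= f ^ 2 / (2 k) + k g ^ 2 / 2] this [k] makes the integral of the second term at most
   [e / 2]; that of the first is at most [e / 2] as soon as [ip f f <= k e]. *)
pose k := e / (ip g g + 1).
have k0 : 0 < k by rewrite divr_gt0.
have ke : e = k * (ip g g + 1) by rewrite /k divfK ?gt_eqF.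
clearbody k.
move/cvgrPdist_le: f0 => /(_ (k * e) (mulr_gt0 k0 e0))[N _ hN].
exists N => // n Nn /=; rewrite sub0r normrN.
have := hN n Nn; rewrite /= sub0r normrN ger0_norm ?ip_ge0// => h.
have labs u : rL2 u -> rL2 (fun t => `|u t|).
  move=> [mu ru]; apply: (@rL2_dom _ u) => //; first exact: measurableT_comp.
  by move=> t _; rewrite normr_id.
rewrite ger0_norm; last by apply: Rintegral_ge0 => t _; exact: nw_ge0.
apply: (@le_trans _ _ (\int[leb]_(t in Rpos)
   ((2 * k)^-1 * (f n t * f n t * w t) + (k / 2) * (g t * g t * w t)))).
  apply: Rint_le => //.
  - by apply: rL2_mul; exact: labs.
  - by apply: rintD => //; apply: rintZ => //; exact: rL2_mul.
  - move=> t _; rewrite [leRHS](_ : _ = ((2 * k)^-1 * f n t ^+ 2 + k / 2 * g t ^+ 2) * w t); last by ring.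
    rewrite ler_wpM2r ?rdens_ge0//.
    rewrite -[f n t ^+ 2]real_normK ?num_real// -[g t ^+ 2]real_normK ?num_real//.
    rewrite -subr_ge0.
    rewrite (_ : _ - _ = (2 * k)^-1 * ((`|f n t| - k * `|g t|) ^+ 2)).
      by rewrite mulr_ge0 ?sqr_ge0// invr_ge0 mulr_ge0// ltW.
    by field; rewrite gt_eqF.
rewrite RintD//; [|by apply: rintZ => //; exact: rL2_mul|by apply: rintZ => //; exact: rL2_mul].
rewrite !RintZ//; [|exact: rL2_mul|exact: rL2_mul].
rewrite -/(ip _ _) -/(ip g g).
have -> : e = e / 2 + e / 2 by field.
apply: lerD.
  rewrite ler_pdivrMl ?mulr_gt0//; apply: le_trans h _; rewrite le_eqVlt; apply/orP; left.
  by apply/eqP; field.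
have -> : e / 2 = k / 2 * (ip g g + 1) by rewrite {1}ke; field.
by rewrite ler_wpM2l ?divr_ge0// ?ltW// ltrDl.
Qed.

Lemma ip_cvg0 (f : nat -> R -> R) g : (forall n, rL2 (f n)) -> rL2 g ->
  ip (f n) (f n) @[n --> \oo] --> 0 -> ip (f n) g @[n --> \oo] --> 0.
Proof.
move=> lf lg f0; apply/cvgrPdist_le => e e0.
move/cvgrPdist_le: (L2_pair_cvg0 lf lg f0) => /(_ e e0).
apply: filterS => n /=; rewrite !sub0r !normrN; apply: le_trans.
apply: le_trans (le_normr_Rintegral (mu := leb) (@measurable_Rpos R) (rL2_mul (lf n) lg)) _.
apply: le_trans (ler_norm _); rewrite le_eqVlt; apply/orP; left; apply/eqP; apply: Rint_eq => t _.
by rewrite normrM (ger0_norm (rdens_ge0 _ _)) normrM.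
Qed.

Lemma ip_laguerre n m : ip (L n) (L m) = lagG n * (n == m)%:R.
Proof. exact: laguerre_orth. Qed.

Definition lagS a N t := \sum_(i < N) a i * L i t.

Lemma rL2_lagS a N : rL2 (lagS a N).
Proof. by apply: rL2_sum => i; apply: rL2Z; exact: rL2_laguerre. Qed.

Lemma ip_lagS a N k : ip (lagS a N) (L k) = if (k < N)%N then a k * lagG k else 0.
Proof.
rewrite /lagS ip_suml => [|i|]; [|by apply: rL2Z; exact: rL2_laguerre|exact: rL2_laguerre].
rewrite (eq_bigr (fun i : 'I_N => a i * (lagG i * (i == k :> nat)%:R))) => [|i _]; last first.
  by rewrite ipZl ?ip_laguerre//; exact: rL2_laguerre.
case: ltnP => kN.
  rewrite (bigD1 (Ordinal kN))//= eqxx mulr1 big1 ?addr0// => i ik.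
  rewrite (_ : (i == k :> nat) = false) ?mulr0//.
  by apply: contraNF ik => /eqP ik; apply/eqP/val_inj.
by rewrite big1// => i _; rewrite (ltn_eqF (leq_trans (ltn_ord i) kN)) !mulr0.
Qed.

Definition l2S a N := \sum_(i < N) a i ^+ 2 * lagG i.

Lemma l2S_homo a : {homo l2S a : m n / (m <= n)%N >-> m <= n}.
Proof.
apply/nondecreasing_seqP => n; rewrite /l2S big_ord_recr /= lerDl.
by rewrite mulr_ge0 ?sqr_ge0// ltW// lagG_gt0.
Qed.

Lemma ip_lagS2 a N : ip (lagS a N) (lagS a N) = l2S a N.
Proof.
rewrite {1}/lagS ip_suml => [|i|]; [|by apply: rL2Z; exact: rL2_laguerre|exact: rL2_lagS].
apply: eq_bigr => i _; rewrite ipZl; [|exact: rL2_laguerre|exact: rL2_lagS].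
by rewrite ipC ip_lagS ltn_ord mulrA.
Qed.

Lemma ip_lagSB a N M : ip (fun t => lagS a N t - lagS a M t) (fun t => lagS a N t - lagS a M t) =
  `|l2S a N - l2S a M|.
Proof.
wlog MN : N M / (M <= N)%N.
  move=> h; have [/h//|/ltnW NM] := leqP M N.
  rewrite distrC -h//; apply: Rint_eq => t _; ring.
rewrite ger0_norm ?subr_ge0 ?l2S_homo//.
have lS := rL2_lagS a.
rewrite ipBl ?(rL2B)//; try by apply: rL2B.
rewrite ![ip _ (fun t => _ - _)]ipC !ipBl// [ip (lagS a M) (lagS a N)]ipC !ip_lagS2.
suff -> : ip (lagS a N) (lagS a M) = l2S a M by ring.
rewrite ipC {1}/lagS ip_suml => [|i|//]; last by apply: rL2Z; exact: rL2_laguerre.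
apply: eq_bigr => i _; rewrite ipZl//; last exact: rL2_laguerre.
by rewrite ipC ip_lagS (leq_trans (ltn_ord i) MN) mulrA.
Qed.

Definition lagcoef f k := ip f (L k) / lagG k.

Lemma bessel f N : rL2 f -> l2S (lagcoef f) N <= ip f f.
Proof.
move=> lf; set a := lagcoef f.
have lS := rL2_lagS a N.
have := ip_ge0 (fun t => f t - lagS a N t).
rewrite ipBl//; last exact: rL2B.
rewrite ![ip _ (fun t => _ - _)]ipC !ipBl// ip_lagS2 [ip f (lagS _ _)]ipC.
suff -> : ip (lagS a N) f = l2S a N by lra.
rewrite {1}/lagS ip_suml => [|i|//]; last by apply: rL2Z; exact: rL2_laguerre.
apply: eq_bigr => i _; rewrite ipZl//; last exact: rL2_laguerre.
by rewrite ipC /a /lagcoef; field; rewrite gt_eqF ?lagG_gt0.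
Qed.

(** The leading coefficient of [L n] is nonzero, so strong induction turns the vanishing pairing
    with [L n] into a vanishing [n]-th moment. The exponential integrability of [f w] follows from
    [t ^ n exp (t / 4)] being square integrable. *)
Lemma laguerre_complete f : rL2 f -> (forall k, ip f (L k) = 0) ->
  {ae leb, forall t : R, 0 < t -> f t = 0}.
Proof.
move=> lf fL.
have mom n : ip f (fun t => t ^+ n) = 0.
  elim/ltn_ind: n => n ih.
  have := fL n; rewrite (funext (laguerreE n)) ipC ip_suml => [|l|//]; last first.
    by apply: rL2Z; exact: rL2_mono.
  rewrite big_ord_recr /= big1 => [|l _]; last first.
    rewrite ipZl//; last exact: rL2_mono.
    by rewrite ipC ih ?mulr0.
  rewrite add0r ipZl//; last exact: rL2_mono.
  move=> /eqP; rewrite mulf_eq0 ipC => /orP[|/eqP//].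
  have g0 : rGamma (n%:R + c) != 0 by rewrite gt_eqF// rGamma_gt0// ltr_wpDl// mulr_gt0.
  rewrite subnn fact0 mul1r mulfV// mul1r mulf_eq0 invr_eq0 pnatr_eq0 -[(n`! == 0)%N]negbK -lt0n fact_gt0 orbF.
  by rewrite expf_eq0 oppr_eq0 oner_eq0 andbF.
have := @moments0_ae0 R (fun t => f t * w t) _ _.
have h1 n : rint Rpos (fun t => t ^+ n * expR (4^-1 * t) * (f t * w t)).
  apply: rint_eq (rL2_mul (rL2_monoexp n) lf) => // t _; by rewrite !mulrA.
have h2 n : \int[leb]_(t in Rpos) (t ^+ n * (f t * w t)) = 0.
  by rewrite -(mom n); apply: Rint_eq => t _; rewrite mulrA [f t * _]mulrC.
move=> /(_ h1 h2); apply: filterS => [|t /= h t0]; first exact: (ae_filter_ringOfSetsType leb).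
have /eqP := h t0; rewrite mulf_eq0 => /orP[/eqP//|].
by rewrite gt_eqF// rdens_gt0.
Qed.

End weighted_L2.

(** * The Riesz-Fischer theorem for Laguerre series *)

Section riesz_fischer.
Variable R : realType.
Variable xi : R.
Hypothesis xi0 : 0 < xi.
Local Notation c := (2 * xi).
Local Notation w := (rdens xi).
Local Notation L := (laguerre xi).
Local Notation ip := (ip xi).
Local Notation rL2 := (rL2 xi).
Local Notation lagS := (lagS xi).
Local Notation l2S := (l2S xi).
Implicit Types (f g h : R -> R) (a : nat -> R).

Let mw : measurable_fun Rpos w. Proof. exact: measurable_rdens. Qed.
Let sw_ge0 (x t : R) : 0 <= x ^+ 2 * w t.
Proof. by apply: mulr_ge0; [exact: sqr_ge0|exact: rdens_ge0]. Qed.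

Let m2 f : measurable_fun Rpos f -> measurable_fun Rpos (fun t => f t ^+ 2 * w t).
Proof. by move=> mf; apply: measurable_funM => //; exact: measurable_funX. Qed.

Lemma ipE f : ip f f = \int[leb]_(t in Rpos) (f t ^+ 2 * w t).
Proof. by apply: Rint_eq => t _; rewrite expr2. Qed.

Lemma ip_ereal f : rL2 f -> (\int[leb]_(t in Rpos) (f t ^+ 2 * w t)%:E = (ip f f)%:E)%E.
Proof. by move=> [mf rf]; rewrite ipE Eint_Rint. Qed.

Lemma ge0_rL2 f (B : R) : measurable_fun Rpos f ->
  (\int[leb]_(t in Rpos) (f t ^+ 2 * w t)%:E <= B%:E)%E -> rL2 f /\ ip f f <= B.
Proof.
move=> mf fB; rewrite ipE.
by have [] := ge0_rint (@measurable_Rpos R) (m2 mf) (fun t _ => sw_ge0 (f t) t) fB.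
Qed.

Lemma ip_ae f g : rL2 f -> rL2 g -> {ae leb, forall t : R, 0 < t -> f t = g t} ->
  ip f f = ip g g.
Proof.
move=> lf lg fg; apply: EFin_inj; rewrite -!ip_ereal//.
have [[mf _] [mg _]] := (lf, lg).
apply: Eint_ae_eq => //; [exact: m2|exact: m2|].
by apply: (ae_imp fg) => t h /Rpos_gt0 /h ->.
Qed.

Section limit_function.
Variables (a : nat -> R) (T : R).
Hypothesis aT : l2S a N @[N --> \oo] --> T.

Let tail_ge0 N : 0 <= T - l2S a N.
Proof.
rewrite subr_ge0 -(cvg_lim _ aT)//; apply: nondecreasing_cvgn_le.
  exact: l2S_homo.
by apply/cvg_ex; exists T.
Qed.

Let ip_tail N M : ip (fun t => lagS a N t - lagS a M t) (fun t => lagS a N t - lagS a M t) <=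
  (T - l2S a N) + (T - l2S a M).
Proof.
rewrite ip_lagSB// ler_norml; have := tail_ge0 N; have := tail_ge0 M.
by move=> *; apply/andP; split; lra.
Qed.

Let ex_idx j : {n | T - l2S a n <= 4 ^- j}.
Proof.
apply: cid; move/cvgrPdist_le: aT => /(_ (4 ^- j)).
rewrite invr_gt0 exprn_gt0// => /(_ isT)[N _ h]; exists N.
by have := h N (leqnn N); rewrite /= ger0_norm.
Qed.

(* Along [idx] the increments of the partial sums are summable in L^1, so that
   the sums converge almost everywhere; Fatou bounds the distance to the limit. *)
Let idx j := sval (ex_idx j).
Let idxP j : T - l2S a (idx j) <= 4 ^- j. Proof. exact: (svalP (ex_idx j)). Qed.
Let d j t : R := `|lagS a (idx j.+1) t - lagS a (idx j) t|.
Let m := \int[leb]_(t in Rpos) w t.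

Let mS N : measurable_fun Rpos (lagS a N).
Proof. by have [] := rL2_lagS xi0 a N. Qed.

Let md j : measurable_fun Rpos (d j).
Proof. by apply: measurableT_comp => //; exact: measurable_funB. Qed.

Let rw : rint Rpos w.
Proof.
have [_] := rL2_mono xi0 0; by under eq_fun do rewrite expr1n mul1r.
Qed.

(** Pointwise [|u| <= 2 ^ j u ^ 2 + 2 ^ - j], and the increment [u] has squared norm at most
    [2 * 4 ^ - j]. The two terms contribute [2 * 2 ^ - j] and [m * 2 ^ - j]. *)
Let d_int j : (\int[leb]_(t in Rpos) (d j t * w t)%:E <= ((2 + m) * 2 ^- j)%:E)%E.
Proof.
have lB := rL2B (rL2_lagS xi0 a (idx j.+1)) (rL2_lagS xi0 a (idx j)).
set u := (fun t => lagS a (idx j.+1) t - lagS a (idx j) t) in lB.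
have [mu ru] := lB.
have ru2 : rint Rpos (fun t => u t * u t * w t) by exact: rL2_mul.
have r2 : rint Rpos (fun t => 2 ^+ j * (u t * u t * w t) + 2 ^- j * w t).
  by apply: rintD => //; exact: rintZ.
apply: (@le_trans _ _ (\int[leb]_(t in Rpos) (2 ^+ j * (u t * u t * w t) + 2 ^- j * w t)%:E)%E).
  apply: Eint_le => //.
  - exact: measurable_funM.
  - exact: rint_measurable r2.
  - by move=> t _; apply: mulr_ge0; [exact: normr_ge0|exact: rdens_ge0].
  - move=> t _; rewrite [leRHS](_ : _ = (2 ^+ j * (u t * u t) + 2 ^- j) * w t); last by ring.
    rewrite ler_wpM2r ?rdens_ge0//.
    rewrite /d -/(u t) -expr2 -[u t ^+ 2]real_normK ?num_real//.
    set x := `|u t|; have x0 : 0 <= x by exact: normr_ge0.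
    set p : R := 2 ^+ j; have p0 : 0 < p by exact: exprn_gt0.
    rewrite -subr_ge0 (_ : _ - _ = p^-1 * ((p * x - 2^-1) ^+ 2 + 3 / 4)); last by field; rewrite gt_eqF.
    by rewrite mulr_ge0 ?invr_ge0 ?ltW// ltr_wpDl ?sqr_ge0.
rewrite Eint_Rint// lee_fin RintD//; [|exact: rintZ|exact: rintZ].
rewrite !RintZ// -/m mulrDl [m * _]mulrC lerD2r.
have : ip u u <= 2 * 4 ^- j.
  apply: le_trans (ip_tail _ _) _; have := idxP j; have := idxP j.+1 => h1 h2.
  have h3 : 4 ^- j.+1 <= 4 ^- j :> R.
    by rewrite lef_pV2 ?posrE ?exprn_gt0// ler_eXn2l// ltr1n.
  by move: h1 h2 h3; move: (4 ^- j) (4 ^- j.+1) => x y; lra.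
rewrite -/(ip u u) => h.
have -> : 2 * 2 ^- j = 2 ^+ j * (2 * 4 ^- j) :> R.
  have -> : 4 = 2 * 2 :> R by ring.
  by rewrite exprMn; field; rewrite expf_neq0.
by rewrite ler_wpM2l// exprn_ge0.
Qed.

Let S t : nat -> R := fun j => lagS a (idx j) t.

Let S_cvg : {ae leb, forall t : R, Rpos t -> cvgn (S t)}.
Proof.
have mdw j : measurable_fun Rpos (fun t => (d j t * w t)%:E).
  by apply/measurable_EFinP; exact: measurable_funM.
have dw0 j t : Rpos t -> (0 <= (d j t * w t)%:E)%E.
  by move=> _; rewrite lee_fin; apply: mulr_ge0; [exact: normr_ge0|exact: rdens_ge0].
have fin : (\int[leb]_(t in Rpos) (\sum_(0 <= j <oo) (d j t * w t)%:E) < +oo)%E.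
  rewrite (integral_nneseries leb (@measurable_Rpos R) mdw dw0).
  apply: (@le_lt_trans _ _ (\sum_(0 <= j <oo) ((2 + m) * 2 ^- j)%:E)%E).
    apply: lee_nneseries => [j _ _|j _]; last exact: d_int.
    by apply: integral_ge0 => t; exact: dw0.
  apply: (@le_lt_trans _ _ ((2 + m) / (1 - 2^-1))%:E); last exact: ltry.
  have m0 : 0 <= m by apply: Rintegral_ge0 => t _; exact: rdens_ge0.
  apply: lime_le.
    by apply: is_cvg_nneseries => j _ _; rewrite lee_fin mulr_ge0 ?addr_ge0 ?invr_ge0.
  near=> n; rewrite sumEFin lee_fin.
  have := @geometric_le_lim R n (2 + m) 2^-1 (addr_ge0 (ler0n _ 2) m0).
  rewrite invr_gt0 ltr0n => /(_ isT) h; apply: le_trans (h _); last first.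
    by rewrite ger0_norm ?invr_ge0// invf_lt1// ltr1n.
  by rewrite le_eqVlt /series /=; apply/orP; left; apply/eqP; apply: eq_bigr => k _; rewrite exprVn.
have ri : leb.-integrable Rpos (fun t => (\sum_(0 <= j <oo) (d j t * w t)%:E)%E).
  apply/integrableP; split.
    by apply: ge0_emeasurable_sum => [j t Rt _|j _]; [exact: dw0|exact: mdw].
  apply: le_lt_trans fin; rewrite le_eqVlt; apply/orP; left; apply/eqP.
  apply: eq_integral => t; rewrite inE => Rt /=; rewrite gee0_abs//.
  by apply: nneseries_ge0 => j _ _; exact: dw0.
(* An integrable function is finite almost everywhere; at such a point, division by [w t > 0] shows
   that the increments are absolutely summable. *)
have := integrable_ae (mu := leb) (@measurable_Rpos R) ri.
move=> hri; apply: (ae_imp hri) => t /= h Rt.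
have wt := rdens_gt0 xi (Rpos_gt0 Rt).
have /fineK E := h Rt.
set B := fine _ in E.
have cd : cvgn (series (d ^~ t)).
  apply: nondecreasing_is_cvgn.
    by apply/nondecreasing_seqP => n; rewrite /series /= big_nat_recr//= lerDl normr_ge0.
  exists (B / w t) => _ [n _ <-].
  rewrite ler_pdivlMr// /series /= mulr_suml -lee_fin E -sumEFin.
  by apply: nneseries_lim_ge => j _ _; exact: dw0.
have cS : cvgn (series (fun j => S t j.+1 - S t j)) by apply: normed_cvg; exact: cd.
have -> : S t = (fun n => S t 0 + series (fun j => S t j.+1 - S t j) n).
  by apply/funext => n; rewrite /series /= telescope_sumr// addrC subrK.
by apply: is_cvgD => //; exact: is_cvg_cst.
Unshelve. all: by end_near. Qed.

Lemma l2S_limit : exists2 f, rL2 f & forall N,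
  ip (fun t => f t - lagS a N t) (fun t => f t - lagS a N t) <= T - l2S a N.
Proof.
have [Z [mZ Z0 hZ]] := S_cvg.
(* Setting the sequence to zero on the null set [Z] makes it converge at every point of the
   half-line, so that the limit is measurable. *)
pose S' j t := S t j * \1_(~` Z) t.
pose f t := limn (S' ^~ t).
have S'E j t : ~ Z t -> S' j t = S t j.
  by move=> Zt; rewrite /S' indicE mem_set ?mulr1.
have S'f t : Rpos t -> S' j t @[j --> \oo] --> f t.
  move=> Rt; have [Zt|Zt] := pselect (Z t).
    rewrite /f (_ : S' ^~ t = fun=> 0).
      by rewrite lim_cst//; exact: cvg_cst.
    by apply/funext => j; rewrite /S' indicE memNset ?mulr0// => /(_ Zt).
  have /cvg_ex[l hl] : cvgn (S t) by apply: contrapT => nc; apply: Zt; apply: hZ => /(_ Rt).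
  have e : S' ^~ t = S t by apply/funext => j; rewrite S'E.
  by rewrite /f e (cvg_lim _ hl).
have mS' j : measurable_fun Rpos (S' j).
  apply: measurable_funM; first exact: mS.
  by apply: measurable_indic; exact: measurableC.
have mf : measurable_fun Rpos f by exact: (measurable_fun_cvg mS').
have key N : rL2 (fun t => f t - lagS a N t) /\
    ip (fun t => f t - lagS a N t) (fun t => f t - lagS a N t) <= T - l2S a N.
  apply: ge0_rL2; first exact: measurable_funB.
  pose g j t := ((S' j t - lagS a N t) ^+ 2 * w t)%:E.
  have mg j : measurable_fun Rpos (g j).
    by apply/measurable_EFinP; apply: m2; exact: measurable_funB.
  have g0 j t : Rpos t -> (0 <= g j t)%E by move=> _; rewrite lee_fin.
  have -> : (\int[leb]_(t in Rpos) ((f t - lagS a N t) ^+ 2 * w t)%:E =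
     \int[leb]_(t in Rpos) limn_einf (g ^~ t))%E.
    apply: eq_integral => t; rewrite inE => Rt.
    have hg : g j t @[j --> \oo] --> ((f t - lagS a N t) ^+ 2 * w t)%:E.
      apply: cvg_EFin; first exact: nearW.
      apply: cvgMl; rewrite expr2; under eq_fun do rewrite /= expr2.
      by apply: cvgM; (apply: cvgB; [exact: S'f|exact: cvg_cst]).
    by rewrite (cvg_limn_einf_sup hg).1.
  apply: le_trans (fatou leb (@measurable_Rpos R) mg g0) _.
  apply: (@limn_einf_le _ _ (fun j => ((T - l2S a N) + (T - l2S a (idx j)))%:E)); last first.
    apply: cvg_EFin; first exact: nearW.
    rewrite -[X in _ --> X]addr0; apply: cvgD; first exact: cvg_cst.
    apply: (@squeeze_cvgr _ _ _ _ (fun=> 0) (fun j => 4 ^- j)).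
    - by near=> j; rewrite tail_ge0 idxP.
    - exact: cvg_cst.
    - have h4 : `|4^-1 : R| < 1 by rewrite ger0_norm ?invr_ge0// invf_lt1// ltr1n.
      have -> : (fun j => 4 ^- j) = geometric 1 4^-1 :> (nat -> R).
        by apply/funext => j; rewrite /geometric /= mul1r exprVn.
      exact: cvg_geometric.
  move=> j.
  have -> : (\int[leb]_(t in Rpos) g j t = \int[leb]_(t in Rpos) ((S t j - lagS a N t) ^+ 2 * w t)%:E)%E.
    apply: Eint_ae_eq => //.
    - by apply: m2; exact: measurable_funB.
    - by apply: m2; apply: measurable_funB => //; exact: mS.
    exists Z; split => // t /= h; apply: contrapT => nZ; apply: h => _.
    by rewrite S'E.
  rewrite (ip_ereal (rL2B (rL2_lagS xi0 a (idx j)) (rL2_lagS xi0 a N))) lee_fin addrC.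
  exact: ip_tail.
exists f; last by move=> N; have [] := key N.
have := rL2D (proj1 (key 0)) (rL2_lagS xi0 a 0).
by under eq_fun do rewrite subrK.
Unshelve. all: by end_near. Qed.

End limit_function.

Lemma riesz_fischer a (B : R) : (forall N, l2S a N <= B) -> exists2 f, rL2 f &
  ip (fun t => f t - lagS a N t) (fun t => f t - lagS a N t) @[N --> \oo] --> 0.
Proof.
move=> aB.
have : cvgn (l2S a).
  apply: nondecreasing_is_cvgn; first exact: l2S_homo.
  by exists B => _ [n _ <-].
move=> /cvg_ex[T aT]; have [f lf hf] := l2S_limit aT.
exists f => //; apply: (@squeeze_cvgr _ _ _ _ (fun=> 0) (fun N => T - l2S a N)).
- by near=> N; rewrite ip_ge0 hf.
- exact: cvg_cst.
- by rewrite -[X in _ --> X](subrr T); apply: cvgB => //; exact: cvg_cst.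
Unshelve. all: by end_near.
Qed.

Lemma ip_lagS_cvg a f k : rL2 f ->
  ip (fun t => f t - lagS a N t) (fun t => f t - lagS a N t) @[N --> \oo] --> 0 ->
  ip f (L k) = a k * lagG xi k.
Proof.
move=> lf fa.
have := ip_cvg0 (fun N => rL2B lf (rL2_lagS xi0 a N)) (rL2_laguerre xi0 k) fa.
move=> h; apply/eqP; rewrite -subr_eq0; apply/eqP.
have h2 : ip (fun t => f t - lagS a N t) (L k) @[N --> \oo] --> ip f (L k) - a k * lagG xi k.
  apply: cvg_near_cst; exists k.+1 => // N /= kN.
  by rewrite ipBl ?ip_lagS ?kN//; [exact: rL2_lagS|exact: rL2_laguerre].
exact: (cvg_unique _ h2 h).
Qed.

(** By Bessel's inequality Riesz-Fischer applies to the coefficients of [f] and yields some [g] with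
    the same coefficients; completeness identifies [g] with [f]. *)
Lemma laguerre_expansion f : rL2 f ->
  ip (fun t => f t - lagS (lagcoef xi f) N t) (fun t => f t - lagS (lagcoef xi f) N t)
    @[N --> \oo] --> 0.
Proof.
move=> lf; have [g lg hg] := riesz_fischer (fun N => bessel xi0 N lf).
have fg : {ae leb, forall t : R, 0 < t -> f t - g t = 0}.
  apply: (laguerre_complete xi0); first exact: rL2B.
  move=> k; rewrite ipBl//; last exact: rL2_laguerre.
  rewrite (ip_lagS_cvg k lg hg) /lagcoef divfK ?subrr//.
  by rewrite gt_eqF// lagG_gt0.
have E N : ip (fun t => f t - lagS (lagcoef xi f) N t) (fun t => f t - lagS (lagcoef xi f) N t) =
   ip (fun t => g t - lagS (lagcoef xi f) N t) (fun t => g t - lagS (lagcoef xi f) N t).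
  apply: ip_ae; [by apply: rL2B => //; exact: rL2_lagS|by apply: rL2B => //; exact: rL2_lagS|].
  apply: (ae_imp fg) => t h t0.
  by have /eqP := h t0; rewrite subr_eq0 => /eqP ->.
by rewrite (funext E).
Qed.

End riesz_fischer.

(** * The Bessel kernel *)

Section hyp01.
Variable R : realType.
Implicit Types (c z : R[i]) (x : R).

Lemma Re_rising_neq0 c m : 0 < Re c -> rising c m != 0.
Proof.
move=> c0; elim: m => [|m ih]; first by rewrite rising0 oner_eq0.
rewrite risingSr mulf_neq0//; apply: Re_neq0.
by rewrite ReD Re_nat ltr_wpDr.
Qed.

Lemma normc_rising_ge c m : 0 < Re c -> Re c * m`!%:R <= normc (rising c m.+1).
Proof.
move=> c0; elim: m => [|m ih].
  by rewrite rising1 fact0 mulr1 (le_trans (ler_norm _))// Re_le_normc.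
rewrite risingSr ComplexField.Normc.normcM factS natrM mulrA mulrAC.
apply: ler_pM => //; first by rewrite mulr_ge0// ltW.
apply: le_trans (Re_le_normc _); apply: le_trans (ler_norm _).
by rewrite ReD Re_nat lerDr ltW.
Qed.

Lemma exp_le_rising c (A : R) : 0 < Re c -> 0 <= A ->
  exists2 C, 0 <= C & forall m, A ^+ m <= C * normc (rising c m).
Proof.
move=> c0 A0; exists (1 + A * expR A / Re c).
  by rewrite addr_ge0// divr_ge0 ?mulr_ge0 ?expR_ge0// ltW.
case=> [|m].
  rewrite rising0 ComplexField.Normc.normc1 mulr1 expr0 lerDl.
  by rewrite divr_ge0 ?mulr_ge0 ?expR_ge0// ltW.
apply: (@le_trans _ _ (A * expR A / Re c * (Re c * m`!%:R))).
  rewrite [leRHS](_ : _ = A * (m`!%:R * expR A)); last by field; rewrite gt_eqF.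
  by rewrite exprS ler_wpM2l// expR_ge_exp.
apply: ler_pM; rewrite ?mulr_ge0 ?divr_ge0 ?mulr_ge0 ?expR_ge0 ?invr_ge0 ?(ltW c0)//.
  by rewrite lerDr.
exact: normc_rising_ge.
Qed.

Definition hcoef c m : R[i] := (-1) ^+ m / (m`!%:R * rising c m).
(** The function [0F1(; c; - x)], that is, the Bessel kernel freed from its fractional powers and
    hence given by an everywhere convergent power series. *)
Definition hyp01 c x : R[i] := csum (fun m => hcoef c m * (x ^+ m)%:C).

Lemma normc_hcoef c m : normc (hcoef c m) = (m`!%:R * normc (rising c m))^-1.
Proof.
rewrite /hcoef ComplexField.Normc.normcM normcX -[-1]/(- 1%:C) normcN normc_real normr1 expr1n mul1r.
by rewrite ComplexField.Normc.normcV ComplexField.Normc.normcM normc_nat.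
Qed.

(** Rising factorials outgrow every geometric sequence, so the terms of the series are majorised by
    those of [C exp (|x| / A)] with [A] at choice. In [opN_mono] the choice [A = 2 t] at [x = s t]
    gives [exp (s / 2)], which the factor [exp (- s)] of the density absorbs. *)
Lemma hcoef_bound c (A : R) : 0 < Re c -> 0 < A ->
  exists2 C, 0 <= C & forall m, normc (hcoef c m) <= C * (A^-1 ^+ m / m`!%:R).
Proof.
move=> c0 A0; have [C C0 hC] := exp_le_rising c0 (ltW A0).
exists C => // m; rewrite normc_hcoef invfM mulrA [leRHS]mulrC mulrA.
rewrite [leRHS](_ : _ = m`!%:R^-1 * (C * A^-1 ^+ m)); last by ring.
rewrite ler_wpM2l ?invr_ge0//.
have r0 : 0 < normc (rising c m).
  by rewrite lt_neqAle normc_ge0 andbT eq_sym; apply: contraNneq (Re_rising_neq0 m c0) => /ComplexField.Normc.eq0_normc ->.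
rewrite -[leLHS]mul1r ler_pdivrMr// exprVn mulrAC.
by rewrite ler_pdivlMr ?exprn_gt0// mul1r.
Qed.

Lemma normc_hterm c m x : normc (hcoef c m * (x ^+ m)%:C) = normc (hcoef c m) * `|x| ^+ m.
Proof. by rewrite ComplexField.Normc.normcM normc_real normrX. Qed.

Lemma hcoef_summable c x : 0 < Re c -> cvgn (series (fun m => normc (hcoef c m) * `|x| ^+ m)).
Proof.
move=> c0; have [C C0 hC] := hcoef_bound c0 (ltr01 : 0 < 1 :> R).
have h : cvgn (series (fun m => C * exp_coeff `|x| m)).
  by apply: is_cvg_seriesZ; exact: is_cvg_series_exp_coeff.
apply: series_le_cvg h => m.
- by rewrite mulr_ge0 ?normc_ge0 ?exprn_ge0.
- by rewrite mulr_ge0// divr_ge0 ?exprn_ge0.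
rewrite /exp_coeff /=; apply: le_trans (ler_wpM2r (exprn_ge0 _ (normr_ge0 _)) (hC m)) _.
by rewrite invr1 expr1n mul1r -mulrA [_^-1 * _]mulrC.
Qed.

Lemma hyp01_cvg c x : 0 < Re c -> cvg_cseries (fun m => hcoef c m * (x ^+ m)%:C).
Proof.
move=> c0; apply: (@cvg_cseries_norm _ _ (fun m => normc (hcoef c m) * `|x| ^+ m)); last exact: hcoef_summable.
by move=> m; rewrite normc_hterm.
Qed.

Lemma hyp01E c x : hyp01 c x = limn (pseries (fun m => Re (hcoef c m)) x) +i*
  limn (pseries (fun m => Im (hcoef c m)) x).
Proof.
rewrite /hyp01 /csum /pseries; congr (limn _ +i* limn _); congr series;
  by apply/funext => m; rewrite ?ReZr ?ImZr.
Qed.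

Lemma hyp01_pseries c x : 0 < Re c -> cvgn (pseries (fun m => Re (hcoef c m)) x) /\
  cvgn (pseries (fun m => Im (hcoef c m)) x).
Proof.
move=> c0; have [h1 h2] := hyp01_cvg x c0; split.
  by move: h1; under [X in series X]eq_fun do rewrite ReZr.
by move: h2; under [X in series X]eq_fun do rewrite ImZr.
Qed.

Lemma hcoef_diff c m : 0 < Re c -> m.+1%:R * hcoef c m.+1 = - c^-1 * hcoef (c + 1) m.
Proof.
move=> c0; rewrite /hcoef risingS factS natrM exprS.
have c0' : c != 0 by exact: Re_neq0.
have r0 : rising (c + 1) m != 0 by apply: Re_rising_neq0; rewrite ReD /= addr_gt0.
have f0 : m`!%:R != 0 :> R[i] by rewrite pnatr_eq0 -lt0n fact_gt0.
have m0 : m.+1%:R != 0 :> R[i] by rewrite pnatr_eq0.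
by move: (m.+1%:R) m0 => k m0; field; rewrite c0' r0 f0 m0.
Qed.

Lemma cvg_pseriesZ (u : nat -> R) k x : cvgn (pseries u x) ->
  cvgn (pseries (fun m => k * u m) x) /\
  limn (pseries (fun m => k * u m) x) = k * limn (pseries u x).
Proof.
have -> : pseries (fun m => k * u m) x = (fun n => k * pseries u x n).
  apply/funext => n; rewrite /pseries /series /= mulr_sumr.
  by apply: eq_bigr => i _; rewrite mulrA.
move=> cu; split; first exact: is_cvgMr.
by apply/cvg_lim => //; exact: cvgMr.
Qed.

Lemma cvg_pseriesB (u v : nat -> R) x : cvgn (pseries u x) -> cvgn (pseries v x) ->
  cvgn (pseries (fun m => u m - v m) x) /\
  limn (pseries (fun m => u m - v m) x) = limn (pseries u x) - limn (pseries v x).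
Proof.
have -> : pseries (fun m => u m - v m) x = (fun n => pseries u x n - pseries v x n).
  apply/funext => n; rewrite /pseries /series /= -sumrB.
  by apply: eq_bigr => i _; rewrite mulrBl.
move=> cu cv; split; first exact: is_cvgB.
by apply/cvg_lim => //; exact: cvgB.
Qed.

Let Re1 c : 0 < Re c -> 0 < Re (c + 1). Proof. by move=> ?; rewrite ReD /= addr_gt0. Qed.

Let diffs_Re c : 0 < Re c -> pseries_diffs (fun m => Re (hcoef c m)) =
  (fun m => Re (- c^-1) * Re (hcoef (c + 1) m) - Im (- c^-1) * Im (hcoef (c + 1) m)).
Proof.
move=> c0; apply/funext => m; rewrite /pseries_diffs /= -ReM -hcoef_diff//.
by rewrite -realc_nat ReZ.
Qed.
Let diffs_Im c : 0 < Re c -> pseries_diffs (fun m => Im (hcoef c m)) =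
  (fun m => Re (- c^-1) * Im (hcoef (c + 1) m) - - Im (- c^-1) * Re (hcoef (c + 1) m)).
Proof.
move=> c0; apply/funext => m; rewrite /pseries_diffs /= mulNr opprK -ImM -hcoef_diff//.
by rewrite -realc_nat ImZ.
Qed.

Let diffs_lin (k1 k2 : R) (u v : nat -> R) :
  pseries_diffs (fun m => k1 * u m - k2 * v m) =
  (fun m => k1 * pseries_diffs u m - k2 * pseries_diffs v m).
Proof. by apply/funext => m; rewrite /pseries_diffs /=; ring. Qed.

Let lin_cvg (k1 k2 : R) (u v : nat -> R) x : cvgn (pseries u x) -> cvgn (pseries v x) ->
  cvgn (pseries (fun m => k1 * u m - k2 * v m) x) /\
  limn (pseries (fun m => k1 * u m - k2 * v m) x) = k1 * limn (pseries u x) - k2 * limn (pseries v x).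
Proof.
move=> cu cv; have [c1 l1] := cvg_pseriesZ k1 cu; have [c2 l2] := cvg_pseriesZ k2 cv.
have [c3 l3] := cvg_pseriesB c1 c2; split; [exact: c3|rewrite -l1 -l2; exact: l3].
Qed.

Lemma deriv_hyp01 c x : 0 < Re c ->
  is_derive x 1 (fun t => Re (hyp01 c t)) (Re (- c^-1 * hyp01 (c + 1) x)) /\
  is_derive x 1 (fun t => Im (hyp01 c t)) (Im (- c^-1 * hyp01 (c + 1) x)).
Proof.
move=> c0; have c1 := Re1 c0; have c2 := Re1 c1.
(* Any radius beyond [|x|] would do: termwise differentiation asks for convergence at [K] of the
   series and of its two formal derivatives, which are multiples of the series with parameters
   [c + 1] and [c + 2]. *)
set K := `|x| + 1.
have [a1 a2] := hyp01_pseries K c0.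
have [b1 b2] := hyp01_pseries K c1.
have [d1 d2] := hyp01_pseries K c2.
have [b1x b2x] := hyp01_pseries x c1.
have xK : `|x| < `|K| by rewrite /K [ltRHS]ger0_norm ?addr_ge0// ltrDl.
rewrite ReM ImM !hyp01E /=.
have fE1 : (fun t => Re (hyp01 c t)) = (fun t => limn (pseries (fun m => Re (hcoef c m)) t)).
  by apply/funext => t; rewrite hyp01E.
have fE2 : (fun t => Im (hyp01 c t)) = (fun t => limn (pseries (fun m => Im (hcoef c m)) t)).
  by apply/funext => t; rewrite hyp01E.
rewrite fE1 fE2; split.
- have := @pseries_snd_diffs R (fun m => Re (hcoef c m)) K x a1.
  rewrite (diffs_Re c0) diffs_lin (diffs_Re c1) (diffs_Im c1).
  have [e1 _] := lin_cvg (Re (- c^-1)) (Im (- c^-1)) b1 b2.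
  have [g1 _] := lin_cvg (Re (- (c + 1)^-1)) (Im (- (c + 1)^-1)) d1 d2.
  have [g2 _] := lin_cvg (Re (- (c + 1)^-1)) (- Im (- (c + 1)^-1)) d2 d1.
  have [e2 _] := lin_cvg (Re (- c^-1)) (Im (- c^-1)) g1 g2.
  move=> /(_ e1 e2 xK) h; apply: (deriv_eq h).
  by have [_ ->] := lin_cvg (Re (- c^-1)) (Im (- c^-1)) b1x b2x.
- have := @pseries_snd_diffs R (fun m => Im (hcoef c m)) K x a2.
  rewrite (diffs_Im c0) diffs_lin (diffs_Re c1) (diffs_Im c1).
  have [e1 _] := lin_cvg (Re (- c^-1)) (- Im (- c^-1)) b2 b1.
  have [g1 _] := lin_cvg (Re (- (c + 1)^-1)) (Im (- (c + 1)^-1)) d1 d2.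
  have [g2 _] := lin_cvg (Re (- (c + 1)^-1)) (- Im (- (c + 1)^-1)) d2 d1.
  have [e2 _] := lin_cvg (Re (- c^-1)) (- Im (- c^-1)) g2 g1.
  move=> /(_ e1 e2 xK) h; apply: (deriv_eq h).
  by have [_ ->] := lin_cvg (Re (- c^-1)) (- Im (- c^-1)) b2x b1x; rewrite mulNr opprK.
Qed.

Lemma hyp01_0 c : hyp01 c 0 = 1.
Proof.
rewrite /hyp01 (@csum_finite _ _ 1) => [|m m0].
  by rewrite big_ord1 /hcoef rising0 fact0 expr0 mulr1 divr1 mulr1.
by rewrite expr0n gtn_eqF//= mulr0.
Qed.

(** Equivalent to the differential equation [x f'' + c f' + f = 0]. It supplies the relation
    [x g' = c (f - g)] of the energy argument, and it trades [c] for parameters of larger real part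
    at the cost of a factor [x]. *)
Lemma hyp01_contiguous c x : 0 < Re c ->
  hyp01 c x = hyp01 (c + 1) x - x%:C * (c * (c + 1))^-1 * hyp01 (c + 1 + 1) x.
Proof.
move=> c0; have c1 := Re1 c0; have c2 := Re1 c1.
apply/esym; apply: (@ccvg_unique _ (fun n => \sum_(m < n.+1) hcoef c m * (x ^+ m)%:C)); last first.
  exact/(ccvg_shift (fun n => \sum_(m < n) hcoef c m * (x ^+ m)%:C))/csum_ccvg/hyp01_cvg.
apply: (@ccvg_eq _ _ (fun n => \sum_(m < n.+1) hcoef (c + 1) m * (x ^+ m)%:C -
  x%:C * (c * (c + 1))^-1 * \sum_(m < n) hcoef (c + 1 + 1) m * (x ^+ m)%:C)); last first.
  apply: ccvgB; last by apply: ccvgZ; apply: csum_ccvg; exact: hyp01_cvg.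
  exact/(ccvg_shift (fun n => \sum_(m < n) hcoef (c + 1) m * (x ^+ m)%:C))/csum_ccvg/hyp01_cvg.
move=> n; apply/esym/eqP; rewrite subr_eq [X in _ == X]addrC -subr_eq -sumrB; apply/eqP.
rewrite big_ord_recl /= /hcoef !rising0 subrr add0r mulr_sumr; apply: eq_bigr => m _.
rewrite /bump leq0n add1n (risingS c m) (risingSr (c + 1) m).
have c0' : c != 0 by exact: Re_neq0.
have c1' : c + 1 != 0 by exact: Re_neq0.
have f0 : m`!%:R != 0 :> R[i] by rewrite pnatr_eq0 -lt0n fact_gt0.
have m0 : m.+1%:R != 0 :> R[i] by rewrite pnatr_eq0.
have r1 : rising (c + 1) m != 0 by exact: Re_rising_neq0.
have cm0 : c + 1 + m%:R != 0 by apply: Re_neq0; rewrite ReD Re_nat ltr_wpDr.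
have e1 : rising (c + 1 + 1) m = rising (c + 1) m * (c + 1 + m%:R) / (c + 1).
  by rewrite -risingSr risingS; field.
rewrite e1 factS natrM !exprS realcM -natr1 in m0 *.
by field; rewrite c0' c1' f0 m0 r1 cm0.
Qed.

Lemma le0_deriv_le (F F' : R -> R) x : 0 <= x -> (forall t : R, is_derive t 1 F (F' t)) ->
  (forall t, 0 < t -> F' t <= 0) -> F x <= F 0.
Proof.
rewrite le_eqVlt => /predU1P[<-//|x0] dF F'0.
have [|c] := @MVT R F F' 0 x x0 (fun t _ => dF t).
  by apply: continuous_subspaceT => t; exact: is_derive_continuous (dF t).
rewrite in_itv /= => /andP[c0 _] h; rewrite -subr_le0 h subr0.
by rewrite mulr_le0_ge0 ?F'0// ltW.
Qed.

(* Energy method: with [f = hyp01 c] and [g = hyp01 (c + 1)], so that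
   [f' = - g / c] and [x g' = c (f - g)], the quantity [|f|^2 + x |g / c|^2] has
   derivative [(1 - 2 Re c) |g / c|^2]. *)
Lemma hyp01_le1 c x : 2^-1 <= Re c -> 0 <= x -> normc (hyp01 c x) <= 1.
Proof.
move=> c12 x0; have c0 : 0 < Re c by apply: lt_le_trans c12.
have c1 := Re1 c0.
pose N := Re c ^+ 2 + Im c ^+ 2.
have N0 : 0 < N by rewrite ltr_pwDl ?exprn_gt0// sqr_ge0.
pose f1 t := Re (hyp01 c t); pose f2 t := Im (hyp01 c t).
pose g1 t := Re (hyp01 (c + 1) t); pose g2 t := Im (hyp01 (c + 1) t).
pose h1 t := Re (- (c + 1)^-1 * hyp01 (c + 1 + 1) t).
pose h2 t := Im (- (c + 1)^-1 * hyp01 (c + 1 + 1) t).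
have df1 (t : R) : is_derive t 1 f1 (- (Re c * g1 t + Im c * g2 t) / N).
  have [d _] := deriv_hyp01 t c0; apply: deriv_eq d _.
  by rewrite /N /g1 /g2 ReM; case: (c) (hyp01 _ t) => a b [u v] /=; ring.
have df2 (t : R) : is_derive t 1 f2 (- (Re c * g2 t - Im c * g1 t) / N).
  have [_ d] := deriv_hyp01 t c0; apply: deriv_eq d _.
  by rewrite /N /g1 /g2 ImM; case: (c) (hyp01 _ t) => a b [u v] /=; ring.
have dg1 (t : R) : is_derive t 1 g1 (h1 t) by have [] := deriv_hyp01 t c1.
have dg2 (t : R) : is_derive t 1 g2 (h2 t) by have [] := deriv_hyp01 t c1.
have xh (t : R) : t * h1 t = Re (c * (hyp01 c t - hyp01 (c + 1) t)) /\
            t * h2 t = Im (c * (hyp01 c t - hyp01 (c + 1) t)).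
  have c0' : c != 0 by exact: Re_neq0.
  have c1' : c + 1 != 0 by exact: Re_neq0.
  rewrite (hyp01_contiguous t c0) addrAC subrr add0r /h1 /h2.
  by split; [rewrite -ReZ|rewrite -ImZ]; congr (complex.Re _ ) || congr (complex.Im _); field; rewrite c0' c1'.
pose E t := (f1 t * f1 t + f2 t * f2 t) + N^-1 * (t * (g1 t * g1 t + g2 t * g2 t)).
pose E' t := ((- (Re c * g1 t + Im c * g2 t) / N) * f1 t + f1 t * (- (Re c * g1 t + Im c * g2 t) / N) +
   ((- (Re c * g2 t - Im c * g1 t) / N) * f2 t + f2 t * (- (Re c * g2 t - Im c * g1 t) / N))) +
   N^-1 * (1 * (g1 t * g1 t + g2 t * g2 t) + t * ((h1 t * g1 t + g1 t * h1 t) + (h2 t * g2 t + g2 t * h2 t))).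
have dE (t : R) : is_derive t 1 E (E' t).
  apply: deriv_add.
    by apply: deriv_add; apply: deriv_mul.
  apply: deriv_scale; apply: (deriv_mul (deriv_id t)).
  exact: (deriv_add (deriv_mul (dg1 t) (dg1 t)) (deriv_mul (dg2 t) (dg2 t))).
have E'E (t : R) : E' t = (1 - 2 * Re c) * (g1 t * g1 t + g2 t * g2 t) / N.
  have [e1 e2] := xh t.
  have -> : E' t = ((- (Re c * g1 t + Im c * g2 t) / N) * f1 t + f1 t * (- (Re c * g1 t + Im c * g2 t) / N) +
   ((- (Re c * g2 t - Im c * g1 t) / N) * f2 t + f2 t * (- (Re c * g2 t - Im c * g1 t) / N))) +
   N^-1 * ((g1 t * g1 t + g2 t * g2 t) + 2 * (g1 t * (t * h1 t) + g2 t * (t * h2 t))).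
    by rewrite /E'; ring.
  rewrite e1 e2 ReM ImM ReB ImB -/(f1 t) -/(f2 t) -/(g1 t) -/(g2 t).
  by ring.
have le : E x <= E 0.
  apply: le0_deriv_le dE _ => // t t0; rewrite E'E.
  rewrite mulr_le0_ge0 ?invr_ge0 ?(ltW N0)// mulr_le0_ge0//; first by lra.
  by rewrite -!expr2 addr_ge0 ?sqr_ge0.
have E0 : E 0 = 1.
  by rewrite /E /f1 /f2 hyp01_0 /= !mul0r !mulr0 !addr0 mulr1.
rewrite -(@ler_pXn2r _ 2) ?nnegrE ?normc_ge0// expr1n sqr_normc -E0.
apply: le_trans le; rewrite /E -!expr2 lerDl.
by rewrite !mulr_ge0 ?invr_ge0 ?(ltW N0)// addr_ge0 ?sqr_ge0.
Qed.

(** For [0 < Re c] both parameters [c + 1] and [c + 2] have real part above [1 / 2], so the two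
    functions on the right of the contiguous relation are bounded by 1. The explicit factor [x]
    there is the source of the linear growth. *)
Lemma hyp01_le c : 0 < Re c -> exists2 C, 0 <= C &
  forall x, 0 <= x -> normc (hyp01 c x) <= C * (1 + x).
Proof.
move=> c0; have c1 := Re1 c0; have c2 := Re1 c1.
have le12 z : 0 < Re z -> 2^-1 <= Re (z + 1) by move=> z0; rewrite ReD /=; lra.
exists (1 + normc (c * (c + 1))^-1); first by rewrite addr_ge0 ?normc_ge0.
move=> x x0; rewrite hyp01_contiguous//.
apply: le_trans (le_normcD _ _) _; rewrite normcN !ComplexField.Normc.normcM normc_real ger0_norm//.
have h1 := hyp01_le1 (le12 _ c0) x0; have h2 := hyp01_le1 (le12 _ c1) x0.
set k := normc (c * (c + 1))^-1; have k0 : 0 <= k by exact: normc_ge0.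
apply: (@le_trans _ _ (1 + x * k * 1)).
  by apply: lerD => //; rewrite ler_wpM2l// mulr_ge0.
by rewrite mulr1; nra.
Qed.

Lemma continuous_hyp01 c : 0 < Re c -> continuous (fun t => Re (hyp01 c t)) /\
  continuous (fun t => Im (hyp01 c t)).
Proof.
by move=> c0; split => t; have [h1 h2] := deriv_hyp01 t c0;
  [exact: is_derive_continuous h1|exact: is_derive_continuous h2].
Qed.

End hyp01.
Arguments hyp01 : simpl never.

(** * Fubini for kernels *)

Section fubini.
Context d1 d2 (T1 : measurableType d1) (T2 : measurableType d2) (R : realType).
Variables (m1 : {sigma_finite_measure set T1 -> \bar R}) (m2 : {sigma_finite_measure set T2 -> \bar R}).

Lemma Rintegral_restrict d (T : measurableType d) (m : {measure set T -> \bar R}) D (u : T -> R) :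
  \int[m]_(x in D) u x = \int[m]_x (u \_ D) x.
Proof.
rewrite /Rintegral integral_mkcond; congr fine; apply: eq_integral => x _.
by rewrite !patchE; case: ifP.
Qed.

(** The product majorant makes every section integrable, not only almost every one. The real-valued
    inner integrals therefore agree everywhere with the extended ones, for which Fubini is stated,
    and no exceptional null set appears. *)
Lemma fubini_bounded (f : T1 * T2 -> R) (a : T1 -> R) (b : T2 -> R) :
  measurable_fun setT f ->
  m1.-integrable setT (EFin \o a) -> m2.-integrable setT (EFin \o b) ->
  (forall s t, `|f (s, t)| <= `|a s| * `|b t|) ->
  [/\ m2.-integrable setT (EFin \o (fun t => \int[m1]_s f (s, t))),
      m1.-integrable setT (EFin \o (fun s => \int[m2]_t f (s, t))) &
      \int[m2]_t (\int[m1]_s f (s, t)) = \int[m1]_s (\int[m2]_t f (s, t))].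
Proof.
move=> mf ia ib fab.
have mEf : measurable_fun setT (EFin \o f) by exact/measurable_EFinP.
have s1 s : measurable_fun setT (fun t => (f (s, t))%:E) by exact: (measurableT_comp mEf (pair1_measurable s)).
have s2 t : measurable_fun setT (fun s => (f (s, t))%:E) by exact: (measurableT_comp mEf (pair2_measurable t)).
have ia' := integrable_abse ia; have ib' := integrable_abse ib.
have B t : (\int[m1]_s `|(f (s, t))%:E| <= `|b t|%:E * \int[m1]_s `|(a s)%:E|)%E.
  rewrite -ge0_integralZl ?lee_fin//; last by move: ia' => /integrableP[].
  apply: ge0_le_integral => //.
  - by apply: measurableT_comp => //; exact: s2.
  - by apply: emeasurable_funM => //; move: ia' => /integrableP[].
  by move=> s _; rewrite -EFinM lee_fin mulrC.
have A s : (\int[m2]_t `|(f (s, t))%:E| <= `|a s|%:E * \int[m2]_t `|(b t)%:E|)%E.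
  rewrite -ge0_integralZl ?lee_fin//; last by move: ib' => /integrableP[].
  apply: ge0_le_integral => //.
  - by apply: measurableT_comp => //; exact: s1.
  - by apply: emeasurable_funM => //; move: ib' => /integrableP[].
  by move=> t _; rewrite -EFinM lee_fin.
have a_fin : (\int[m1]_s `|(a s)%:E| < +oo)%E by move: ia => /integrableP[].
have b_fin : (\int[m2]_s `|(b s)%:E| < +oo)%E by move: ib => /integrableP[].
have a_num : (\int[m1]_s `|(a s)%:E|)%E \is a fin_num by rewrite ge0_fin_numE ?integral_ge0.
have b_num : (\int[m2]_s `|(b s)%:E|)%E \is a fin_num by rewrite ge0_fin_numE ?integral_ge0.
have If1 t : m1.-integrable setT (fun s => (f (s, t))%:E).
  apply/integrableP; split; first exact: s2.
  by apply: le_lt_trans (B t) _; rewrite -(fineK a_num) -EFinM ltry.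
have If2 s : m2.-integrable setT (fun t => (f (s, t))%:E).
  apply/integrableP; split; first exact: s1.
  by apply: le_lt_trans (A s) _; rewrite -(fineK b_num) -EFinM ltry.
have If : (m1 \x m2)%E.-integrable setT (EFin \o f).
  apply/integrable12ltyP => //.
  apply: (@le_lt_trans _ _ (\int[m1]_s (`|a s|%:E * \int[m2]_t `|(b t)%:E|)))%E.
    apply: ge0_le_integral => //.
    - by move=> s _; exact: integral_ge0.
    - by apply: (measurable_fun_fubini_tonelli_F (abse \o (EFin \o f))) => //=; exact: measurableT_comp.
    - by apply: emeasurable_funM => //; move: ia' => /integrableP[].
    by move=> s _; exact: A.
  rewrite ge0_integralZr//; [|by move: ia' => /integrableP[]|exact: integral_ge0].
  by rewrite -(fineK a_num) -(fineK b_num) -EFinM ltry.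
have e1 t : ((\int[m1]_s f (s, t))%:E = \int[m1]_s (f (s, t))%:E)%E.
  by rewrite /Rintegral fineK//; exact: integrable_fin_num.
have e2 s : ((\int[m2]_t f (s, t))%:E = \int[m2]_t (f (s, t))%:E)%E.
  by rewrite /Rintegral fineK//; exact: integrable_fin_num.
have E1 : EFin \o (fun t => \int[m1]_s f (s, t)) = fubini_G m1 (EFin \o f).
  by apply/funext => t; rewrite /= e1.
have E2 : EFin \o (fun s => \int[m2]_t f (s, t)) = fubini_F m2 (EFin \o f).
  by apply/funext => s; rewrite /= e2.
split.
- rewrite E1; apply: (le_integrable _ _ _ (integrableZr measurableT (fine (\int[m1]_s `|(a s)%:E|)) ib')) => //.
    exact: measurable_fubini_G If.
  move=> t _; apply: le_trans (le_abse_integral m1 measurableT (s2 t)) _.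
  by apply: le_trans (B t) _;  rewrite /= -[X in (_ * X <= _)%E](fineK a_num) lee_fin ler_norm.
- by rewrite E2; exact: integrable_fubini_F.
rewrite /Rintegral; congr fine.
under eq_integral do rewrite e1.
under [RHS]eq_integral do rewrite e2.
by have := Fubini If => ->.
Qed.

(** Extension of [u] and [v] by zero reduces the claim to the full product space; joint
    measurability is asked of the kernel [K] alone. *)
Lemma fubini_kernel D E (u a : T1 -> R) (v b : T2 -> R) (K : T1 -> T2 -> R) :
  measurable D -> measurable E -> measurable_fun D u -> measurable_fun E v ->
  measurable_fun setT (fun p : T1 * T2 => K p.1 p.2) ->
  m1.-integrable D (EFin \o a) -> m2.-integrable E (EFin \o b) ->
  (forall s t, D s -> E t -> `|u s * K s t * v t| <= a s * b t) ->
  [/\ m2.-integrable E (EFin \o (fun t => (\int[m1]_(s in D) (u s * K s t * v t)))),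
      m1.-integrable D (EFin \o (fun s => \int[m2]_(t in E) (u s * K s t * v t))) &
      \int[m2]_(t in E) (\int[m1]_(s in D) (u s * K s t * v t)) =
      \int[m1]_(s in D) (\int[m2]_(t in E) (u s * K s t * v t))].
Proof.
move=> mD mE mu mv mK ia ib uv_le.
pose f p := (u \_ D) p.1 * K p.1 p.2 * (v \_ E) p.2.
have mu' := (measurable_restrictT u mD).1 mu.
have mv' := (measurable_restrictT v mE).1 mv.
have mf : measurable_fun setT f.
  apply: measurable_funM; first apply: measurable_funM => //.
    by apply: (measurableT_comp mu'); exact: measurable_fst.
  by apply: (measurableT_comp mv'); exact: measurable_snd.
have ia' : m1.-integrable setT (EFin \o (a \_ D)).
  by rewrite -restrict_EFin; apply/(integrable_restrict _ mD measurableT); rewrite setTI.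
have ib' : m2.-integrable setT (EFin \o (b \_ E)).
  by rewrite -restrict_EFin; apply/(integrable_restrict _ mE measurableT); rewrite setTI.
have f_le s t : `|f (s, t)| <= `|(a \_ D) s| * `|(b \_ E) t|.
  rewrite /f /= !patchE; case: ifPn => [|_]; last by rewrite !mul0r normr0 mulr_ge0.
  rewrite inE => Ds; case: ifPn => [|_]; last by rewrite !mulr0 normr0 mulr_ge0.
  by rewrite inE => Et; rewrite -normrM (le_trans (uv_le s t Ds Et))// ler_norm.
have [h1 h2 h3] := fubini_bounded mf ia' ib' f_le.
have e1 t : \int[m1]_s f (s, t) = ((fun t => \int[m1]_(s in D) (u s * K s t * v t)) \_ E) t.
  rewrite patchE; case: ifPn => tE.
    rewrite /Rintegral [in RHS]integral_mkcond; congr fine; apply: eq_integral => s _.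
    by rewrite /f /= !patchE tE; case: ifPn => //; rewrite !mul0r.
  rewrite /Rintegral (eq_integral (fun=> 0%E)) ?integral0// => s _.
  by rewrite /f /= !patchE (negbTE tE) mulr0.
have e2 s : \int[m2]_t f (s, t) = ((fun s => \int[m2]_(t in E) (u s * K s t * v t)) \_ D) s.
  rewrite patchE; case: ifPn => sD.
    rewrite /Rintegral [in RHS]integral_mkcond; congr fine; apply: eq_integral => t _.
    by rewrite /f /= !patchE sD; case: ifPn => //; rewrite !mulr0.
  rewrite /Rintegral (eq_integral (fun=> 0%E)) ?integral0// => t _.
  by rewrite /f /= !patchE (negbTE sD) !mul0r.
split.
- move: h1; under [X in EFin \o X]eq_fun do rewrite e1.
  by rewrite -restrict_EFin => /(integrable_restrict _ mE measurableT); rewrite setTI.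
- move: h2; under [X in EFin \o X]eq_fun do rewrite e2.
  by rewrite -restrict_EFin => /(integrable_restrict _ mD measurableT); rewrite setTI.
by move: h3; rewrite (funext e1) (funext e2) -!Rintegral_restrict.
Qed.

End fubini.

Section real_fubini.
Variable R : realType.

Lemma rfubini (D E : set R) (u a v b : R -> R) (K : R -> R -> R) :
  measurable D -> measurable E -> measurable_fun D u -> measurable_fun E v ->
  measurable_fun setT (fun p : R * R => K p.1 p.2) ->
  rint D a -> rint E b ->
  (forall s t, D s -> E t -> `|u s * K s t * v t| <= a s * b t) ->
  [/\ rint E (fun t => (\int[leb]_(s in D) (u s * K s t * v t))),
      rint D (fun s => \int[leb]_(t in E) (u s * K s t * v t)) &
      \int[leb]_(t in E) (\int[leb]_(s in D) (u s * K s t * v t)) =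
      \int[leb]_(s in D) (\int[leb]_(t in E) (u s * K s t * v t))].
Proof.
move=> mD mE mu mv mK ia ib h.
exact: (@fubini_kernel _ _ _ _ R (@lebesgue_measure R) (@lebesgue_measure R) D E u a v b K mD mE mu mv mK ia ib h).
Qed.
End real_fubini.

(** * The integral operator *)

Section bessel_operator.
Variable R : realType.
Implicit Types (z : R[i]) (s t : R) (phi psi : R -> R[i]).

Lemma Re_double z : Re (2 * z) = 2 * Re z.
Proof. by rewrite -realc_nat ReZ. Qed.

Lemma Gamma_rising z n : 0 < Re z -> Gamma (z + n%:R) = rising z n * Gamma z.
Proof.
move=> z0; elim: n => [|n ih]; first by rewrite addr0 rising0 mul1r.
rewrite -natr1 addrA GammaS ?ih; last by rewrite ReD Re_nat ltr_wpDr.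
by rewrite risingSr; ring.
Qed.

Lemma normc_dens z s : 0 < s -> normc (dens z s) = rdens (Re z) s.
Proof.
move=> s0; rewrite /dens ComplexField.Normc.normcM normc_cpow// normc_real ger0_norm ?expR_ge0//.
by rewrite ReB Re_double.
Qed.

Lemma cmeasurable_dens D z : measurable D -> cmeasurable D (dens z).
Proof.
move=> mD; apply: cmeasurableM => //; first exact: cmeasurable_cpow.
apply: cmeasurable_real; have := @measurable_expN R D 1.
by under eq_fun do rewrite mul1r.
Qed.

Lemma dens_moment z k : 0 < Re z -> cint Rpos (fun s => (s ^+ k)%:C * dens z s) /\
  cintegral Rpos (fun s => (s ^+ k)%:C * dens z s) = rising (2 * z) k * Gamma (2 * z).
Proof.
move=> z0; have c0 : 0 < Re (2 * z) by rewrite Re_double mulr_gt0.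
have ck0 : 0 < Re (2 * z + k%:R) by rewrite ReD Re_nat ltr_wpDr.
have e s : Rpos s -> cpow s (2 * z + k%:R - 1) * (expR (- (1 * s)))%:C = (s ^+ k)%:C * dens z s.
  rewrite /Rpos /= in_itv /= andbT => s0; rewrite /dens mul1r addrAC cpowD cpow_nat//.
  by ring.
split; first by apply: cint_eq (cint_gamma ck0 ltr01) => //; exact: measurable_Rpos.
rewrite -Gamma_rising// /Gamma; apply: cintegral_eq => s ps.
by rewrite -e// mul1r.
Qed.

(** Since [2 q - 1] is twice [q - 1/2], the power of [2 sqrt (s t)] in front of the Bessel series is
    [2 ^ (2 q - 1) (s t) ^ (q - 1/2)], and both factors cancel. Only integral powers of [s t]
    remain. *)
Lemma bessel_kernel (q : R[i]) s t : 0 < Re q -> 0 < s -> 0 < t ->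
  besselJ (2 * q - 1) (2 * Num.sqrt (s * t)) / cpow (s * t) (q - 2^-1) =
  (Gamma (2 * q))^-1 * hyp01 (2 * q) (s * t).
Proof.
move=> q0 s0 t0; have c0 : 0 < Re (2 * q) by rewrite Re_double mulr_gt0.
have st0 : 0 < s * t by rewrite mulr_gt0.
have r0 : 0 < Num.sqrt (s * t) by rewrite sqrtr_gt0.
have two : (2 : R[i]) != 0 by rewrite pnatr_eq0.
have -> : 2 * q - 1 = (q - 2^-1) + (q - 2^-1) by field.
rewrite /besselJ (cpowM _ (ltr0n R 2) r0) cpow_sqrt//.
have n1 := cpow_neq0 (q - 2^-1) st0; have n2 := cpow_neq0 (q - 2^-1 + (q - 2^-1)) (ltr0n R 2).
rewrite (@csum_eq _ _ (fun m => (Gamma (2 * q))^-1 * (hcoef (2 * q) m * ((s * t) ^+ m)%:C))); last first.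
  move=> m; have -> : m%:R + (q - 2^-1 + (q - 2^-1)) + 1 = 2 * q + m%:R by field.
  have e : ((2 * Num.sqrt (s * t)) ^+ (2 * m))%:C = 2 ^+ (2 * m) * ((s * t) ^+ m)%:C :> R[i].
    rewrite exprMn realcM; congr (_ * _); first by rewrite realcX realc_nat.
    by rewrite exprM sqr_sqrtr ?(ltW st0).
  rewrite Gamma_rising// /hcoef e.
  set T := 2 ^+ (2 * m); have T0 : T != 0 by rewrite expf_neq0.
  rewrite !invfM; clearbody T.
  by move: (Gamma _)^-1 (m`!%:R^-1) (rising _ _)^-1 => a b d; field.
rewrite csumZ; last exact: hyp01_cvg.
by rewrite -/(hyp01 _ _); set X := (Gamma _)^-1 * _; field; rewrite n1 n2.
Qed.

(** The weight [1 + s] matches the kernel bound, as [1 + s t <= (1 + s) (1 + t)] separates the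
    variables. The sum of [|Re|] and [|Im|] in place of the modulus lets the norm split into two
    real integrals. *)
Definition cL1 (q : R[i]) phi := cmeasurable Rpos phi /\
  rint Rpos (fun s => (1 + s) * (`|Re (phi s)| + `|Im (phi s)|) * rdens (Re q) s).
Definition L1norm (q : R[i]) phi :=
  \int[leb]_(s in Rpos) ((1 + s) * (`|Re (phi s)| + `|Im (phi s)|) * rdens (Re q) s).

Section fixed_parameter.
Variable q : R[i].
Hypothesis q0 : 0 < Re q.
Local Notation c := (2 * q).
Local Notation w := (rdens (Re q)).
Let c0 : 0 < Re c. Proof. by rewrite Re_double mulr_gt0. Qed.

Definition Nker phi t s := (Gamma c)^-1 * hyp01 c (s * t) * phi s * dens q s.

Lemma opNE phi t : 0 < t -> opN q phi t = cintegral Rpos (Nker phi t).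
Proof.
move=> t0; apply: cintegral_eq => s /Rpos_gt0 s0.
by rewrite bessel_kernel.
Qed.

Lemma cmeasurable_hyp01 D t : measurable D -> cmeasurable D (fun s => hyp01 c (s * t)).
Proof.
move=> mD; have [h1 h2] := continuous_hyp01 c0.
have m : measurable_fun D (fun s : R => s * t) by apply: measurable_funM => //.
split.
  by apply: (measurableT_comp (continuous_measurable_fun h1) m).
by apply: (measurableT_comp (continuous_measurable_fun h2) m).
Qed.

Lemma cmeasurable_Nker phi t : cmeasurable Rpos phi -> cmeasurable Rpos (Nker phi t).
Proof.
move=> mphi; have mR := @measurable_Rpos R.
apply: cmeasurableM (cmeasurable_dens _ _) => //; apply: cmeasurableM => //.
by apply: cmeasurableM => //; exact: cmeasurable_hyp01.
Qed.

Lemma Nker_bound : exists2 C, 0 <= C & forall phi s t, 0 < s -> 0 < t ->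
  normc (Nker phi t s) <= C * (1 + t) * ((1 + s) * (`|Re (phi s)| + `|Im (phi s)|) * w s).
Proof.
have [C C0 hC] := hyp01_le c0.
exists (normc (Gamma c)^-1 * C); first by rewrite mulr_ge0 ?normc_ge0.
move=> phi s t s0 t0; rewrite /Nker ComplexField.Normc.normcM (normc_dens q s0) !ComplexField.Normc.normcM.
have hb : normc (hyp01 c (s * t)) <= C * ((1 + t) * (1 + s)).
  apply: le_trans (hC _ (mulr_ge0 (ltW s0) (ltW t0))) _; rewrite ler_wpM2l//.
  by nra.
rewrite [leRHS](_ : _ = normc (Gamma c)^-1 * (C * ((1 + t) * (1 + s))) *
  (`|Re (phi s)| + `|Im (phi s)|) * w s); last by ring.
apply: ler_wpM2r; first exact: rdens_ge0.
apply: ler_pM; rewrite ?mulr_ge0 ?normc_ge0//; last exact: normc_le_ReIm.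
by apply: ler_wpM2l => //; exact: normc_ge0.
Qed.

Lemma cint_Nker phi t : cL1 q phi -> 0 < t -> cint Rpos (Nker phi t).
Proof.
move=> [mphi rphi] t0; have [C _ hC] := Nker_bound.
apply: (@cint_dom _ _ _ (fun s => C * (1 + t) * ((1 + s) * (`|Re (phi s)| + `|Im (phi s)|) * w s))).
- exact: measurable_Rpos.
- exact: cmeasurable_Nker.
- by move=> s /Rpos_gt0 s0; exact: hC.
by apply: rintZ => //; exact: measurable_Rpos.
Qed.

Lemma opN_bound : exists2 C, 0 <= C & forall phi t, cL1 q phi -> 0 < t ->
  normc (opN q phi t) <= C * (1 + t) * L1norm q phi.
Proof.
have [C C0 hC] := Nker_bound; exists (2 * C); first by rewrite mulr_ge0.
move=> phi t [mphi rphi] t0; rewrite opNE//.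
rewrite -!mulrA [C * _]mulrA /L1norm -(RintZ _ (@measurable_Rpos R))//.
apply: cintegral_norm_le.
- exact: measurable_Rpos.
- exact: cmeasurable_Nker.
- by move=> s /Rpos_gt0 s0; exact: hC.
by apply: rintZ => //; exact: measurable_Rpos.
Qed.

Lemma opNB phi psi t : cL1 q phi -> cL1 q psi -> 0 < t ->
  opN q (fun s => phi s - psi s) t = opN q phi t - opN q psi t.
Proof.
move=> h1 h2 t0; rewrite !opNE// -cintegralB; [|exact: measurable_Rpos|exact: cint_Nker..].
by apply: cintegral_eq => s _; rewrite /Nker; ring.
Qed.

Lemma opN_sum I (r : seq I) (a : I -> R[i]) (F : I -> R -> R[i]) t :
  (forall i, cL1 q (F i)) -> 0 < t ->
  opN q (fun s => \sum_(i <- r) a i * F i s) t = \sum_(i <- r) a i * opN q (F i) t.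
Proof.
move=> h t0; rewrite opNE//.
rewrite (@cintegral_eq _ _ _ (fun s => \sum_(i <- r) a i * Nker (F i) t s)); last first.
  move=> s _; rewrite /Nker mulr_sumr mulr_suml; apply: eq_bigr => i _.
  by ring.
have mR := @measurable_Rpos R.
rewrite cintegral_sum//; last by move=> i; apply: cintZ => //; exact: cint_Nker.
apply: eq_bigr => i _; rewrite opNE//.
exact: (cintegralZ _ mR (cint_Nker (h i) t0)).
Qed.

End fixed_parameter.
End bessel_operator.

(** * The operators on square integrable functions *)

Section operator_on_L2.
Variable R : realType.
Variable q : R[i].
Hypothesis q0 : 0 < Re q.
Local Notation c := (2 * q).
Local Notation xi := (Re q).
Local Notation w := (rdens xi).
Implicit Types (s t : R) (phi psi : R -> R[i]).
Let c0 : 0 < Re c. Proof. by rewrite Re_double mulr_gt0. Qed.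
Let mR := @measurable_Rpos R.

Lemma Re_cintegral D (f : R -> R[i]) : Re (cintegral D f) = \int[leb]_(t in D) Re (f t).
Proof. by []. Qed.
Lemma Im_cintegral D (f : R -> R[i]) : Im (cintegral D f) = \int[leb]_(t in D) Im (f t).
Proof. by []. Qed.

(** Measurability in [t] is a by-product of Fubini. The kernel grows linearly in [t], so the factor
    [exp (- t)] is inserted to make the double integral converge and is divided out afterwards. *)
Lemma measurable_kernel_int (u K : R -> R) (C : R) : measurable_fun Rpos u ->
  rint Rpos (fun s => (1 + s) * `|u s|) -> continuous K ->
  (forall x, 0 <= x -> `|K x| <= C * (1 + x)) ->
  measurable_fun Rpos (fun t => \int[leb]_(s in Rpos) (u s * K (s * t))) /\
  forall t, 0 < t -> rint Rpos (fun s => u s * K (s * t)).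
Proof.
move=> mu ru cK hK.
have mK t : measurable_fun Rpos (fun s => K (s * t)).
  apply: (measurableT_comp (continuous_measurable_fun cK)).
  exact: measurable_funM.
have C0 : 0 <= C.
  by have := hK 0 (lexx _); rewrite addr0 mulr1; exact: le_trans (normr_ge0 _).
have K_le s t : 0 < s -> 0 < t -> `|K (s * t)| <= C * ((1 + s) * (1 + t)).
  move=> s0 t0; apply: le_trans (hK _ (mulr_ge0 (ltW s0) (ltW t0))) _.
  by rewrite ler_wpM2l//; nra.
have r1 t : 0 < t -> rint Rpos (fun s => u s * K (s * t)).
  move=> t0; apply: (@rint_dom _ _ _ (fun s => C * (1 + t) * ((1 + s) * `|u s|))) => //.
  - exact: measurable_funM.
  - move=> s /Rpos_gt0 s0; rewrite normrM.
    rewrite [leRHS](_ : _ = `|u s| * (C * ((1 + s) * (1 + t)))); last by ring.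
    by apply: ler_wpM2l => //; exact: K_le.
  exact: rintZ.
split=> //.
have rb : rint Rpos (fun t : R => (1 + t) * expR (- t)).
  apply: (@rint_eq _ _ (fun t => t `^ (1 - 1) * expR (- (1 * t)) + t `^ (2 - 1) * expR (- (1 * t)))) => //.
    move=> t /Rpos_gt0 t0; rewrite subrr powRr0 (_ : 2 - 1 = 1 :> R); last by ring.
    by rewrite powRr1 ?ltW// !mul1r mulrDl mul1r.
  by apply: rintD => //; apply: rint_gamma.
have mv : measurable_fun Rpos (fun t : R => expR (- t)).
  by have := @measurable_expN R Rpos 1; under eq_fun do rewrite mul1r.
have mK2 : measurable_fun setT (fun p : R * R => K (p.1 * p.2)).
  apply: (measurableT_comp (continuous_measurable_fun cK)).
  by apply: measurable_funM; [exact: measurable_fst|exact: measurable_snd].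
have uK_le s t : Rpos s -> Rpos t ->
    `|u s * K (s * t) * expR (- t)| <= C * ((1 + s) * `|u s|) * ((1 + t) * expR (- t)).
  move=> /Rpos_gt0 s0 /Rpos_gt0 t0; rewrite !normrM [`|expR _|]ger0_norm ?expR_ge0//.
  rewrite [leRHS](_ : _ = `|u s| * (C * ((1 + s) * (1 + t))) * expR (- t)); last by ring.
  by rewrite ler_wpM2r ?expR_ge0// ler_wpM2l// K_le.
have [h _ _] := @rfubini R Rpos Rpos u _ (fun t => expR (- t)) _ (fun s t => K (s * t))
  mR mR mu mv mK2 (rintZ C mR ru) rb uK_le.
have mi := rint_measurable h.
apply: (@eq_measurable_fun _ _ _ _ _ (fun t => (\int[leb]_(s in Rpos) (u s * K (s * t) * expR (- t))) * expR t)).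
  move=> t; rewrite inE => /Rpos_gt0 t0.
  under [X in X * _ = _]eq_Rintegral do rewrite mulrC.
  by rewrite RintZ//; [rewrite mulrC mulrA -expRD subrr expR0 mul1r|exact: r1].
by apply: (measurable_funM mi); apply: measurable_funTS; exact: measurable_expR.
Qed.

Lemma cmeasurable_opN phi : cL1 q phi -> cmeasurable Rpos (opN q phi).
Proof.
move=> [[m1 m2] rphi].
pose A s := (Gamma c)^-1 * phi s * dens q s.
have mA : cmeasurable Rpos A.
  apply: cmeasurableM (cmeasurable_dens _ _) => //.
  by apply: cmeasurableM => //; exact: cmeasurable_cst.
have A_le s : 0 < s -> normc (A s) <= normc (Gamma c)^-1 * ((`|Re (phi s)| + `|Im (phi s)|) * w s).
  move=> s0; rewrite /A ComplexField.Normc.normcM (normc_dens q s0) ComplexField.Normc.normcM -mulrA.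
  rewrite ler_wpM2l ?normc_ge0// ler_wpM2r ?rdens_ge0//; exact: normc_le_ReIm.
have rA (f : R[i] -> R) : measurable_fun Rpos (fun s => f (A s)) -> (forall z, `|f z| <= normc z) ->
    rint Rpos (fun s => (1 + s) * `|f (A s)|).
  move=> mf fz; apply: (@rint_dom _ _ _ (fun s => normc (Gamma c)^-1 * ((1 + s) * (`|Re (phi s)| + `|Im (phi s)|) * w s))) => //.
  - by apply: measurable_funM; [exact: measurable_funD|exact: measurableT_comp].
  - move=> s /Rpos_gt0 s0; rewrite normrM normr_id ger0_norm ?addr_ge0 ?(ltW s0)//.
    rewrite -(mulrA (1 + s)) mulrCA ler_wpM2l ?addr_ge0 ?(ltW s0)//.
    exact: le_trans (fz _) (A_le s s0).
  exact: rintZ.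
have [C C0 hC] := hyp01_le c0; have [k1 k2] := continuous_hyp01 c0.
have [p11 i11] := measurable_kernel_int mA.1 (rA _ mA.1 (@Re_le_normc R)) k1
  (fun x x0 => le_trans (Re_le_normc _) (hC x x0)).
have [p22 i22] := measurable_kernel_int mA.2 (rA _ mA.2 (@Im_le_normc R)) k2
  (fun x x0 => le_trans (Im_le_normc _) (hC x x0)).
have [p12 i12] := measurable_kernel_int mA.1 (rA _ mA.1 (@Re_le_normc R)) k2
  (fun x x0 => le_trans (Im_le_normc _) (hC x x0)).
have [p21 i21] := measurable_kernel_int mA.2 (rA _ mA.2 (@Im_le_normc R)) k1
  (fun x x0 => le_trans (Re_le_normc _) (hC x x0)).
have NA t s : Nker q phi t s = A s * hyp01 c (s * t) by rewrite /Nker /A; ring.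
split.
  apply: eq_measurable_fun (measurable_funB p11 p22) => t; rewrite inE => /Rpos_gt0 t0.
  rewrite opNE//; apply: etrans (esym (RintB mR (i11 t t0) (i22 t t0))) _.
  by rewrite Re_cintegral; apply: Rint_eq => s _; rewrite NA [RHS]ReM.
apply: eq_measurable_fun (measurable_funD p12 p21) => t; rewrite inE => /Rpos_gt0 t0.
rewrite opNE//; apply: etrans (esym (RintD mR (i12 t t0) (i21 t t0))) _.
by rewrite Im_cintegral; apply: Rint_eq => s _; rewrite NA [RHS]ImM.
Qed.

Definition cL2 phi := rL2 xi (fun t => Re (phi t)) /\ rL2 xi (fun t => Im (phi t)).

Lemma rL2_norm f : rL2 xi f -> rL2 xi (fun t => `|f t|).
Proof.
move=> h; apply: rL2_dom (h); last by move=> t _; rewrite normr_id.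
by apply: measurableT_comp => //; case: h.
Qed.

Lemma rL2_1D : rL2 xi (fun t => 1 + t).
Proof. by apply: rL2D; [have := rL2_mono q0 0|have := rL2_mono q0 1]. Qed.

(** The weighted [L^1] norm is a pairing of [|Re phi|] and [|Im phi|] with the square integrable
    function [1 + t]; hence convergence in [L^2(m_xi)] implies convergence in this norm. *)
Lemma L1norm_split phi : cL2 phi -> cL1 q phi /\
  L1norm q phi = \int[leb]_(t in Rpos) (`|Re (phi t)| * `|1 + t| * w t) +
    \int[leb]_(t in Rpos) (`|Im (phi t)| * `|1 + t| * w t).
Proof.
move=> [h1 h2]; have l1 := rL2_norm rL2_1D.
have i1 := rL2_mul (rL2_norm h1) l1; have i2 := rL2_mul (rL2_norm h2) l1.
have e s : Rpos s -> `|Re (phi s)| * `|1 + s| * w s + `|Im (phi s)| * `|1 + s| * w s =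
    (1 + s) * (`|Re (phi s)| + `|Im (phi s)|) * w s.
  by move=> /Rpos_gt0 s0; rewrite [`|1 + s|]ger0_norm ?addr_ge0 ?(ltW s0)//; ring.
split.
  split; first by split; [case: h1|case: h2].
  by apply: (rint_eq mR e); exact: rintD.
by rewrite -RintD//; apply: Rint_eq => s /e.
Qed.

Lemma cL2_cL1 phi : cL2 phi -> cL1 q phi.
Proof. by case/L1norm_split. Qed.

Lemma L1norm_cvg0 (f : nat -> R -> R[i]) : (forall n, cL2 (f n)) ->
  ip xi (fun t => Re (f n t)) (fun t => Re (f n t)) @[n --> \oo] --> 0 ->
  ip xi (fun t => Im (f n t)) (fun t => Im (f n t)) @[n --> \oo] --> 0 ->
  L1norm q (f n) @[n --> \oo] --> 0.
Proof.
move=> h c1 c2.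
under eq_fun => n do rewrite (L1norm_split (h n)).2.
rewrite -[0]addr0; apply: cvgD.
  by apply: (L2_pair_cvg0 (fun n => (h n).1) rL2_1D).
by apply: (L2_pair_cvg0 (fun n => (h n).2) rL2_1D).
Qed.

Lemma cL2B phi psi : cL2 phi -> cL2 psi -> cL2 (fun t => phi t - psi t).
Proof.
move=> [a1 a2] [b1 b2]; split.
  by under eq_fun do rewrite ReB; exact: rL2B.
by under eq_fun do rewrite ImB; exact: rL2B.
Qed.

Lemma cL2D phi psi : cL2 phi -> cL2 psi -> cL2 (fun t => phi t + psi t).
Proof.
move=> [a1 a2] [b1 b2]; split.
  by under eq_fun do rewrite ReD; exact: rL2D.
by under eq_fun do rewrite ImD; exact: rL2D.
Qed.

Lemma cL2Z (k : R[i]) phi : cL2 phi -> cL2 (fun t => k * phi t).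
Proof.
move=> [a1 a2]; split.
  by under eq_fun do rewrite ReM; apply: rL2B; exact: rL2Z.
by under eq_fun do rewrite ImM; apply: rL2D; exact: rL2Z.
Qed.

Lemma cL2_real (f : R -> R) : rL2 xi f -> cL2 (fun t => (f t)%:C).
Proof.
move=> h; split => //.
by apply: rL2_dom h => [|t _]; [exact: measurable_cst|rewrite normr0].
Qed.

Lemma cL2_sum I (r : seq I) (F : I -> R -> R[i]) : (forall i, cL2 (F i)) ->
  cL2 (fun t => \sum_(i <- r) F i t).
Proof.
move=> h; split.
  by under eq_fun do rewrite Re_sum; apply: rL2_sum => // i; case: (h i).
by under eq_fun do rewrite Im_sum; apply: rL2_sum => // i; case: (h i).
Qed.

Lemma cL2_dom phi (g : R -> R) : cmeasurable Rpos phi -> rL2 xi g ->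
  (forall t, 0 < t -> normc (phi t) <= g t) -> cL2 phi.
Proof.
move=> [m1 m2] rg h; split; apply: rL2_dom rg => // t t0.
  exact: le_trans (Re_le_normc _) (le_trans (h t t0) (ler_norm _)).
exact: le_trans (Im_le_normc _) (le_trans (h t t0) (ler_norm _)).
Qed.

Lemma cL2_opN phi : cL2 phi -> cL2 (opN q phi).
Proof.
move=> h; have h1 := cL2_cL1 h; have [C C0 hC] := opN_bound q0.
apply: (@cL2_dom _ (fun t => C * L1norm q phi * (1 + t))).
- exact: cmeasurable_opN.
- by apply: rL2Z => //; exact: rL2_1D.
by move=> t t0; rewrite mulrAC; exact: hC.
Qed.

Lemma cL2_opM phi : cL2 phi -> cL2 (opM phi).
Proof.
move=> [[m1 r1] [m2 r2]].
have mv : measurable_fun Rpos (fun t : R => expR (- t)).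
  by have := @measurable_expN R Rpos 1; under eq_fun do rewrite mul1r.
have le f t : 0 < t -> `|expR (- t) * f t| <= `|f t|.
  move=> t0; rewrite normrM ger0_norm ?expR_ge0// ler_piMl//.
  by rewrite -expR0 ler_expR oppr_le0 ltW.
split.
  under eq_fun do rewrite /opM ReZ.
  by apply: rL2_dom (fun t => le _ t) _ => //; exact: measurable_funM.
under eq_fun do rewrite /opM ImZ.
by apply: rL2_dom (fun t => le _ t) _ => //; exact: measurable_funM.
Qed.

End operator_on_L2.

(** * Laguerre coefficients and the matrix entries *)

Section operator_on_polynomials.
Variable R : realType.
Variable q : R[i].
Hypothesis q0 : 0 < Re q.
Local Notation c := (2 * q).
Local Notation xi := (Re q).
Local Notation w := (rdens xi).
Implicit Types (s t x : R) (phi psi : R -> R[i]).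
Let c0 : 0 < Re c. Proof. by rewrite Re_double mulr_gt0. Qed.
Let mR := @measurable_Rpos R.

(** This is [x ^ j] times the [j]-th derivative of the exponential series; the first [j] terms
    vanish. *)
Lemma ffact_exp_cvg x j :
  \sum_(m < n) (m ^_ j)%:R * (x ^+ m / m`!%:R) @[n --> \oo] --> x ^+ j * expR x.
Proof.
rewrite -(cvg_shiftn j).
have e n : \sum_(m < n + j) (m ^_ j)%:R * (x ^+ m / m`!%:R) = x ^+ j * exp_sum n x.
  rewrite addnC big_split_ord /= big1 ?add0r => [|i _]; last by rewrite ffact_small// mul0r.
  rewrite /exp_sum mulr_sumr; apply: eq_bigr => i _.
  have := ffact_fact (leq_addr i j); rewrite addKn => <-.
  rewrite exprD natrM.
  have f1 : ((j + i) ^_ j)%:R != 0 :> R by rewrite pnatr_eq0 -lt0n ffact_gt0 leq_addr.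
  have f2 : i`!%:R != 0 :> R by rewrite pnatr_eq0 -lt0n fact_gt0.
  by field; rewrite f1 f2.
under eq_fun do rewrite e.
by apply: cvgMr; exact: exp_sum_cvg.
Qed.

(* The factor [(Gamma c)^-1 * Gamma c] reappears in [Aplus]; keeping it avoids
   proving that [Gamma c] is not zero. *)
Lemma opN_mono l t : 0 < t ->
  opN q (fun s => (s ^+ l)%:C) t = (Gamma c)^-1 * Gamma c *
  \sum_(r < l.+1) 'C(l, r)%:R * rising (c + r%:R) (l - r) * ((- t) ^+ r * expR (- t))%:C.
Proof.
move=> t0; rewrite opNE//.
pose f n s := \sum_(m < n) ((Gamma c)^-1 * hcoef c m * (t ^+ m)%:C) * ((s ^+ (m + l))%:C * dens q s).
have A0 : 0 < 2 * t by rewrite mulr_gt0.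
have [C C0 hC] := hcoef_bound c0 A0.
pose g s := normc (Gamma c)^-1 * (C * expR (- (- 2^-1 * s))) * s ^+ l * w s.
have f_eq n s : f n s = (Gamma c)^-1 * (\sum_(m < n) hcoef c m * ((s * t) ^+ m)%:C) * (s ^+ l)%:C * dens q s.
  rewrite /f mulr_sumr !mulr_suml; apply: eq_bigr => m _.
  by rewrite exprD exprMn !realcM; ring.
have [_ cv] : cint Rpos (Nker q (fun s => (s ^+ l)%:C) t) /\
    ccvg (fun n => cintegral Rpos (f n)) (cintegral Rpos (Nker q (fun s => (s ^+ l)%:C) t)).
  apply: (@cdct _ Rpos f _ g) => //.
  - move=> n; have : cint Rpos (f n).
      by apply: cint_sum => // m; apply: cintZ => //; case: (dens_moment (m + l) q0).
    exact: cint_measurable.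
  - move=> n s /Rpos_gt0 s0; rewrite f_eq ComplexField.Normc.normcM (normc_dens q s0).
    rewrite !ComplexField.Normc.normcM normc_real ger0_norm ?exprn_ge0 ?(ltW s0)//.
    apply: ler_wpM2r; first exact: rdens_ge0.
    rewrite ler_wpM2r ?exprn_ge0 ?(ltW s0)// ler_wpM2l ?normc_ge0//.
    apply: le_trans (normc_sum _ _ _) _.
    apply: (@le_trans _ _ (C * exp_sum n (2^-1 * s))).
      rewrite /exp_sum mulr_sumr; apply: ler_sum => m _; rewrite normc_hterm.
      rewrite ger0_norm ?mulr_ge0 ?(ltW s0) ?(ltW t0)//.
      apply: le_trans (ler_wpM2r _ (hC m)) _; first by rewrite exprn_ge0// mulr_ge0 ?(ltW s0) ?(ltW t0).
      rewrite -mulrA ler_wpM2l// mulrAC -exprMn.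
      rewrite (_ : (2 * t)^-1 * (s * t) = 2^-1 * s)//.
      by field; rewrite gt_eqF.
    rewrite ler_wpM2l// mulNr opprK; apply: le_trans (ler_norm _) _.
    by apply: le_trans (exp_sum_le _ _) _; rewrite ger0_norm ?mulr_ge0 ?invr_ge0 ?(ltW s0).
  - have m2 : -1 < - 2^-1 :> R by lra.
    apply: rint_eq (rintZ (normc (Gamma c)^-1 * C) mR (rint_moment q0 l m2)) => // s _.
    by rewrite /g; move: (w s) => ws; ring.
  - move=> s /Rpos_gt0 s0; rewrite /Nker.
    apply: (ccvg_eq (fun n => f_eq n s)).
    apply: ccvgM (ccvg_cst _); apply: ccvgM (ccvg_cst _); apply: ccvgZ.
    by apply: csum_ccvg; exact: hyp01_cvg.
apply: ccvg_unique cv _.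
apply: (@ccvg_eq _ _ (fun n => (Gamma c)^-1 * Gamma c * \sum_(r < l.+1) 'C(l, r)%:R * rising (c + r%:R) (l - r) *
  (\sum_(m < n) (m ^_ r)%:R * ((- t) ^+ m / m`!%:R))%:C)).
  move=> n; rewrite cintegral_sum//; last first.
    by move=> m; apply: cintZ => //; case: (dens_moment (m + l) q0).
  have e m : cintegral Rpos (fun s => (Gamma c)^-1 * hcoef c m * (t ^+ m)%:C * ((s ^+ (m + l))%:C * dens q s)) =
    (Gamma c)^-1 * Gamma c * \sum_(r < l.+1) 'C(l, r)%:R * rising (c + r%:R) (l - r) * ((m ^_ r)%:R * ((- t) ^+ m / m`!%:R))%:C.
    have [d1 d2] := dens_moment (m + l) q0.
    (* The moment of order [m + l] contains [(2 q)_(m + l) = (2 q)_m (2 q + m)_l]. The first factor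
       cancels the denominator of [hcoef]; the second is expanded in falling factorials of [m],
       which leaves exponential series to be summed over [m]. *)
    rewrite cintegralZ// d2 rising_add rising_vandermonde.
    have r0 := Re_rising_neq0 m c0.
    have f2 : m`!%:R != 0 :> R[i] by rewrite pnatr_eq0 -lt0n fact_gt0.
    rewrite /hcoef; set S := \sum_(j < _) _.
    rewrite (_ : \sum_(r < _) _ = S * ((- t) ^+ m / m`!%:R)%:C); last first.
      rewrite /S mulr_suml; apply: eq_bigr => r _.
      by rewrite natrM !realcM realc_nat; ring.
    rewrite [in RHS]exprNn !realcM realcV realc_nat (realcX (- 1)) realcN.
    rewrite (_ : - 1%:C = -1)//; clearbody S.
    move: (Gamma c)^-1 => a; move: (Gamma c) ((-1) ^+ m) (rising c m) r0 (m`!%:R) f2 => b e z z0 k k0.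
    by field; rewrite z0 k0.
  rewrite (eq_bigr _ (fun (m : 'I_n) _ => e m)) -mulr_sumr exchange_big /=; congr (_ * _).
  by apply: eq_bigr => r _; rewrite realc_sum mulr_sumr.
apply: ccvgZ.
have : forall L : nat, ccvg (fun n => \sum_(r < L) 'C(l, r)%:R * rising (c + r%:R) (l - r) *
    (\sum_(m < n) (m ^_ r)%:R * ((- t) ^+ m / m`!%:R))%:C)
  (\sum_(r < L) 'C(l, r)%:R * rising (c + r%:R) (l - r) * ((- t) ^+ r * expR (- t))%:C).
  elim=> [|L ih]; first by apply: (@ccvg_eq _ _ (fun=> 0)) => [n|]; rewrite big_ord0//; exact: ccvg_cst.
  apply: (@ccvg_eq _ _ (fun n => \sum_(r < L) 'C(l, r)%:R * rising (c + r%:R) (l - r) *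
    (\sum_(m < n) (m ^_ r)%:R * ((- t) ^+ m / m`!%:R))%:C +
    'C(l, L)%:R * rising (c + L%:R) (l - L) *
    (\sum_(m < n) (m ^_ L)%:R * ((- t) ^+ m / m`!%:R))%:C)) => [n|].
    by rewrite big_ord_recr.
  rewrite big_ord_recr /=; apply: ccvgD ih _; apply: ccvgZ.
  by split; [exact: ffact_exp_cvg|exact: cvg_cst].
by move=> /(_ l.+1).
Qed.

(** The scalar product with [L k]; as [L k] is real, no conjugation appears. *)
Definition lagpair phi k := cintegral Rpos (fun t => phi t * (laguerre xi k t * w t)%:C).

Lemma lagpairE phi k : lagpair phi k =
  ip xi (fun t => Re (phi t)) (laguerre xi k) +i* ip xi (fun t => Im (phi t)) (laguerre xi k).
Proof.
apply: complex_ext; rewrite /lagpair ?Re_cintegral ?Im_cintegral; apply: Rint_eq => t _.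
  by rewrite ReZr mulrA.
by rewrite ImZr mulrA.
Qed.

Let cint_pair phi k : cL2 q phi -> cint Rpos (fun t => phi t * (laguerre xi k t * w t)%:C).
Proof.
move=> [h1 h2]; have rl := rL2_laguerre q0 k; split.
  by apply: rint_eq (rL2_mul h1 rl) => // t _; rewrite ReZr mulrA.
by apply: rint_eq (rL2_mul h2 rl) => // t _; rewrite ImZr mulrA.
Qed.

Lemma lagpairD phi psi k : cL2 q phi -> cL2 q psi ->
  lagpair (fun t => phi t + psi t) k = lagpair phi k + lagpair psi k.
Proof.
move=> h1 h2; rewrite -cintegralD//; [|exact: cint_pair..].
by apply: cintegral_eq => t _; rewrite mulrDl.
Qed.

Lemma lagpairB phi psi k : cL2 q phi -> cL2 q psi ->
  lagpair (fun t => phi t - psi t) k = lagpair phi k - lagpair psi k.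
Proof.
move=> h1 h2; rewrite -cintegralB//; [|exact: cint_pair..].
by apply: cintegral_eq => t _; rewrite mulrBl.
Qed.

Lemma lagpairZ (a : R[i]) phi k : cL2 q phi -> lagpair (fun t => a * phi t) k = a * lagpair phi k.
Proof.
move=> h; rewrite -cintegralZ//; last exact: cint_pair.
by apply: cintegral_eq => t _; rewrite mulrA.
Qed.

Lemma lagpair_sum I (r : seq I) (F : I -> R -> R[i]) k : (forall i, cL2 q (F i)) ->
  lagpair (fun t => \sum_(i <- r) F i t) k = \sum_(i <- r) lagpair (F i) k.
Proof.
move=> h; rewrite -cintegral_sum//; last by move=> i; exact: cint_pair.
by apply: cintegral_eq => t _; rewrite mulr_suml.
Qed.

Lemma lagpair_eq phi psi k : (forall t, 0 < t -> phi t = psi t) -> lagpair phi k = lagpair psi k.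
Proof. by move=> h; apply: cintegral_eq => t /Rpos_gt0 t0; rewrite h. Qed.

Lemma lagpair_real (f : R -> R) k : lagpair (fun t => (f t)%:C) k = (ip xi f (laguerre xi k))%:C.
Proof.
rewrite /lagpair -cintegral_real; apply: cintegral_eq => t _.
by rewrite -realcM mulrA.
Qed.

Lemma cL2_monoexp r : cL2 q (fun t => (t ^+ r * expR (- t))%:C).
Proof.
have := cL2_opM (cL2_real (rL2_mono q0 r)).
by rewrite /opM; under eq_fun do rewrite -realcM mulrC.
Qed.

End operator_on_polynomials.

(** * Rearrangement of finite sums, binomials as quotients of factorials *)

Section finite_sums.

Lemma big_ord_extend (V : nmodType) (F : nat -> V) m n : (m <= n)%N ->
  (forall j, (m <= j)%N -> F j = 0) -> \sum_(j < m) F j = \sum_(j < n) F j.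
Proof.
move=> mn F0; rewrite -(subnKC mn) big_split_ord /= [X in _ = _ + X]big1 ?addr0// => i _.
by rewrite F0// leq_addr.
Qed.

Lemma triangle_sum (V : nmodType) (F : nat -> nat -> V) n :
  \sum_(r < n) \sum_(j < r.+1) F r j = \sum_(j < n) \sum_(i < n - j) F (i + j)%N j.
Proof.
elim: n => [|n ih]; first by rewrite !big_ord0.
rewrite big_ord_recr /= ih [RHS]big_ord_recr /= subSnn big_ord1 add0n big_ord_recr /= addrA.
congr (_ + _); rewrite -big_split; apply: eq_bigr => j _ /=.
by rewrite subSn ?(ltnW (ltn_ord j))// big_ord_recr /= subnK// ltnW.
Qed.

Lemma bin_div (F : numFieldType) n m : (m <= n)%N ->
  'C(n, m)%:R = n`!%:R / (m`!%:R * (n - m)`!%:R) :> F.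
Proof.
move=> mn; rewrite -(bin_fact mn) !natrM mulfK// mulf_neq0// pnatr_eq0 -lt0n fact_gt0.
Qed.

Lemma ffact_div (F : numFieldType) n m : (m <= n)%N ->
  (n ^_ m)%:R = n`!%:R / (n - m)`!%:R :> F.
Proof.
move=> mn; rewrite -(ffact_fact mn) natrM mulfK// pnatr_eq0 -lt0n fact_gt0.
Qed.

Lemma rising_neg (K : comNzRingType) m i : rising (- m%:R : K) i = (-1) ^+ i * (m ^_ i)%:R.
Proof.
elim: i => [|i ih]; first by rewrite rising0 ffactn0 mulr1.
rewrite risingSr ih ffactnSr exprS natrM.
have [mi|im] := ltnP m i; first by rewrite ffact_small// !(mulr0, mul0r).
by rewrite natrB//; ring.
Qed.

End finite_sums.

(** * Evaluation of the matrix entries *)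

Section matrix_entries.
Variable R : realType.
Variable q : R[i].
Hypothesis q0 : 0 < Re q.
Local Notation c := (2 * q).
Local Notation xi := (Re q).
Local Notation e := (2 * xi).
Local Notation w := (rdens xi).
Implicit Types (s t x : R).
Let c0 : 0 < Re c. Proof. by rewrite Re_double mulr_gt0. Qed.
Let e0 : 0 < e. Proof. by rewrite mulr_gt0. Qed.
Let en0 n : 0 < n%:R + e. Proof. by rewrite ltr_wpDl. Qed.
Let fact0 (F : numFieldType) n : n`!%:R != 0 :> F.
Proof. by rewrite pnatr_eq0 -lt0n fact_gt0. Qed.

Lemma rising_neq0 (a : R) n : 0 < a -> rising a n != 0.
Proof. by move=> a0; apply/prodf_neq0 => i _; rewrite gt_eqF// ltr_wpDr. Qed.

Lemma realc_sign n : ((-1) ^+ n)%:C = (-1) ^+ n :> R[i].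
Proof. by rewrite realcX (_ : (-1)%:C = -1)// realcN. Qed.

Lemma hyp2F1_neg m (b z : R[i]) d : hyp2F1 (- m%:R) b d z =
  \sum_(i < m.+1) (-1) ^+ i * (m ^_ i)%:R * rising b i / rising d i * (z ^+ i / i`!%:R).
Proof.
rewrite /hyp2F1 (@csum_finite _ _ m.+1) => [|i mi].
  by apply: eq_bigr => i _; rewrite [pochhammer _ i]rising_neg.
by rewrite [pochhammer _ i]rising_neg ffact_small// mulr0 !mul0r.
Qed.

Lemma powR2_nat r x : 2 `^ (r%:R + x) = 2 ^+ r * 2 `^ x :> R.
Proof. by rewrite powRD ?pnatr_eq0 ?implybT// powR_mulrn. Qed.

(** The coefficient of [t ^ l] in [L n]. *)
Definition lagC n l : R :=
  rGamma (n%:R + e) / ((n - l)`!%:R * rGamma (l%:R + e)) * ((-1) ^+ l / l`!%:R).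

(** The case [x = 1] of [laguerre_laplace]: there [1 / (1 + x)] and [x / (1 + x)] are both one half,
    so the powers in the [j]-th term combine to [2 ^ - k] independently of [j]. *)
Lemma ip_monoexp r k : ip xi (fun t => t ^+ r * expR (- t)) (laguerre xi k) =
  rGamma (k%:R + e) / k`!%:R / 2 `^ (k%:R + e) * 2^-1 ^+ r *
  \sum_(j < r.+1) (-1) ^+ j * ('C(r, j)%:R * (k ^_ j)%:R * rising (e + j%:R) (r - j)).
Proof.
have h1 : -1 < 1 :> R by lra.
have := laguerre_laplace q0 k r h1.
under eq_Rintegral do rewrite mul1r.
rewrite /ip => ->; rewrite (_ : 1 + 1 = 2 :> R)//.
rewrite powRN !powR2_nat.
rewrite (eq_bigr (fun j : 'I_r.+1 => (2^-1) ^+ k * ((-1) ^+ j * ('C(r, j)%:R * (k ^_ j)%:R * rising (e + j%:R) (r - j))))).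
  rewrite -mulr_sumr; set S := \sum_(_ < _) _.
  have : 2 `^ e != 0 :> R by rewrite gt_eqF// powR_gt0.
  move: (2 `^ e) => z z0.
  rewrite !invfM !exprVn.
  have z1 : 2 ^+ k != 0 :> R by rewrite expf_neq0.
  have z2 : 2 ^+ r != 0 :> R by rewrite expf_neq0.
  clearbody S; have := fact0 R k; move: (k`!%:R) => f f0.
  by field; rewrite z0 z1 z2 f0.
move=> j _; have [jk|kj] := leqP j k; last by rewrite ffact_small// !(mulr0, mul0r).
have -> : 2^-1 ^+ k = 2^-1 ^+ j * 2^-1 ^+ (k - j) :> R by rewrite -exprD subnKC.
by rewrite div1r (exprNn 2^-1 j); ring.
Qed.

Lemma lagCE n l : (l <= n)%N -> lagC n l = rising e n / n`!%:R * 'C(n, l)%:R * (-1) ^+ l / rising e l.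
Proof.
move=> ln; rewrite /lagC ![_%:R + e]addrC !rGamma_rising// bin_div//.
have g0 : rGamma e != 0 by rewrite gt_eqF// rGamma_gt0.
have r0 := rising_neq0 l e0.
have := fact0 R n; have := fact0 R l; have := fact0 R (n - l).
move: (rGamma e) g0 (n`!%:R) (l`!%:R) ((n - l)`!%:R) => g g0 f1 f2 f3 h3 h2 h1.
by field; rewrite h1 h2 h3 r0 g0.
Qed.

(** After exchange of the sums, the sum over [l] is [binomial_ffact] at [y = - 1/2], where also
    [1 + y = 1/2]. What remains over [j] is Chu-Vandermonde, read backwards, for [(2 xi + k)_n], and
    this produces [Gamma (k + n + 2 xi)]. *)
Lemma ip_opM n k : ip xi (fun t => expR (- t) * laguerre xi n t) (laguerre xi k) =
  rGamma ((k + n)%:R + e) / (k`!%:R * n`!%:R) * 2 `^ (- ((k + n)%:R + e)).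
Proof.
have re t : expR (- t) * laguerre xi n t = \sum_(l <- index_enum 'I_n.+1) lagC n l * (t ^+ l * expR (- t)).
  rewrite /laguerre mulr_sumr; apply: eq_bigr => l _; rewrite /lagC; ring.
have rm r : rL2 xi (fun t => t ^+ r * expR (- t)) by case: (cL2_monoexp q0 r).
have rl := rL2_laguerre q0 k.
rewrite (funext re) ip_suml//; last by move=> l; exact: rL2Z.
have r0 j := rising_neq0 j e0.
have f0 m := fact0 R m.
pose K := rGamma (k%:R + e) / k`!%:R / 2 `^ (k%:R + e).
have el (l : 'I_n.+1) : ip xi (fun t => lagC n l * (t ^+ l * expR (- t))) (laguerre xi k) =
    K * (rising e n / n`!%:R) * \sum_(j < n.+1)
    (-1) ^+ j * (k ^_ j)%:R / (j`!%:R * rising e j) * ('C(n, l) * l ^_ j)%:R * (- 2^-1) ^+ l.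
  have ln : (l <= n)%N by rewrite -ltnS.
  rewrite ipZl// ip_monoexp -/K -(@big_ord_extend _ (fun j => (-1) ^+ j * (k ^_ j)%:R / (j`!%:R * rising e j) * ('C(n, l) * l ^_ j)%:R * (- 2^-1) ^+ l) l.+1)//; last first.
    by move=> j lj; rewrite (ffact_small lj) muln0; ring.
  rewrite !mulr_sumr; apply: eq_bigr => j _; have jl : (j <= l)%N by rewrite -ltnS.
  have risE : rising e l = rising e j * rising (e + j%:R) (l - j) by rewrite -rising_add subnKC.
  rewrite lagCE// risE natrM -(bin_ffact l) natrM (exprNn 2^-1 l).
  have rj : rising (e + j%:R) (l - j) != 0.
    by apply: rising_neq0; rewrite ltr_wpDr.
  have := r0 j; have := f0 j; have := f0 n.
  move: (j`!%:R) (n`!%:R) (rising e j) rj => a b d rj a0 b0 d0.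
  by field; rewrite a0 b0 d0 rj.
rewrite (eq_bigr _ (fun l _ => el l)) -mulr_sumr exchange_big /=.
have ej (j : 'I_n.+1) : \sum_(l < n.+1) (-1) ^+ j * (k ^_ j)%:R / (j`!%:R * rising e j) * ('C(n, l) * l ^_ j)%:R * (- 2^-1) ^+ l
   = 2^-1 ^+ n * ((('C(n, j) * k ^_ j)%:R * rising (e + j%:R) (n - j)) / rising e n).
  have jn : (j <= n)%N by rewrite -ltnS.
  rewrite (eq_bigr (fun l : 'I_n.+1 => (-1) ^+ j * (k ^_ j)%:R / (j`!%:R * rising e j) * (('C(n, l) * l ^_ j)%:R * (- 2^-1) ^+ l))); last by move=> l _; rewrite mulrA.
  rewrite -mulr_sumr binomial_ffact (_ : 1 + - 2^-1 = 2^-1 :> R); last by field.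
  have risE : rising e n = rising e j * rising (e + j%:R) (n - j) by rewrite -rising_add subnKC.
  have -> : 2^-1 ^+ n = 2^-1 ^+ j * 2^-1 ^+ (n - j) :> R by rewrite -exprD subnKC.
  rewrite risE -(bin_ffact n) !natrM (exprNn 2^-1 j).
  have rj : rising (e + j%:R) (n - j) != 0.
    by apply: rising_neq0; rewrite ltr_wpDr.
  have := r0 j; have := f0 j.
  have s1 : (-1) ^+ j * (-1) ^+ j = 1 :> R by rewrite -exprMn mulrNN mulr1 expr1n.
  rewrite [RHS](_ : _ = (-1) ^+ j * (-1) ^+ j * (2^-1 ^+ j * 2^-1 ^+ (n - j) * ('C(n, j)%:R * (k ^_ j)%:R * rising (e + j%:R) (n - j) /
    (rising e j * rising (e + j%:R) (n - j))))); last by rewrite s1 mul1r.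
  move: (j`!%:R) (rising e j) rj => a d rj a0 d0.
  by field; rewrite a0 d0 rj.
rewrite (eq_bigr _ (fun j _ => ej j)) -mulr_sumr -mulr_suml -rising_vandermonde.
have -> : (k + n)%:R + e = n%:R + (k%:R + e) by rewrite natrD; ring.
rewrite [in rGamma _]addrC rGamma_rising// powRN powR2_nat /K exprVn [e + _]addrC.
have p0 : 2 `^ (k%:R + e) != 0 :> R by rewrite gt_eqF// powR_gt0.
have n2 : 2 ^+ n != 0 :> R by rewrite expf_neq0.
have := f0 k; have := f0 n; move: (k`!%:R) (n`!%:R) (2 `^ _) p0 (rising e n) (r0 n) => a b p p0 z z0 b0 a0.
by field; rewrite a0 b0 p0 n2 z0.
Qed.

Lemma lagpair_opN n k : lagpair q (opN q (fun t => (laguerre xi n t)%:C)) k =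
  \sum_(l < n.+1) (lagC n l)%:C * ((Gamma c)^-1 * Gamma c *
   \sum_(r < l.+1) 'C(l, r)%:R * rising (c + r%:R) (l - r) * (-1) ^+ r *
   (ip xi (fun t => t ^+ r * expR (- t)) (laguerre xi k))%:C).
Proof.
have re : (fun t => (laguerre xi n t)%:C) = (fun t => \sum_(l <- index_enum 'I_n.+1) (lagC n l)%:C * (t ^+ l)%:C).
  apply/funext => t; rewrite /laguerre realc_sum; apply: eq_bigr => l _.
  by rewrite -realcM.
have m2 l : cL2 q (fun t : R => (t ^+ l)%:C) by apply: cL2_real => //; exact: rL2_mono.
have me r := cL2_monoexp q0 r.
rewrite (@lagpair_eq _ _ _ (fun t => \sum_(l <- index_enum 'I_n.+1) (lagC n l)%:C * ((Gamma c)^-1 * Gamma c *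
    \sum_(r <- index_enum 'I_l.+1) 'C(l, r)%:R * rising (c + r%:R) (l - r) * (-1) ^+ r * (t ^+ r * expR (- t))%:C))); last first.
  move=> t t0; rewrite re opN_sum//; last by move=> l; exact: cL2_cL1.
  apply: eq_bigr => l _; rewrite opN_mono//; congr (_ * (_ * _)); apply: eq_bigr => r _.
  by rewrite (exprNn t r) !realcM realc_sign; ring.
have ms l : cL2 q (fun t => \sum_(r <- index_enum 'I_l.+1) 'C(l, r)%:R * rising (c + r%:R) (l - r) * (-1) ^+ r * (t ^+ r * expR (- t))%:C).
  by apply: cL2_sum => // r; exact: cL2Z.
rewrite lagpair_sum//; last by move=> l; apply: cL2Z => //; exact: cL2Z.
apply: eq_bigr => l _; rewrite !lagpairZ//; last exact: cL2Z.
congr (_ * (_ * _)); rewrite lagpair_sum//; last by move=> r; exact: cL2Z.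
by apply: eq_bigr => r _; rewrite lagpairZ// lagpair_real.
Qed.

(** In the double sum over [j <= r <= l] put [r = i + j]. The factorisation [(2 q)_l = (2 q)_j (2 q
    + j)_i (2 q + i + j)_(l - i - j)] turns the sum over [i] into the terminating series
    [2F1 (j - l, 2 xi + j; 2 q + j; 1/2)]. Terms with [j > k] vanish with the falling factorial of
    [k], whence the upper limit [minn l k]. *)
Lemma Aplus_N_term l k :
  (Gamma c)^-1 * Gamma c *
   \sum_(r < l.+1) 'C(l, r)%:R * rising (c + r%:R) (l - r) * (-1) ^+ r *
   (ip xi (fun t => t ^+ r * expR (- t)) (laguerre xi k))%:C =
  (rGamma (k%:R + e) / 2 `^ (k%:R + e))%:C * (l`!%:R * Gamma (l%:R + c) *
  \sum_(j < (minn l k).+1)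
      2 ^- j / (j`!%:R * (l - j)`!%:R * (k - j)`!%:R * Gamma (j%:R + c)) *
      hyp2F1 (- l%:R + j%:R) (e%:C + j%:R) (c + j%:R) 2^-1).
Proof.
set K := rGamma _ / _.
pose F r j : R[i] := 'C(l, r)%:R * rising (c + r%:R) (l - r) * (-1) ^+ r * (K / k`!%:R * 2^-1 ^+ r)%:C *
  ((-1) ^+ j * ('C(r, j)%:R * (k ^_ j)%:R * rising (e%:C + j%:R) (r - j))).
have -> : \sum_(r < l.+1) 'C(l, r)%:R * rising (c + r%:R) (l - r) * (-1) ^+ r *
   (ip xi (fun t => t ^+ r * expR (- t)) (laguerre xi k))%:C = \sum_(r < l.+1) \sum_(j < r.+1) F r j.
  apply: eq_bigr => r _; rewrite ip_monoexp /F -mulr_sumr.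
  have -> : rGamma (k%:R + e) / k`!%:R / 2 `^ (k%:R + e) = K / k`!%:R by rewrite /K mulrAC.
  rewrite (realcM (_ * _ ^+ _)) mulrA; congr (_ * _); rewrite realc_sum; apply: eq_bigr => j _.
  rewrite !realcM !realc_nat realc_sign /rising realc_prod; congr (_ * (_ * _)).
  by apply: eq_bigr => i _; rewrite !realcD !realc_nat realcM realc_nat.
rewrite triangle_sum -(@big_ord_extend _ (fun j => \sum_(i < l.+1 - j) F (i + j)%N j) (minn l k).+1); last 2 first.
- by rewrite ltnS geq_minl.
- move=> j; rewrite gtn_min => /orP[lj|kj].
    by have -> : (l.+1 - j = 0)%N by [apply/eqP; rewrite subn_eq0]; rewrite big_ord0.
  by rewrite big1// => i _; rewrite /F (ffact_small kj); ring.
rewrite !mulr_sumr; apply: eq_bigr => j _.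
have jm : (j <= minn l k)%N by rewrite -ltnS.
have [jl jk] : (j <= l)%N /\ (j <= k)%N by move: jm; rewrite leq_min => /andP.
have -> : - l%:R + j%:R = - (l - j)%:R :> R[i] by rewrite natrB//; ring.
rewrite hyp2F1_neg subSn// !mulr_sumr; apply: eq_bigr => i _.
have il : (i <= l - j)%N by rewrite -ltnS.
move: (nat_of_ord i) il => {}i il; move: (nat_of_ord j) jm jl jk il => {}j jm jl jk il.
have ijl : (i + j <= l)%N by rewrite addnC -leq_subRL.
rewrite /F addnK ![_%:R + c]addrC !Gamma_rising//.
rewrite (bin_div _ ijl) (bin_div _ (leq_addl i j)) addnK (ffact_div _ jk) (ffact_div _ il) -subnDA [(j + i)%N]addnC.
have rl : rising c l = rising c j * (rising (c + j%:R) i * rising (c + (i + j)%:R) (l - (i + j))).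
  have -> : c + (i + j)%:R = c + j%:R + i%:R by rewrite natrD; ring.
  by rewrite -!rising_add addnA [(j + i)%N]addnC subnKC.
rewrite rl.
have r1 := Re_rising_neq0 j c0.
have r2 : rising (c + j%:R) i != 0 by apply: Re_rising_neq0; rewrite ReD Re_nat ltr_wpDr.
have f0 m := fact0 R[i] m.
rewrite !realcM !realcX !realcV !realc_nat !exprD !exprVn.
rewrite !invfM.
have s1 : (-1) ^+ j * (-1) ^+ j = 1 :> R[i] by rewrite -exprMn mulrNN mulr1 expr1n.
rewrite -[RHS]mul1r -[X in _ = X * _]s1.
have p0 : (2 `^ (k%:R + e))%:C^-1 * (2 `^ (k%:R + e))%:C = 1 :> R[i].
  by rewrite -realcV -realcM mulVf// gt_eqF// powR_gt0.
move: ((Gamma c)^-1) => a; move: (Gamma c) => b.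
move: (rising c j) r1 (rising (c + j%:R) i) r2 => z1 r1 z2 r2.
move: (rising (c + _) _) (rising (_ + _) i) => z3 z4.
move: ((2 `^ _)%:C^-1) => p.
have := f0 (i + j)%N; have := f0 (l - (i + j))%N; have := f0 l; have := f0 j; have := f0 i.
have := f0 k; have := f0 (k - j)%N; have := f0 (l - j)%N.
have t1 : 2 ^+ i != 0 :> R[i] by rewrite expf_neq0// pnatr_eq0.
have t2 : 2 ^+ j != 0 :> R[i] by rewrite expf_neq0// pnatr_eq0.
move: ((i + j)`!%:R) ((l - (i + j))`!%:R) (l`!%:R) (j`!%:R) (i`!%:R) (k`!%:R) ((k - j)`!%:R) ((l - j)`!%:R).
move: ((-1) ^+ i) ((-1) ^+ j) (2 ^+ i) t1 (2 ^+ j) t2 => x y u1 t1 u2 t2 f1 f2 f3 f4 f5 f6 f7 f8 h8 h7 h6 h5 h4 h3 h2 h1.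
by field; rewrite r1 r2 t1 t2 h1 h2 h4 h5 h6 h7 h8.
Qed.

Lemma AplusE n k : Aplus q k n =
  lagpair q (fun t => opM (fun s => (laguerre xi n s)%:C) t + opN q (fun s => (laguerre xi n s)%:C) t) k.
Proof.
have cl : cL2 q (fun t : R => (laguerre xi n t)%:C) by apply: cL2_real; exact: rL2_laguerre.
rewrite lagpairD//; [|exact: cL2_opM|exact: cL2_opN].
rewrite lagpair_opN /Aplus; congr (_ + _).
  rewrite (@lagpair_eq _ _ _ (fun t => (expR (- t) * laguerre xi n t)%:C)).
    by rewrite lagpair_real ip_opM.
  by move=> t _; rewrite /opM realcM.
rewrite mulr_sumr; apply: eq_bigr => l _; rewrite Aplus_N_term.
set S := \sum_(_ < _) _.
rewrite /lagC !realcM !realcV !realcM !realc_nat realc_sign.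
have := fact0 R[i] l; move: (l`!%:R) => f f0.
clearbody S; rewrite !invfM.
move: S; generalize ((-1) ^+ l : R[i]).
generalize (Gamma (l%:R + c)).
generalize (rGamma (n%:R + e))%:C (rGamma (k%:R + e))%:C.
generalize (2 `^ (k%:R + e))%:C^-1.
move: (_`!%:R^-1 / _) => a b g h d u v.
by field.
Qed.

End matrix_entries.

(** * Laplace transforms over the unit interval *)

Section unit_interval.
Variable R : realType.
Implicit Types (z : R[i]) (s t u x : R).
Local Notation D := (`]0, 1[%classic : set R).
Let mD := @measurable_01 R.
Let in01 u : D u -> 0 < u /\ u < 1.
Proof. by rewrite /= in_itv /= => /andP. Qed.

Lemma natinv3_cvg0 : (n.+3%:R^-1 : R) @[n --> \oo] --> 0.
Proof.
have := @cvg_harmonic R; rewrite -(cvg_shiftn 2).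
by under eq_fun do rewrite /harmonic /= addn2.
Qed.

Lemma rint_powR01 a : -1 < a -> rint D (fun u => u `^ a).
Proof.
move=> a1; have a0 : 0 < a + 1 by rewrite -(ltrD2r (- 1)) addrK add0r.
apply: (@ge0_FTC_exhausts R _ _ _ _ (fun s => (a + 1)^-1 * s `^ (a + 1)) (a + 1)^-1 _ (exhausts_01 R)) => //.
- exact: measurable_powR_on.
- by move=> u _; exact: powR_ge0.
- move=> u /in01[u0 _]; apply: deriv_eq (deriv_scale _ (is_derive1_powR (a + 1) u0)) _.
  by rewrite addrK mulrA mulVf ?mul1r// gt_eqF.
- by move=> u /in01[u0 _]; exact: continuous_powR.
move=> n; rewrite lerBlDr -[leLHS]addr0; apply: lerD; last first.
  by rewrite mulr_ge0 ?invr_ge0 ?powR_ge0 ?(ltW a0).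
rewrite -[leRHS]mulr1 ler_pM2l ?invr_gt0//.
have h : 0 <= 1 - n.+3%:R^-1 :> R by rewrite subr_ge0 invf_le1 ?ler1n.
have := @ge0_ler_powR R (a + 1) (ltW a0) (1 - n.+3%:R^-1) 1.
by rewrite powR1; apply; rewrite ?nnegrE// gerBl invr_ge0.
Qed.

Lemma cint_cpow01 z (f : R -> R) (C : R) : 0 < Re z -> measurable_fun D f ->
  (forall u, D u -> `|f u| <= C) -> cint D (fun u => cpow u (z - 1) * (f u)%:C).
Proof.
move=> z0 mf fC; have h : -1 < Re z - 1 by rewrite ltrBrDr addrC subrr.
apply: (@cint_dom _ _ _ (fun u => C * u `^ (Re z - 1))) => //.
- by apply: (cmeasurableM mD (cmeasurable_cpow D _)); split => //=; exact: measurable_cst.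
- move=> u Du; have [u0 _] := in01 Du.
  rewrite ComplexField.Normc.normcM normc_cpow// normc_real ReB mulrC.
  by rewrite ler_wpM2r ?powR_ge0// fC.
by apply: rintZ => //; exact: rint_powR01.
Qed.

(** The integrand is the derivative of [u ^ z p u], whose boundary value at 0 vanishes because
    [0 < Re z]. Regularity of [p] on [-1 < u] includes the endpoint 1 and suits powers of
    [1 + u]. *)
Lemma cFTC01 z (p p' : R -> R) (C : R) : 0 < Re z ->
  (forall u : R, -1 < u -> is_derive u 1 p (p' u)) ->
  (forall u : R, -1 < u -> {for u, continuous p'}) ->
  (forall u, D u -> `|p u| <= C) -> (forall u, D u -> `|p' u| <= C) ->
  let f u := z * (cpow u (z - 1) * (p u)%:C) + cpow u z * (p' u)%:C in
  cint D f /\ cintegral D f = (p 1)%:C.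
Proof.
move=> z0 dp cp' pC p'C f.
have D1 u : D u -> -1 < u by move=> /in01[u0 _]; apply: lt_trans u0; rewrite ltrN10.
have cp u : -1 < u -> {for u, continuous p} by move=> h; exact: is_derive_continuous (dp u h).
have mp (g : R -> R) : (forall u : R, -1 < u -> {for u, continuous g}) -> measurable_fun D g.
  move=> cg; apply: open_continuous_measurable_fun; first exact: interval_open.
  by move=> u; rewrite inE => /D1; exact: cg.
have fint : cint D f.
  apply: cintD => //.
    by apply: cintZ => //; apply: (@cint_cpow01 _ _ C) => //; exact: mp.
  have z1 : 0 < Re (z + 1) by rewrite ReD addr_gt0.
  by have := @cint_cpow01 (z + 1) p' C z1 (mp _ cp') p'C; rewrite addrK.
split=> //.
have ReF t : Re (f t) = Re (z * cpow t (z - 1)) * p t + Re (cpow t z) * p' t.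
  by rewrite /f mulrA ReD !ReZr.
have ImF t : Im (f t) = Im (z * cpow t (z - 1)) * p t + Im (cpow t z) * p' t.
  by rewrite /f mulrA ImD !ImZr.
have cR w t : 0 < t -> {for t, continuous (fun s => Re (cpow s w))}.
  by move=> t0; exact: is_derive_continuous (deriv_Re_cpow w t0).
have cI w t : 0 < t -> {for t, continuous (fun s => Im (cpow s w))}.
  by move=> t0; exact: is_derive_continuous (deriv_Im_cpow w t0).
have dR t : D t -> is_derive t 1 (fun t => Re (cpow t z) * p t) (Re (f t)).
  by move=> Dt; rewrite ReF; exact: (deriv_mul (deriv_Re_cpow z (in01 Dt).1) (dp t (D1 _ Dt))).
have dI t : D t -> is_derive t 1 (fun t => Im (cpow t z) * p t) (Im (f t)).
  by move=> Dt; rewrite ImF; exact: (deriv_mul (deriv_Im_cpow z (in01 Dt).1) (dp t (D1 _ Dt))).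
have cfR t : D t -> {for t, continuous (fun t => Re (f t))}.
  move=> Dt; have t0 := (in01 Dt).1; have t1 := D1 _ Dt.
  rewrite (funext ReF); apply: continuous_add; apply: continuous_mul; [|exact: cp|exact: cR|exact: cp'].
  rewrite (funext (fun s => ReM z (cpow s (z - 1)))).
  by apply: continuous_sub; apply: continuous_mul; (try exact: cst_continuous); [exact: cR|exact: cI].
have cfI t : D t -> {for t, continuous (fun t => Im (f t))}.
  move=> Dt; have t0 := (in01 Dt).1; have t1 := D1 _ Dt.
  rewrite (funext ImF); apply: continuous_add; apply: continuous_mul; [|exact: cp|exact: cI|exact: cp'].
  rewrite (funext (fun s => ImM z (cpow s (z - 1)))).
  by apply: continuous_add; apply: continuous_mul; (try exact: cst_continuous); [exact: cI|exact: cR].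
have a0 : (n.+3%:R^-1 : R) `^ Re z @[n --> \oo] --> 0.
  have := powR_natinv_cvg0 z0; rewrite -(cvg_shiftn 2).
  by under eq_fun do rewrite addn2.
have lim0 : ccvg (fun n => cpow n.+3%:R^-1 z * (p n.+3%:R^-1)%:C) 0.
  apply: (@ccvg_norm0 _ _ _ (fun n => C * n.+3%:R^-1 `^ Re z)).
    move=> n; rewrite subr0 ComplexField.Normc.normcM normc_cpow// normc_real mulrC.
    rewrite ler_wpM2r ?powR_ge0// pC//= in_itv /= invr_gt0 ltr0n /=.
    by rewrite invf_lt1 ?ltr0n// ltr1n.
  by rewrite -(mulr0 C); exact: cvgMr.
have b1 : (1 - n.+3%:R^-1 : R) @[n --> \oo] --> (1 : R).
  by rewrite -[X in _ --> X]subr0; apply: cvgB; [exact: cvg_cst|exact: natinv3_cvg0].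
have lim1 (g : R -> R) : {for 1, continuous g} -> g (1 - n.+3%:R^-1) @[n --> \oo] --> g 1.
  by move=> cg; exact: (cvg_comp (fun n => 1 - n.+3%:R^-1 : R) g b1 cg).
have c1 : 0 < 1 :> R by []. have m1 : -1 < 1 :> R by lra.
have l1R := lim1 _ (continuous_mul (cR z 1 c1) (cp 1 m1)).
have l1I := lim1 _ (continuous_mul (cI z 1 c1) (cp 1 m1)).
move: lim0 => [l0R l0I]; move: fint => [fR fI].
have {}l0R : Re (cpow n.+3%:R^-1 z) * p n.+3%:R^-1 @[n --> \oo] --> (0 : R).
  by move: l0R; under eq_fun do rewrite ReZr.
have {}l0I : Im (cpow n.+3%:R^-1 z) * p n.+3%:R^-1 @[n --> \oo] --> (0 : R).
  by move: l0I; under eq_fun do rewrite ImZr.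
apply: complex_ext; rewrite ?Re_cintegral ?Im_cintegral.
  by rewrite (FTC_exhausts mD (exhausts_01 R) dR cfR l0R l1R fR) subr0 cpow1r mul1r.
by rewrite (FTC_exhausts mD (exhausts_01 R) dI cfI l0I l1I fI) subr0 cpow1r mul0r.
Qed.

Lemma cintegral_cpow01 z : 0 < Re z -> cintegral D (fun u => cpow u (z - 1)) = z^-1.
Proof.
move=> z0; have zn : z != 0 by exact: Re_neq0.
have i1 : cint D (fun u => cpow u (z - 1) * (1 : R)%:C).
  by apply: (@cint_cpow01 _ (fun=> 1) 1) => // u _; rewrite normr1.
have := @cFTC01 z (fun=> 1) (fun=> 0) 1 z0.
move=> /(_ (fun u _ => deriv_cst u 1) (fun u _ => @cst_continuous _ _ _ _)) h.
have {}h : cintegral D (fun u => z * (cpow u (z - 1) * (1 : R)%:C) + cpow u z * (0 : R)%:C) = 1.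
  by apply: (proj2 (h _ _)) => u _; rewrite ?normr1 ?normr0.
move: h; under [X in cintegral _ X]eq_fun do rewrite [_ * 0%:C]mulr0 addr0.
rewrite cintegralZ// => h; rewrite (@cintegral_eq _ _ _ (fun u => cpow u (z - 1) * (1 : R)%:C)).
  by apply: (mulfI zn); rewrite h mulfV.
by move=> u _; rewrite mulr1.
Qed.

Definition laplace01 z t := cintegral D (fun u => cpow u (z - 1) * (expR (- (u * t)))%:C).

Lemma cint_laplace01 z t : 0 < Re z -> 0 <= t -> cint D (fun u => cpow u (z - 1) * (expR (- (u * t)))%:C).
Proof.
move=> z0 t0; apply: (@cint_cpow01 _ _ 1) => //.
  by apply: eq_measurable_fun (@measurable_expN R D t) => u _; rewrite mulrC.
move=> u /in01[u0 _]; rewrite ger0_norm ?expR_ge0// -[leRHS]expR0 ler_expR oppr_le0.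
by rewrite mulr_ge0// ltW.
Qed.

Lemma normc_laplace01 z : 0 < Re z -> exists2 C, 0 <= C & forall t, 0 <= t -> normc (laplace01 z t) <= C.
Proof.
move=> z0; have h : -1 < Re z - 1 by rewrite ltrBrDr addrC subrr.
exists (2 * \int[leb]_(u in D) (u `^ (Re z - 1))).
  by rewrite mulr_ge0// Rintegral_ge0// => u _; exact: powR_ge0.
move=> t t0; apply: cintegral_norm_le => //; last exact: rint_powR01.
  exact: cint_measurable (cint_laplace01 z0 t0).
move=> u /in01[u0 _]; rewrite ComplexField.Normc.normcM normc_cpow// ReB normc_real.
rewrite ger0_norm ?expR_ge0// ler_piMr ?powR_ge0//.
by rewrite -[leRHS]expR0 ler_expR oppr_le0 mulr_ge0// ltW.
Qed.

(** The exponential series integrated term by term. Comparison of coefficients then identifies both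
    parts of the right-hand side with such transforms, and measurability in [t] follows as well. *)
Lemma ccvg_laplace01 z t : 0 < Re z -> 0 < t ->
  ccvg (fun n => \sum_(m < n) (((- t) ^+ m / m`!%:R)%:C / (z + m%:R))) (laplace01 z t).
Proof.
move=> z0 t0; have h : -1 < Re z - 1 by rewrite ltrBrDr addrC subrr.
have zm m : 0 < Re (z + m%:R) by rewrite ReD Re_nat ltr_wpDr.
have i1 m : cint D (fun u => cpow u (z + m%:R - 1)).
  have : cint D (fun u => cpow u (z + m%:R - 1) * (1 : R)%:C).
    by apply: (@cint_cpow01 _ (fun=> 1) 1) => // u _; rewrite normr1.
  by apply: cint_eq => // u _; rewrite mulr1.
pose f n u := \sum_(m < n) ((- t) ^+ m / m`!%:R)%:C * cpow u (z + m%:R - 1).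
have fE n u : 0 < u -> f n u = cpow u (z - 1) * (exp_sum n (- (u * t)))%:C.
  move=> u0; rewrite /f /exp_sum realc_sum mulr_sumr; apply: eq_bigr => m _.
  have -> : z + m%:R - 1 = z - 1 + m%:R by ring.
  rewrite (cpowD u (z - 1)) cpow_nat// mulrCA -realcM; congr (_ * _%:C).
  by rewrite mulrC -mulrN exprMn mulrA.
have [_ cv] : cint D (fun u => cpow u (z - 1) * (expR (- (u * t)))%:C) /\
    ccvg (fun n => cintegral D (f n)) (laplace01 z t).
  apply: (@cdct _ D f _ (fun u => expR t * u `^ (Re z - 1))) => //.
  - by move=> n; apply: (cint_measurable (cint_sum _ _ _)) => // m; exact: cintZ.
  - move=> n u /in01[u0 u1]; rewrite fE// ComplexField.Normc.normcM normc_cpow// ReB normc_real mulrC.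
    rewrite ler_wpM2r ?powR_ge0//; apply: le_trans (exp_sum_le _ _) _.
    by rewrite ler_expR normrN ger0_norm ?mulr_ge0 ?(ltW u0) ?(ltW t0)// ler_piMl ?(ltW t0)// ltW.
  - by apply: rintZ => //; exact: rint_powR01.
  move=> u /in01[u0 _]; apply: (ccvg_eq (fun n => fE n u u0)); apply: ccvgZ.
  by split; [exact: exp_sum_cvg|exact: cvg_cst].
apply: ccvg_eq cv => n; rewrite cintegral_sum//; last by move=> m; exact: cintZ.
by apply: eq_bigr => m _; rewrite cintegralZ// cintegral_cpow01.
Qed.

Lemma cmeasurable_ccvg (E : set R) (f_ : nat -> R -> R[i]) f : measurable E ->
  (forall n, cmeasurable E (f_ n)) -> (forall x, E x -> ccvg (f_ ^~ x) (f x)) -> cmeasurable E f.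
Proof.
move=> mE mf cf; split.
  by apply: (@measurable_fun_cvg _ _ _ _ (fun n x => Re (f_ n x))) => [n|x Ex]; [case: (mf n)|case: (cf x Ex)].
by apply: (@measurable_fun_cvg _ _ _ _ (fun n x => Im (f_ n x))) => [n|x Ex]; [case: (mf n)|case: (cf x Ex)].
Qed.

Lemma cmeasurable_laplace01 z : 0 < Re z -> cmeasurable Rpos (laplace01 z).
Proof.
move=> z0; apply: (@cmeasurable_ccvg _ (fun n t => \sum_(m < n) (((- t) ^+ m / m`!%:R)%:C / (z + m%:R)))).
- exact: measurable_Rpos.
- elim=> [|n ih]; first by apply: cmeasurable_eq (cmeasurable_cst _ 0) => t _; rewrite big_ord0.
  apply: (@cmeasurable_eq _ _ (fun t => \sum_(m < n) (((- t) ^+ m / m`!%:R)%:C / (z + m%:R)) +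
     ((- t) ^+ n / n`!%:R)%:C / (z + n%:R))) => [t _|]; first by rewrite big_ord_recr.
  have mR := @measurable_Rpos R.
  apply: cmeasurableD => //; apply: cmeasurableM => //.
  apply: cmeasurable_real; apply: measurable_funM => //.
  by apply: measurable_funX; exact: oppr_measurable.
by move=> t; rewrite /Rpos /= in_itv /= andbT => t0; exact: ccvg_laplace01.
Qed.

End unit_interval.

(** * The inhomogeneous term *)

Section inhomogeneity.
Variable R : realType.
Variable q : R[i].
Hypothesis q0 : 0 < Re q.
Hypothesis q_neq : q != 2^-1.
Local Notation c := (2 * q).
Local Notation xi := (Re q).
Local Notation e := (2 * xi).
Local Notation w := (rdens xi).
Local Notation L := (laguerre xi).
Local Notation D := (`]0, 1[%classic : set R).
Implicit Types (s t u x : R).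
Let in01 u : D u -> 0 < u /\ u < 1. Proof. by rewrite /= in_itv /= => /andP. Qed.
Let c0 : 0 < Re c. Proof. by rewrite Re_double mulr_gt0. Qed.
Let mR := @measurable_Rpos R.
Let mD := @measurable_01 R.
Let c1 : c - 1 != 0.
Proof.
apply: contraNneq q_neq => h; have two : 2 != 0 :> R[i] by rewrite pnatr_eq0.
by rewrite -(mulKf two q) -[2 * q](subrK 1) h add0r mulr1.
Qed.

Let one0 : 0 < Re (1 : R[i]). Proof. by []. Qed.

Lemma exp_sumS_cvg x : exp_sum n.+1 x @[n --> \oo] --> expR x.
Proof. by have := @exp_sum_cvg R x; rewrite -(cvg_shiftS (fun n => exp_sum n x)). Qed.

Lemma chi_laplace01 t : 0 < t -> chi_m1 t - opM (@chi_m1 R) t = laplace01 1 t.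
Proof.
move=> t0; apply: ccvg_unique (ccvg_laplace01 one0 t0).
have t0' : t != 0 by rewrite gt_eqF.
apply: (@ccvg_eq _ _ (fun n => (t^-1 * (1 - exp_sum n.+1 (- t)))%:C)).
  move=> n; rewrite /exp_sum big_ord_recl /= expr0 fact0 divr1 opprD addrA subrr add0r mulrN -mulNr mulr_sumr realc_sum.
  apply: eq_bigr => m _; rewrite -realc_nat -(realcD 1 m%:R) -realcV -realcM; congr (_%:C).
  rewrite /bump leq0n add1n factS natrM exprS -natr1 [1 + _]addrC.
  have m0 : m%:R + 1 != 0 :> R by rewrite natr1 pnatr_eq0.
  have f0 : m`!%:R != 0 :> R by rewrite pnatr_eq0 -lt0n fact_gt0.
  by field; rewrite t0' m0 f0.
rewrite /opM /chi_m1 -realcM -realcB; split; last exact: cvg_cst.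
rewrite /= (_ : _ - _ = t^-1 * (1 - expR (- t))); last by rewrite mulrBr mulr1 mulrC.
apply: cvgMr; apply: cvgB; first exact: cvg_cst.
exact: exp_sumS_cvg.
Qed.

(** On coefficients this reads [1 / (m + 2 q - 1) = (1 - m / (m + 2 q - 1)) / (2 q - 1)]. It is the
    integration by parts that continues [laplace01 (2 q - 1)] from [Re q > 1/2] to [Re q > 0]. *)
Lemma opN_chiE t : 0 < t ->
  opN_chi q t = (c - 1)^-1 * ((expR (- t))%:C + t%:C * laplace01 c t).
Proof.
move=> t0; rewrite /opN_chi; apply: (proj2 (ccvg_csum _)); apply/ccvg_shift.
apply: (@ccvg_eq _ _ (fun n => (c - 1)^-1 * ((exp_sum n.+1 (- t))%:C +
  t%:C * \sum_(m < n) (((- t) ^+ m / m`!%:R)%:C / (c + m%:R))))); last first.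
  apply: ccvgZ; apply: ccvgD; last by apply: ccvgZ; exact: ccvg_laplace01.
  split; last exact: cvg_cst.
  exact: exp_sumS_cvg.
move=> n; have -> : (exp_sum n.+1 (- t))%:C = 1 + \sum_(m < n) ((- t) ^+ m.+1 / m.+1`!%:R)%:C.
  by rewrite /exp_sum big_ord_recl expr0 fact0 divr1 realcD realc_sum.
rewrite big_ord_recl -[1 + _ + _]addrA [RHS]mulrDr; congr (_ + _).
  by rewrite !expr0 fact0 !mul1r [LHS]mulr1 mulr1 add0r.
rewrite mulr_sumr -big_split mulr_sumr; apply: eq_bigr => m _ /=.
rewrite /bump leq0n add1n factS natrM !exprS !realcM !realcV !realc_nat (exprNn t) realcM realc_sign realcN natrM.
have cm0 : c + m%:R != 0 by apply: Re_neq0; rewrite ReD Re_nat ltr_wpDr.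
have f0 : m`!%:R != 0 :> R[i] by rewrite pnatr_eq0 -lt0n fact_gt0.
have m0 : m%:R + 1 != 0 :> R[i] by rewrite natr1 pnatr_eq0.
rewrite -natr1 (_ : m%:R + 1 + 2 * q - 1 = c + m%:R); last by ring.
move: (m`!%:R) f0 (m%:R) m0 cm0 c1 => f f0 k m0 cm0 c1'.
by field; rewrite c1' f0 m0 cm0.
Qed.

Definition inhom t := chi_m1 t - opM (@chi_m1 R) t - opN_chi q t.

Lemma inhomE t : 0 < t -> inhom t =
  laplace01 1 t - (c - 1)^-1 * ((expR (- t))%:C + t%:C * laplace01 c t).
Proof. by move=> t0; rewrite /inhom chi_laplace01// opN_chiE. Qed.

Let mexp : measurable_fun Rpos (fun t : R => expR (- t)).
Proof. by have := @measurable_expN R Rpos 1; under eq_fun do rewrite mul1r. Qed.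

Let cL2_expN : cL2 q (fun t => (expR (- t))%:C).
Proof. by have := cL2_monoexp q0 0; under eq_fun do rewrite expr0 mul1r. Qed.

(* [r] selects one of the two terms [laplace01 1 t] and [t * laplace01 c t] of
   [inhomE]. *)
Lemma cL2_laplace01 z (r : bool) : 0 < Re z -> cL2 q (fun t => (t ^+ r)%:C * laplace01 z t).
Proof.
move=> z0; have [C C0 hC] := normc_laplace01 z0.
apply: (@cL2_dom _ q _ (fun t => C * (1 + t))).
- apply: (cmeasurableM mR) (cmeasurable_laplace01 z0); apply: cmeasurable_real.
  by apply: measurable_funX; exact: measurable_id.
- by apply: rL2Z => //; exact: rL2_1D.
move=> t t0; rewrite ComplexField.Normc.normcM normc_real mulrC.
apply: ler_pM; rewrite ?normc_ge0// ?hC ?ltW//.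
rewrite ger0_norm ?exprn_ge0 ?(ltW t0)//.
by case: r; rewrite ?expr0 ?expr1; lra.
Qed.

Lemma cL2_inhom : cL2 q inhom.
Proof.
have h : cL2 q (fun t => (t ^+ 0)%:C * laplace01 1 t - (c - 1)^-1 * ((expR (- t))%:C + (t ^+ 1)%:C * laplace01 c t)).
  apply: cL2B => //; first by have := @cL2_laplace01 1 false one0.
  by apply: cL2Z => //; apply: cL2D => //; have := @cL2_laplace01 c true c0.
have E t : Rpos t -> (t ^+ 0)%:C * laplace01 1 t - (c - 1)^-1 * ((expR (- t))%:C + (t ^+ 1)%:C * laplace01 c t) = inhom t.
  by move=> /Rpos_gt0 t0; rewrite inhomE// mul1r expr1.
case: h => -[m1 i1] [m2 i2]; have [n1 n2] := cmeasurable_eq E (conj m1 m2).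
by split; (split; first by []); [apply: rint_eq i1|apply: rint_eq i2] => // t /E ->.
Qed.

Lemma lagpair_laplace01 z (r : bool) k : 0 < Re z ->
  lagpair q (fun t => (t ^+ r)%:C * laplace01 z t) k =
  cintegral D (fun u => cpow u (z - 1) *
    (\int[leb]_(t in Rpos) (t ^+ r * expR (- (u * t)) * L k t * w t))%:C).
Proof.
move=> z0.
pose v t := t ^+ r * L k t * w t.
have rv : rint Rpos v.
  have := rint_laguerre q0 k r (ltrN10 R); apply: rint_eq => // t _.
  by rewrite mul0r oppr0 expR0 mulr1.
have rve u : 0 < u -> rint Rpos (fun t => expR (- (u * t)) * v t).
  move=> u0; have u1 : -1 < u by apply: lt_trans u0; rewrite ltrN10.
  have := rint_laguerre q0 k r u1; apply: rint_eq => // t _.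
  by rewrite /v; move: (w t) => wt; ring.
have mK : measurable_fun setT (fun p : R * R => expR (- (p.1 * p.2))).
  apply: measurableT_comp => //; apply: measurableT_comp => //.
  by apply: measurable_funM; [exact: measurable_fst|exact: measurable_snd].
(* Here [f] stands for [Re] or [Im]. As the exponential is at most 1, a product of a function of [u]
   and a function of [t] is a majorant. *)
have fub (f : R[i] -> R) : (forall u t, f (cpow u (z - 1) * (expR (- (u * t)))%:C) = f (cpow u (z - 1)) * expR (- (u * t))) ->
    rint D (fun u => f (cpow u (z - 1))) ->
    (forall t, 0 < t -> rint D (fun u => f (cpow u (z - 1) * (expR (- (u * t)))%:C))) ->
    \int[leb]_(t in Rpos) ((\int[leb]_(u in D) f (cpow u (z - 1) * (expR (- (u * t)))%:C)) * v t) =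
    \int[leb]_(u in D) (f (cpow u (z - 1)) * \int[leb]_(t in Rpos) (expR (- (u * t)) * v t)).
  move=> fM rf rft.
  have le u t : D u -> Rpos t -> `|f (cpow u (z - 1)) * expR (- (u * t)) * v t| <= `|f (cpow u (z - 1))| * `|v t|.
    move=> /in01[u0 _] /Rpos_gt0 t0; rewrite normrM ler_wpM2r// normrM ler_piMr//.
    by rewrite ger0_norm ?expR_ge0// -[leRHS]expR0 ler_expR oppr_le0 mulr_ge0// ltW.
  have [_ _ h] := @rfubini R D Rpos _ _ v _ (fun u t => expR (- (u * t))) mD mR
    (rint_measurable rf) (rint_measurable rv) mK (rint_norm mD rf) (rint_norm mR rv) le.
  transitivity (\int[leb]_(t in Rpos) \int[leb]_(u in D) (f (cpow u (z - 1)) * expR (- (u * t)) * v t)).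
    apply: Rint_eq => t /Rpos_gt0 t0; rewrite [LHS]mulrC -(RintZ _ mD (rft t t0)).
    by apply: Rint_eq => u _; rewrite fM mulrC.
  rewrite h; apply: Rint_eq => u /in01[u0 _]; rewrite -(RintZ _ mR (rve u u0)).
  by apply: Rint_eq => t _; rewrite mulrA.
have cl t : 0 < t -> cint D (fun u => cpow u (z - 1) * (expR (- (u * t)))%:C).
  by move=> t0; apply: cint_laplace01 => //; exact: ltW.
have [i1 i2] : cint D (fun u => cpow u (z - 1)).
  have : cint D (fun u => cpow u (z - 1) * (1 : R)%:C).
    by apply: (@cint_cpow01 _ _ (fun=> 1) 1) => // u _; rewrite normr1.
  by apply: cint_eq => // u _; rewrite mulr1.
have E u : \int[leb]_(t in Rpos) (expR (- (u * t)) * v t) =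
    \int[leb]_(t in Rpos) (t ^+ r * expR (- (u * t)) * L k t * w t).
  by apply: Rint_eq => t _; rewrite /v; move: (w t) => wt; ring.
apply: complex_ext; rewrite /lagpair ?Re_cintegral ?Im_cintegral.
  rewrite (@Rint_eq _ _ _ (fun t => (\int[leb]_(u in D) Re (cpow u (z - 1) * (expR (- (u * t)))%:C)) * v t)).
    rewrite fub//; [|by move=> u t; rewrite ReZr|by move=> t /cl[]].
    by apply: Rint_eq => u _; rewrite E ReZr.
  by move=> t _; rewrite ReZr ReZ /laplace01 Re_cintegral /v; move: (w t) => wt; ring.
rewrite (@Rint_eq _ _ _ (fun t => (\int[leb]_(u in D) Im (cpow u (z - 1) * (expR (- (u * t)))%:C)) * v t)).
  rewrite fub//; [|by move=> u t; rewrite ImZr|by move=> t /cl[]].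
  by apply: Rint_eq => u _; rewrite E ImZr.
by move=> t _; rewrite ImZr ImZ /laplace01 Im_cintegral /v; move: (w t) => wt; ring.
Qed.

End inhomogeneity.

(** * Laguerre coefficients of the inhomogeneous term *)

Section Psi_coefficients.
Variable R : realType.
Variable q : R[i].
Hypothesis q0 : 0 < Re q.
Hypothesis q_neq : q != 2^-1.
Local Notation c := (2 * q).
Local Notation xi := (Re q).
Local Notation e := (2 * xi).
Local Notation w := (rdens xi).
Local Notation L := (laguerre xi).
Local Notation D := (`]0, 1[%classic : set R).
Implicit Types (s t u x : R).
Let in01 u : D u -> 0 < u /\ u < 1. Proof. by rewrite /= in_itv /= => /andP. Qed.
Let c0 : 0 < Re c. Proof. by rewrite Re_double mulr_gt0. Qed.
Let e0 : 0 < e. Proof. by rewrite mulr_gt0. Qed.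
Let mD := @measurable_01 R.

Lemma powR_addr (y a b : R) : 0 < y -> y `^ (a + b) = y `^ a * y `^ b.
Proof. by move=> y0; rewrite powRD//; apply/implyP => _; rewrite gt_eqF. Qed.

Lemma powR_natD y n x : 0 < y -> y `^ (n%:R + x) = y ^+ n * y `^ x.
Proof. by move=> y0; rewrite powR_addr// powR_mulrn ?ltW. Qed.

Lemma powR_natD1 y n x : 0 < y -> y `^ (n%:R + x + 1) = y ^+ n * y `^ x * y.
Proof. by move=> y0; rewrite -addrA powR_natD// powR_addr// powRr1 ?ltW// mulrA. Qed.

Lemma continuous_exp (f : R -> R) n s : {for s, continuous f} -> {for s, continuous (fun t => f t ^+ n)}.
Proof.
move=> cf; elim: n => [|n ih]; first by rewrite (_ : (fun t => _) = fun=> 1)//; exact: cst_continuous.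
by rewrite (_ : (fun t => _) = fun t => f t * f t ^+ n) => [|]; [exact: continuous_mul|apply/funext => t; rewrite exprS].
Qed.

(** Mere existence is enough, because the substitution below expresses both integrals as increments
    of the same [H]. The induction uses [(1 - s) ^ (n + 1) = (1 - s) ^ n - s (1 - s) ^ n], and the
    exponent [-1] leads to the logarithm. *)
Lemma powR_antiderivative a n : exists H : R -> R,
  forall s, 0 < s -> is_derive s 1 H (s `^ a * (1 - s) ^+ n).
Proof.
elim: n a => [|n ih] a.
  have [->|a1] := eqVneq a (- 1).
    exists (@ln R) => s s0; rewrite expr0 mulr1 powR_inv1 ?ltW//.
    exact: is_derive1_ln.
  have a0 : a + 1 != 0 by rewrite addr_eq0.
  exists (fun s => (a + 1)^-1 * s `^ (a + 1)) => s s0.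
  apply: deriv_eq (deriv_scale _ (is_derive1_powR (a + 1) s0)) _.
  by rewrite addrK expr0 mulr1 mulrA mulVf// mul1r.
have [H1 h1] := ih a; have [H2 h2] := ih (a + 1).
exists (fun s => H1 s - H2 s) => s s0; apply: deriv_eq (deriv_sub (h1 s s0) (h2 s s0)) _.
rewrite powRD; last by apply/implyP => _; rewrite gt_eqF.
by rewrite powRr1 ?ltW// exprS; ring.
Qed.

Lemma measurable_powR1D a : measurable_fun D (fun u => (1 + u) `^ a).
Proof.
apply: (@measurable_funS _ _ _ _ setT) => //.
by apply: measurableT_comp (measurable_powR _) _; exact: measurable_funD.
Qed.

Lemma powR1D_le1 a u : 0 <= a -> 0 < u -> (1 + u) `^ (- a) <= 1.
Proof.
move=> a0 u0; rewrite -[leRHS](powRr0 (1 + u)); apply: ler_powR; last by rewrite oppr_le0.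
by rewrite lerDl ltW.
Qed.

Lemma rint_unit_interval n : rint D (fun u => u ^+ n * (1 + u) `^ (- (n%:R + e))).
Proof.
apply: (@rint_dom _ _ _ (fun u => u `^ 0)) => //; last by apply: rint_powR01; rewrite ltrN10.
  by apply: measurable_funM; [exact: measurable_funX|exact: measurable_powR1D].
move=> u /in01[u0 u1]; rewrite powRr0 ger0_norm ?mulr_ge0 ?powR_ge0 ?exprn_ge0 ?(ltW u0)//.
rewrite -[leRHS]mulr1; apply: ler_pM; rewrite ?powR_ge0 ?exprn_ge0 ?(ltW u0)//.
  by rewrite exprn_ile1// ltW.
by apply: powR1D_le1 => //; rewrite addr_ge0// ltW.
Qed.

(** Substitution [s = 1 / (1 + u)], carried out by differentiating [- H (1 / (1 + u))]. It brings
    the first integral of [Psi] to the form of a Laplace transform of [L n] integrated over the unit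
    interval. *)
Lemma unit_interval_substitution n :
  \int[leb]_(s in `[2^-1, 1]) (s `^ (e - 2) * (1 - s) ^+ n) =
  \int[leb]_(u in D) (u ^+ n * (1 + u) `^ (- (n%:R + e))).
Proof.
have [H dH] := powR_antiderivative (e - 2) n.
have h21 : 2^-1 < 1 :> R by lra.
have cG s : 0 < s -> {for s, continuous (fun s => s `^ (e - 2) * (1 - s) ^+ n)}.
  move=> s0; apply: continuous_mul; first exact: continuous_powR.
  apply: continuous_exp; apply: continuous_sub; first exact: cst_continuous.
  exact: is_derive_continuous (deriv_id s).
have p1 s : 2^-1 <= s <= 1 -> 0 < s by move=> /andP[s0 _]; lra.
have LE := @FTC_itv R _ H _ _ h21 (fun s h => dH s (p1 s h)) (fun s h => cG s (p1 s h)).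
rewrite /Rintegral {}LE /=.
have dinv u : -1 < u -> is_derive u 1 (fun u : R => (1 + u)^-1) (- (1 + u) ^- 2).
  move=> u1; have y0 : 1 + u != 0 by rewrite gt_eqF//; lra.
  have d1 : is_derive u 1 (fun s : R => 1 + s) 1.
    by apply: deriv_eq (deriv_add (deriv_cst u 1) (deriv_id u)) _; rewrite add0r.
  apply: deriv_eq (is_deriveV y0 d1) _.
  by rewrite /GRing.scale /= mulr1.
have dF u : -1 < u -> is_derive u 1 (fun u => - H (1 + u)^-1) (((1 + u)^-1 `^ (e - 2) * (1 - (1 + u)^-1) ^+ n) * (1 + u) ^- 2).
  move=> u1; have y0 : 0 < (1 + u)^-1 by rewrite invr_gt0; lra.
  apply: deriv_eq (deriv_opp (@deriv_comp R H (fun u => (1 + u)^-1) u _ _ (dH _ y0) (dinv u u1))) _.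
  by rewrite mulrN opprK.
have fE u : D u -> ((1 + u)^-1 `^ (e - 2) * (1 - (1 + u)^-1) ^+ n) * (1 + u) ^- 2 = u ^+ n * (1 + u) `^ (- (n%:R + e)).
  move=> /in01[u0 _]; have y0 : 0 < 1 + u by rewrite addr_gt0.
  have -> : 1 - (1 + u)^-1 = u / (1 + u) by field; rewrite gt_eqF.
  have -> : (1 + u)^-1 `^ (e - 2) = (1 + u) ^+ 2 / (1 + u) `^ e.
    by rewrite -[(1 + u)^-1](powR_inv1 (ltW y0)) -powRrM mulN1r opprB powR_natD// powRN.
  rewrite powRN powR_natD// expr_div_n.
  have n1 : (1 + u) `^ e != 0 by rewrite gt_eqF// powR_gt0.
  have n2 : (1 + u) ^+ n != 0 by rewrite expf_neq0// gt_eqF.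
  by field; rewrite n1 n2 gt_eqF.
have rf := rint_unit_interval n.
have D1 u : D u -> -1 < u by move=> /in01[u0 _]; lra.
have dF' u : D u -> is_derive u 1 (fun u => - H (1 + u)^-1) (u ^+ n * (1 + u) `^ (- (n%:R + e))).
  by move=> Du; apply: deriv_eq (dF u (D1 u Du)) _; exact: fE.
have cf u : D u -> {for u, continuous (fun u => u ^+ n * (1 + u) `^ (- (n%:R + e)))}.
  move=> /in01[u0 _]; have y0 : 0 < 1 + u by rewrite addr_gt0.
  apply: continuous_mul; first by apply: continuous_exp; exact: is_derive_continuous (deriv_id u).
  have d1 : is_derive u 1 (fun s : R => 1 + s) 1.
    by apply: deriv_eq (deriv_add (deriv_cst u 1) (deriv_id u)) _; rewrite add0r.
  exact: is_derive_continuous (deriv_comp (is_derive1_powR _ y0) d1).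
have lim (a : R) (v : nat -> R) : -1 < a -> v n @[n --> \oo] --> a ->
    - H (1 + v n)^-1 @[n --> \oo] --> - H (1 + a)^-1.
  move=> a1 va; have ca := is_derive_continuous (dF a a1).
  exact: (cvg_comp v _ va ca).
have b1 : (1 - n.+3%:R^-1 : R) @[n --> \oo] --> (1 : R).
  by rewrite -[X in _ --> X]subr0; apply: cvgB; [exact: cvg_cst|exact: natinv3_cvg0].
have l1 := lim 1 _ (lt_trans (ltrN10 R) ltr01) b1.
have l0 := lim 0 _ (ltrN10 R) (@natinv3_cvg0 R).
rewrite -/(Rintegral _ _ _) (FTC_exhausts mD (exhausts_01 R) dF' cf l0 l1 rf).
by rewrite addr0 invr1 opprK addrC.
Qed.

(** Minus the derivative of [u ^ k (1 + u) ^ (- k - 2 xi)], the effect of an additional factor [t]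
    under the Laplace transform. For [k = 0] the term with [k.-1] has coefficient zero. *)
Definition B1 k u := (e * u ^+ k - k%:R * u ^+ k.-1) * (1 + u) `^ (- (k%:R + e + 1)).

Lemma laguerre_laplace0 k u : 0 < u ->
  \int[leb]_(t in Rpos) (t ^+ 0 * expR (- (u * t)) * L k t * w t) =
  lagG xi k * (u ^+ k * (1 + u) `^ (- (k%:R + e))).
Proof.
move=> u0; have u1 : -1 < u by apply: lt_trans u0; rewrite ltrN10.
have y0 : 0 < 1 + u by rewrite addr_gt0.
rewrite (laguerre_laplace q0 k 0 u1) big_ord1 bin0 ffactn0 rising0 !expr0 subn0 mulr0n add0r !mul1r.
rewrite /lagG -[LHS]mulrA; congr (_ * _).
rewrite !powRN powR_natD// expr_div_n invfM.
by move: (_ `^ _)^-1 (_ ^+ _)^-1 => a b; ring.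
Qed.

Lemma laguerre_laplace1 k u : 0 < u ->
  \int[leb]_(t in Rpos) (t ^+ 1 * expR (- (u * t)) * L k t * w t) = lagG xi k * B1 k u.
Proof.
move=> u0; have u1 : -1 < u by apply: lt_trans u0; rewrite ltrN10.
have y0 : 0 < 1 + u by rewrite addr_gt0.
rewrite (laguerre_laplace q0 k 1 u1) !big_ord_recl big_ord0 /= !expr0 !bin0 /bump /= addr0 !rising0 bin1 ffactn0 ffactn1 subn0 rising1 subn1 expr1.
rewrite /lagG -[LHS]mulrA; congr (_ * _).
rewrite /B1 !powRN powR_natD1// powR_natD// subn0 expr1 !expr_div_n.
have n1 : (1 + u) `^ e != 0 by rewrite gt_eqF// powR_gt0.
have n2 : (1 + u) != 0 by rewrite gt_eqF.
case: k => [|k].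
  rewrite /= !expr0; field; by rewrite n1 n2.
rewrite /= !exprS.
have n3 : (1 + u) ^+ k != 0 by rewrite expf_neq0// gt_eqF.
by field; rewrite n1 n2 n3.
Qed.

Lemma cint_B1 k : cint D (fun u => cpow u (c - 1) * (B1 k u)%:C).
Proof.
have a0 : 0 <= k%:R + e + 1 by rewrite !addr_ge0// ltW.
apply: (@cint_cpow01 _ _ _ (e + k%:R)) => //.
  apply: measurable_funM; last exact: measurable_powR1D.
  by apply: measurable_funB; apply: measurable_funM => //; apply: measurable_funX.
move=> u /in01[u0 u1]; rewrite /B1 normrM [`|_ `^ _|]ger0_norm ?powR_ge0//.
rewrite -[leRHS]mulr1; apply: ler_pM => //; first exact: powR_ge0.
  apply: le_trans (ler_normB _ _) _; rewrite (normrM e) (normrM k%:R) !normrX.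
  have n1 m : `|u| ^+ m <= 1 by rewrite exprn_ile1// ger0_norm ?(ltW u0)// ltW.
  rewrite ger0_norm ?(ltW e0)// normr_nat.
  by apply: lerD; rewrite -[leRHS]mulr1 ler_wpM2l// ltW.
exact: (powR1D_le1 a0 u0).
Qed.

(* The two integrands differ by the derivative of
   [2 u ^ (k + 2 q) (1 + u) ^ (- k - 2 xi - 1)]. *)
Lemma Psi_boundary k :
  cintegral D (fun u => cpow u (c - 1) * (B1 k u)%:C) + ((2 `^ (k%:R + e))^-1)%:C =
  cintegral D (fun t =>
    cpow t (k%:R + 2 * q - 2) / ((1 + t) `^ (k%:R + 2 * xi + 1))%:C *
    (((2 * xi)%:C + 4 * q) * t%:C - k%:R
     - (2 * (2 * xi + 1) * (t ^+ 2 / (1 + t)))%:C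
     + (2 * k%:R * (t / (1 + t)))%:C)).
Proof.
pose a := k%:R + e + 1.
have a0 : 0 < a by rewrite /a -addrA ltr_wpDl// addr_gt0.
pose p u := 2 * (1 + u) `^ (- a); pose p' u := 2 * (- a * (1 + u) `^ (- a - 1)).
have d1 u : is_derive u 1 (fun s : R => 1 + s) 1.
  by apply: deriv_eq (deriv_add (deriv_cst u 1) (deriv_id u)) _; rewrite add0r.
have y0 u : -1 < u -> 0 < 1 + u by move=> u1; lra.
have dp u : -1 < u -> is_derive u 1 p (p' u).
  move=> /y0 u1; apply: deriv_eq (deriv_scale 2 (deriv_comp (is_derive1_powR (- a) u1) (d1 u))) _.
  by rewrite mulr1.
have cp' u : -1 < u -> {for u, continuous p'}.
  move=> /y0 u1; exact: is_derive_continuous (deriv_scale 2 (deriv_scale (- a) (deriv_comp (is_derive1_powR (- a - 1) u1) (d1 u)))).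
have z0 : 0 < Re (k%:R + c) by rewrite ReD Re_nat ltr_wpDl.
have pC u : D u -> `|p u| <= 2 + 2 * a.
  move=> /in01[u0 _]; rewrite ger0_norm ?mulr_ge0 ?powR_ge0//.
  by have := powR1D_le1 (ltW a0) u0; rewrite /p; lra.
have p'C u : D u -> `|p' u| <= 2 + 2 * a.
  move=> /in01[u0 _]; rewrite /p' mulNr mulrN normrN ger0_norm ?mulr_ge0 ?powR_ge0 ?(ltW a0)//.
  have a1 : 0 <= a + 1 by lra.
  have := powR1D_le1 a1 u0; rewrite opprD; nra.
have [if_ Ef] := cFTC01 z0 dp cp' pC p'C.
(* The factor 2 in [p] is chosen so that the boundary value at [u = 1] equals the pairing of
   [exp (- t)] with [L k], up to [lagG xi k]. *)
have p1 : p 1 = (2 `^ (k%:R + e))^-1.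
  rewrite /p /a powRN -[1 + 1]/(2 : R) powR_natD1// powR_natD//.
  by rewrite invfM mulrCA mulfV ?mulr1// pnatr_eq0.
rewrite -p1 -Ef -cintegralD//; last exact: cint_B1.
apply: cintegral_eq => u /in01[u0 _].
have y1 : 0 < 1 + u by rewrite addr_gt0.
have -> : k%:R + 2 * q - 2 = c - 1 + k%:R - 1 by ring.
have -> : k%:R + c - 1 = c - 1 + k%:R by ring.
have -> : k%:R + c = c - 1 + k%:R + 1 by ring.
rewrite [cpow u (_ - 1 + _ - 1)]cpowB1// (cpowD u (c - 1 + k%:R)) (cpowD u (c - 1)) cpow1// cpow_nat//.
rewrite /B1 /p /p' -/a [(1 + u) `^ (- a - 1)]powR_addr// powR_inv1 ?ltW// !powRN.
(* For [k = 0] both sides are zero, so the truncated predecessor does no harm. *)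
have kE : k%:R * u ^+ k.-1 = k%:R * u ^+ k / u.
  by case: (k) => [|m]; rewrite ?mul0r// exprS; field; rewrite gt_eqF.
rewrite kE.
have : (1 + u) `^ a != 0 by rewrite gt_eqF// powR_gt0.
move: ((1 + u) `^ a) => W W0.
have W0' : W%:C != 0 :> R[i] by rewrite -(inj_eq (@complexI R)) in W0.
have U0 : u%:C != 0 :> R[i] by apply: Re_neq0.
have Y0 : 1 + u%:C != 0 :> R[i]. by apply: Re_neq0.
rewrite /a !(realcD, realcN, realcM, realcV, realcX, realc_nat).
rewrite -[1%:C]/(1 : R[i]).
move: (W%:C) W0' (cpow u _) (u%:C) U0 Y0 (u%:C ^+ k) (xi%:C) => {W0} z W0 P y U0 Y0 v x.
by field; rewrite U0 W0 Y0.
Qed.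

Lemma lagpair_inhom k : lagpair q (inhom q) k = (lagG xi k)%:C * Psi q k.
Proof.
have G0 := lagG_gt0 q0 k.
have c1 : 0 < Re (1 : R[i]) by [].
have l1 := cL2_laplace01 q0 false c1; have l2 := cL2_laplace01 q0 true c0.
have l3 := cL2_monoexp q0 0.
rewrite (@lagpair_eq _ _ _ (fun t => (t ^+ false)%:C * laplace01 1 t -
  (2 * q - 1)^-1 * ((t ^+ 0 * expR (- t))%:C + (t ^+ true)%:C * laplace01 c t))); last first.
  by move=> t t0; rewrite inhomE// !expr0 expr1 !mul1r.
rewrite lagpairB//; last by apply: cL2Z => //; exact: cL2D.
rewrite lagpairZ//; last exact: cL2D.
rewrite lagpairD// !lagpair_laplace01// lagpair_real ip_monoexp//.
rewrite /Psi mulrBr; congr (_ - _).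
  rewrite unit_interval_substitution// -realcM -RintZ//; last exact: rint_unit_interval.
  rewrite -cintegral_real; apply: cintegral_eq => u /in01[u0 _].
  by rewrite subrr cpow0 mul1r laguerre_laplace0.
rewrite mulrCA; congr (_ * _).
rewrite -Psi_boundary// mulrDr addrC; congr (_ + _).
  rewrite -cintegralZ//; last exact: cint_B1.
  apply: cintegral_eq => u /in01[u0 _].
  by rewrite laguerre_laplace1// realcM mulrCA.
rewrite big_ord1 bin0 ffactn0 rising0 !expr0 !mulr1 -realcM; congr (_%:C).
Qed.
End Psi_coefficients.

(** * The two systems *)

Section equivalence.
Variable R : realType.
Variable q : R[i].
Hypothesis q0 : 0 < Re q.
Hypothesis q_neq : q != 2^-1.
Local Notation xi := (Re q).
Local Notation w := (rdens xi).
Local Notation L := (laguerre xi).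
Local Notation lagG := (lagG xi).
Implicit Types (s t : R) (phi psi : R -> R[i]) (Phi : nat -> R[i]) (k n N : nat).

Lemma sqnormE phi : cL2 q phi -> sqnorm xi phi =
  (ip xi (fun t => Re (phi t)) (fun t => Re (phi t)) + ip xi (fun t => Im (phi t)) (fun t => Im (phi t)))%:E.
Proof.
move=> [[m1 r1] [m2 r2]]; rewrite !ipE -RintD// /sqnorm.
have E t : normc (phi t) ^+ 2 * w t = Re (phi t) ^+ 2 * w t + Im (phi t) ^+ 2 * w t.
  by rewrite sqr_normc mulrDl.
rewrite -Eint_Rint//; last exact: rintD.
by apply: eq_integral => t _; rewrite E.
Qed.

Lemma in_L2P phi : in_L2 xi phi <-> cL2 q phi.
Proof.
split=> [[[m1 m2] fin]|h]; last first.
  by split; [case: h => -[m1 _] [m2 _]|rewrite sqnormE// ltry].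
have s0 : (0 <= sqnorm xi phi)%E.
  by apply: integral_ge0 => t _; rewrite lee_fin; apply: mulr_ge0; [exact: sqr_ge0|exact: rdens_ge0].
have mw := @measurable_rdens R xi Rpos.
have mn : measurable_fun Rpos (fun t => normc (phi t) ^+ 2 * w t).
  apply: (@eq_measurable_fun _ _ _ _ _ (fun t => (Re (phi t) ^+ 2 + Im (phi t) ^+ 2) * w t)).
    by move=> t _; rewrite sqr_normc.
  by apply: measurable_funM => //; apply: measurable_funD; exact: measurable_funX.
have le (f : R -> R) : measurable_fun Rpos f -> (forall t, f t ^+ 2 <= normc (phi t) ^+ 2) -> rL2 xi f.
  move=> mf hf; apply: (proj1 (@ge0_rL2 _ xi f (fine (sqnorm xi phi)) mf _)).
  rewrite fineK ?ge0_fin_numE//; apply: Eint_le => //.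
  - by apply: measurable_funM => //; exact: measurable_funX.
  - by move=> t _; apply: mulr_ge0; [exact: sqr_ge0|exact: rdens_ge0].
  by move=> t _; apply: ler_wpM2r; [exact: rdens_ge0|exact: hf].
by split; apply: le => // t; rewrite sqr_normc ?lerDl ?lerDr sqr_ge0.
Qed.

(** Convergence of the Laguerre series in [L^2(m_xi)], stated for the two real components so that
    Riesz-Fischer and the convergence of pairings apply to each of them. *)
Definition expands Phi phi := [/\ cL2 q phi,
  ip xi (fun t => Re (phi t) - lagS xi (fun n => Re (Phi n)) N t)
        (fun t => Re (phi t) - lagS xi (fun n => Re (Phi n)) N t) @[N --> \oo] --> 0 &
  ip xi (fun t => Im (phi t) - lagS xi (fun n => Im (Phi n)) N t)
        (fun t => Im (phi t) - lagS xi (fun n => Im (Phi n)) N t) @[N --> \oo] --> 0].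

Definition csumL Phi N t := \sum_(i < N) Phi i * (L i t)%:C.

Lemma Re_csumL Phi N t : Re (csumL Phi N t) = lagS xi (fun n => Re (Phi n)) N t.
Proof. by rewrite /csumL Re_sum; apply: eq_bigr => i _; rewrite ReZr. Qed.
Lemma Im_csumL Phi N t : Im (csumL Phi N t) = lagS xi (fun n => Im (Phi n)) N t.
Proof. by rewrite /csumL Im_sum; apply: eq_bigr => i _; rewrite ImZr. Qed.

Let cL2_L n : cL2 q (fun t => (L n t)%:C).
Proof. by apply: cL2_real; exact: rL2_laguerre. Qed.

Lemma cL2_csumL Phi N : cL2 q (csumL Phi N).
Proof. by apply: cL2_sum => // i; exact: cL2Z. Qed.

Lemma expands_laguerre_sum Phi phi : expands Phi phi -> laguerre_sum xi Phi phi.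
Proof.
move=> [h c1 c2]; rewrite /laguerre_sum.
have E N : sqnorm xi (fun t => phi t - \sum_(i < N) Phi i * (L i t)%:C) =
   (ip xi (fun t => Re (phi t) - lagS xi (fun n => Re (Phi n)) N t)
        (fun t => Re (phi t) - lagS xi (fun n => Re (Phi n)) N t) +
    ip xi (fun t => Im (phi t) - lagS xi (fun n => Im (Phi n)) N t)
        (fun t => Im (phi t) - lagS xi (fun n => Im (Phi n)) N t))%:E.
  rewrite (sqnormE (cL2B h (cL2_csumL Phi N))).
  by congr ((_ + _)%:E); apply: Rint_eq => t _; rewrite ?ReB ?ImB ?Re_csumL ?Im_csumL.
rewrite (funext E); apply/cvg_EFin; first exact: nearW.
by rewrite -[0]addr0; exact: cvgD.
Qed.

Lemma pair_csumL Phi N k :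
  lagpair q (fun t => opM (csumL Phi N) t + opN q (csumL Phi N) t) k =
  \sum_(n < N) Aplus q k n * Phi n.
Proof.
have cLn n : cL2 q (fun t => opM (fun s => (L n s)%:C) t + opN q (fun s => (L n s)%:C) t).
  by apply: cL2D => //; [exact: cL2_opM|exact: cL2_opN].
rewrite (@lagpair_eq _ _ _ (fun t => \sum_(n <- index_enum 'I_N) Phi n * (opM (fun s => (L n s)%:C) t + opN q (fun s => (L n s)%:C) t))).
  rewrite lagpair_sum//; last by move=> n; exact: cL2Z.
  by apply: eq_bigr => n _; rewrite lagpairZ// -AplusE// mulrC.
move=> t t0; rewrite [opN q (csumL Phi N) t]opN_sum//; last by move=> n; exact: cL2_cL1.
rewrite /opM /csumL mulr_sumr -big_split; apply: eq_bigr => n _ /=.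
by rewrite mulrDr mulrCA.
Qed.

(** Multiplication by [exp (- t)] is symmetric and is moved to the side of [L k]. *)
Lemma lagpair_opM_cvg0 (f : nat -> R -> R[i]) k : (forall n, cL2 q (f n)) ->
  ip xi (fun t => Re (f n t)) (fun t => Re (f n t)) @[n --> \oo] --> 0 ->
  ip xi (fun t => Im (f n t)) (fun t => Im (f n t)) @[n --> \oo] --> 0 ->
  ccvg (fun n => lagpair q (opM (f n)) k) 0.
Proof.
move=> h c1 c2.
have [g1 _] := cL2_opM (cL2_L k).
have {}g1 : rL2 xi (fun t => expR (- t) * L k t).
  by move: g1; rewrite /opM; under eq_fun do rewrite ReZ.
have E (g : R -> R) : ip xi (fun t => expR (- t) * g t) (L k) = ip xi g (fun t => expR (- t) * L k t).
  by apply: Rint_eq => t _; move: (w t) => wt; ring.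
have ER n : Re (lagpair q (opM (f n)) k) = ip xi (fun t => Re (f n t)) (fun t => expR (- t) * L k t).
  rewrite lagpairE /= -E; apply: Rint_eq => t _; by rewrite /opM ReZ.
have EI n : Im (lagpair q (opM (f n)) k) = ip xi (fun t => Im (f n t)) (fun t => expR (- t) * L k t).
  rewrite lagpairE /= -E; apply: Rint_eq => t _; by rewrite /opM ImZ.
split.
  by rewrite (funext ER); apply: (ip_cvg0 (f := fun n t => Re (f n t))) => // n; case: (h n).
by rewrite (funext EI); apply: (ip_cvg0 (f := fun n t => Im (f n t))) => // n; case: (h n).
Qed.

(** By the linear bound on [opN], the pairing is at most a constant times the weighted [L^1] norm of
    [f n]; the constant is finite because [1 + t] and [L k] are both square integrable. *)
Lemma lagpair_opN_cvg0 (f : nat -> R -> R[i]) k : (forall n, cL2 q (f n)) ->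
  ip xi (fun t => Re (f n t)) (fun t => Re (f n t)) @[n --> \oo] --> 0 ->
  ip xi (fun t => Im (f n t)) (fun t => Im (f n t)) @[n --> \oo] --> 0 ->
  ccvg (fun n => lagpair q (opN q (f n)) k) 0.
Proof.
move=> h c1 c2; have [C C0 hC] := opN_bound q0.
have rl := rL2_mul (rL2_1D q0) (rL2_norm (rL2_laguerre q0 k)).
apply: (@ccvg_norm0 _ _ _ (fun n => L1norm q (f n) * (2 * (C * \int[leb]_(t in Rpos) ((1 + t) * `|L k t| * w t))))).
  move=> n; rewrite subr0 -RintZ// mulrCA -RintZ//; last exact: rintZ.
  apply: cintegral_norm_le => //; last by apply: rintZ => //; exact: rintZ.
    have [[m1 _] [m2 _]] := cL2_opN q0 (h n).
    apply: cmeasurableM => //; apply: cmeasurable_real; apply: measurable_funM; last exact: measurable_rdens.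
    by case: (rL2_laguerre q0 k).
  move=> t /Rpos_gt0 t0; rewrite ComplexField.Normc.normcM normc_real normrM (ger0_norm (rdens_ge0 _ _)).
  rewrite [leRHS](_ : _ = C * (1 + t) * L1norm q (f n) * (`|L k t| * w t)).
    apply: ler_wpM2r; last by apply: hC => //; exact: cL2_cL1.
    by apply: mulr_ge0; [|exact: rdens_ge0].
  by move: (w t) => wt; ring.
rewrite -[X in _ --> X](mul0r (2 * (C * \int[leb]_(t in Rpos) ((1 + t) * `|L k t| * w t)))).
apply: cvgMl; exact: L1norm_cvg0.
Qed.

(** The two preceding limits are applied to the remainders of the Laguerre series. Each row series
    of the matrix product thus converges without a separate assumption. *)
Lemma expands_pair_cvg Phi phi k : expands Phi phi ->
  ccvg (fun N => \sum_(n < N) Aplus q k n * Phi n)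
       (lagpair q (fun t => opM phi t + opN q phi t) k).
Proof.
move=> [hphi c1 c2].
have hf N : cL2 q (fun t => phi t - csumL Phi N t) by apply: cL2B => //; exact: cL2_csumL.
have d1 : ip xi (fun t => Re (phi t - csumL Phi N t)) (fun t => Re (phi t - csumL Phi N t)) @[N --> \oo] --> 0.
  rewrite (_ : (fun N => _) = fun N => ip xi (fun t => Re (phi t) - lagS xi (fun n => Re (Phi n)) N t)
        (fun t => Re (phi t) - lagS xi (fun n => Re (Phi n)) N t))//.
  by apply/funext => N; apply: Rint_eq => t _; rewrite ReB Re_csumL.
have d2 : ip xi (fun t => Im (phi t - csumL Phi N t)) (fun t => Im (phi t - csumL Phi N t)) @[N --> \oo] --> 0.
  rewrite (_ : (fun N => _) = fun N => ip xi (fun t => Im (phi t) - lagS xi (fun n => Im (Phi n)) N t)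
        (fun t => Im (phi t) - lagS xi (fun n => Im (Phi n)) N t))//.
  by apply/funext => N; apply: Rint_eq => t _; rewrite ImB Im_csumL.
have := ccvgB (ccvgB (ccvg_cst (lagpair q (fun t => opM phi t + opN q phi t) k))
  (lagpair_opM_cvg0 k hf d1 d2)) (lagpair_opN_cvg0 k hf d1 d2).
rewrite !subr0; apply: ccvg_eq => N; rewrite -pair_csumL.
have cs := cL2_csumL Phi N.
rewrite (lagpairD q0 k (cL2_opM hphi) (cL2_opN q0 hphi)) (lagpairD q0 k (cL2_opM cs) (cL2_opN q0 cs)).
have -> : lagpair q (opM (fun t => phi t - csumL Phi N t)) k = lagpair q (opM phi) k - lagpair q (opM (csumL Phi N)) k.
  rewrite -(lagpairB q0 k (cL2_opM hphi) (cL2_opM cs)).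
  by apply: lagpair_eq => t _; rewrite /opM mulrBr.
have -> : lagpair q (opN q (fun t => phi t - csumL Phi N t)) k = lagpair q (opN q phi) k - lagpair q (opN q (csumL Phi N)) k.
  rewrite -(lagpairB q0 k (cL2_opN q0 hphi) (cL2_opN q0 cs)).
  by apply: lagpair_eq => t t0; rewrite opNB//; exact: cL2_cL1.
generalize (lagpair q (opM (csumL Phi N)) k) (lagpair q (opN q (csumL Phi N)) k)
  (lagpair q (opM phi) k) (lagpair q (opN q phi) k) => a b d e.
by ring.
Qed.

Lemma expands_coef Phi phi k : expands Phi phi -> lagpair q phi k = (lagG k)%:C * Phi k.
Proof.
move=> [[h1 h2] c1 c2]; rewrite lagpairE.
rewrite (ip_lagS_cvg q0 k h1 c1) (ip_lagS_cvg q0 k h2 c2).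
by apply: complex_ext; rewrite ?ReZ ?ImZ /= mulrC.
Qed.

Lemma ae_and (P Q : set R) : almost_everywhere leb P -> almost_everywhere leb Q ->
  almost_everywhere leb (P `&` Q).
Proof. by rewrite /almost_everywhere /= setCI; exact: negligibleU. Qed.

(** One direction is Bessel's inequality, which bounds the coefficients by a norm equal to zero; the
    other is completeness, applied to both components. *)
Lemma lagpair_ae0 phi : cL2 q phi ->
  ae_eq_pos phi (fun=> 0) <-> (forall k, lagpair q phi k = 0).
Proof.
move=> [h1 h2]; split=> [h k|h].
  have r0 : rL2 xi (fun=> 0) by have := rL2Z 0 (rL2_1D q0); under eq_fun do rewrite mul0r.
  have z f : rL2 xi f -> {ae leb, forall t : R, 0 < t -> f t = 0} -> ip xi f (L k) = 0.
    move=> rf f0; have := bessel q0 k.+1 rf.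
    rewrite (ip_ae rf r0 f0) [X in _ <= X](_ : _ = 0); last first.
      by rewrite /ip (@Rint_eq _ _ _ (fun=> 0)) ?Rint0// => t _; rewrite !mul0r.
    rewrite /l2S big_ord_recr /= => le.
    have G0 := lagG_gt0 q0.
    have : lagcoef xi f k ^+ 2 * lagG k <= 0.
      apply: le_trans le; rewrite lerDr sumr_ge0// => i _.
      by rewrite mulr_ge0 ?sqr_ge0// ltW.
    rewrite pmulr_lle0// => le2.
    have : lagcoef xi f k == 0 by rewrite -sqrf_eq0 eq_le le2 sqr_ge0.
    by rewrite /lagcoef mulf_eq0 invr_eq0 (gt_eqF (G0 k)) orbF => /eqP.
  rewrite lagpairE; apply: complex_ext => /=; apply: z => //.
    by apply: (ae_imp h) => t ht t0; rewrite ht.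
  by apply: (ae_imp h) => t ht t0; rewrite ht.
have a1 := laguerre_complete q0 h1 (fun k => congr1 (@complex.Re R) (etrans (esym (lagpairE q phi k)) (h k))).
have a2 := laguerre_complete q0 h2 (fun k => congr1 (@complex.Im R) (etrans (esym (lagpairE q phi k)) (h k))).
by apply: (ae_imp (ae_and a1 a2)) => t [b1 b2] t0; apply: complex_ext; [exact: b1|exact: b2].
Qed.

Lemma expands_nonzero Phi phi : expands Phi phi -> nonzero_L2 phi <-> exists n, Phi n != 0.
Proof.
move=> h; have hphi : cL2 q phi by case: h.
have G0 k : (lagG k)%:C != 0 :> R[i] by apply: Re_neq0; exact: lagG_gt0.
split=> [nz|[n Pn] /(lagpair_ae0 hphi) /(_ n)].
  apply: contrapT => nex; apply: nz; apply/lagpair_ae0 => // k.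
  rewrite (expands_coef k h); have [->|Pk] := eqVneq (Phi k) 0; first by rewrite mulr0.
  by exfalso; apply: nex; exists k.
by rewrite (expands_coef n h) => /eqP; rewrite mulf_eq0 (negbTE (G0 n)) (negbTE Pn).
Qed.

Lemma mulmv_Dmx Phi k : mulmv (Dmx q) Phi k = (lagG k)%:C * Phi k.
Proof.
rewrite /mulmv (@csum_finite _ _ k.+1) => [|n kn]; last first.
  by rewrite /Dmx (ltn_eqF kn) mulr0 mul0r.
rewrite big_ord_recr /= big1 ?add0r => [|n _]; last by rewrite /Dmx gtn_eqF ?ltn_ord// mulr0 mul0r.
by rewrite /Dmx eqxx mulr1.
Qed.

Lemma expands_solution Phi phi : expands Phi phi ->
  L2_solution q phi <->
  (cvg_mulmv (Aplus q) Phi /\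
   forall k, mulmv (Aplus q) Phi k = mulmv (Dmx q) Phi k + mulmv (Dmx q) (Psi q) k).
Proof.
move=> h; have hphi : cL2 q phi by case: h.
have hi := cL2_inhom q0 q_neq.
have hM := cL2_opM hphi; have hN := cL2_opN q0 hphi.
have hMN : cL2 q (fun t => opM phi t + opN q phi t) by exact: cL2D.
(* The residual of the equation: its pairing with [L k] is the difference of the two sides of row
   [k], so the rows hold exactly when all coefficients of [H] vanish. *)
pose H t := opM phi t + opN q phi t - phi t - inhom q t.
have hH : cL2 q H by apply: cL2B => //; exact: cL2B.
have HE k : lagpair q H k = lagpair q (fun t => opM phi t + opN q phi t) k -
    ((lagG k)%:C * Phi k + (lagG k)%:C * Psi q k).
  rewrite lagpairB//; last exact: cL2B.
  by rewrite lagpairB// (expands_coef k h) lagpair_inhom// opprD addrA.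
have AE k : cvg_cseries (fun n => Aplus q k n * Phi n) /\
    mulmv (Aplus q) Phi k = lagpair q (fun t => opM phi t + opN q phi t) k.
  exact: ccvg_csum (expands_pair_cvg k h).
have aeH : ae_eq_pos (fun t => opM phi t + opN q phi t - phi t)
    (fun t => chi_m1 t - opM (@chi_m1 R) t - opN_chi q t) <-> ae_eq_pos H (fun=> 0).
  split=> ae; apply: (ae_imp ae) => t ht t0.
    by rewrite /H ht// subrr.
  by apply/eqP; rewrite -subr_eq0; apply/eqP; exact: ht.
split=> [[_ /aeH/(lagpair_ae0 hH) h0]|[_ eqs]].
  split=> k; first by case: (AE k).
  rewrite (proj2 (AE k)) !mulmv_Dmx; apply/eqP; rewrite -subr_eq0.
  by have := h0 k; rewrite HE => ->.
split; first exact/in_L2P.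
apply/aeH/(lagpair_ae0 hH) => k; rewrite HE -(proj2 (AE k)) eqs !mulmv_Dmx.
by rewrite subrr.
Qed.

Lemma l2_series Phi N : (\sum_(0 <= n < N) (normc (Phi n) ^+ 2 * (rGamma (n%:R + 2 * xi) / n`!%:R))%:E)%E =
  (l2S xi (fun n => Re (Phi n)) N + l2S xi (fun n => Im (Phi n)) N)%:E.
Proof.
rewrite big_mkord sumEFin /l2S -big_split /=; congr (_%:E); apply: eq_bigr => n _.
by rewrite sqr_normc mulrDl.
Qed.

Let l2_term_ge0 Phi n : (0 <= (normc (Phi n) ^+ 2 * (rGamma (n%:R + 2 * xi) / n`!%:R))%:E)%E.
Proof. by rewrite lee_fin mulr_ge0 ?sqr_ge0// ltW// lagG_gt0. Qed.

Let l2S_ge0 (a : nat -> R) N : 0 <= l2S xi a N.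
Proof. by apply: sumr_ge0 => i _; rewrite mulr_ge0 ?sqr_ge0// ltW// lagG_gt0. Qed.

(** Riesz-Fischer for the real and the imaginary coefficients separately; both square sums are
    bounded by the given one. *)
Lemma expands_exists Phi :
  (\sum_(0 <= n <oo) (normc (Phi n) ^+ 2 * (rGamma (n%:R + 2 * xi) / n`!%:R))%:E < +oo)%E ->
  exists phi, expands Phi phi.
Proof.
set T := limn _ => Tfin.
have T0 : (0 <= T)%E by apply: nneseries_ge0 => n _ _; exact: l2_term_ge0.
have le N : l2S xi (fun n => Re (Phi n)) N + l2S xi (fun n => Im (Phi n)) N <= fine T.
  rewrite -lee_fin -l2_series fineK ?ge0_fin_numE//.
  by apply: nneseries_lim_ge => *; exact: l2_term_ge0.
have le1 N : l2S xi (fun n => Re (Phi n)) N <= fine T by apply: le_trans (le N); rewrite lerDl.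
have le2 N : l2S xi (fun n => Im (Phi n)) N <= fine T by apply: le_trans (le N); rewrite lerDr.
have [f1 rf1 c1] := riesz_fischer q0 le1; have [f2 rf2 c2] := riesz_fischer q0 le2.
by exists (fun t => f1 t +i* f2 t).
Qed.

Lemma coefficients_exist phi : cL2 q phi -> exists Phi, expands Phi phi /\
  (\sum_(0 <= n <oo) (normc (Phi n) ^+ 2 * (rGamma (n%:R + 2 * xi) / n`!%:R))%:E < +oo)%E.
Proof.
move=> [h1 h2].
pose Phi n := lagcoef xi (fun t => Re (phi t)) n +i* lagcoef xi (fun t => Im (phi t)) n.
exists Phi; split; first by split => //; exact: laguerre_expansion.
set B := ip xi (fun t => Re (phi t)) (fun t => Re (phi t)) + ip xi (fun t => Im (phi t)) (fun t => Im (phi t)).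
apply: (@le_lt_trans _ _ B%:E); last exact: ltry.
apply: lime_le; first by apply: is_cvg_nneseries => n _ _; exact: (l2_term_ge0 Phi n).
by apply: nearW => N; rewrite l2_series lee_fin lerD// bessel.
Qed.

End equivalence.

Theorem theorem3p8 (R : realType) (q : R[i]%C)
    (xi_gt0 : 0 < complex.Re q) (q_neq : q != 2^-1) :
  ((exists phi : R -> R[i]%C, L2_solution q phi /\ nonzero_L2 phi) <->
   (exists Phi : nat -> R[i]%C,
      matrix_solution q Phi /\ exists n, Phi n != 0)) /\
  (forall Phi : nat -> R[i]%C, matrix_solution q Phi ->
     exists phi : R -> R[i]%C,
       [/\ L2_solution q phi,
           laguerre_sum (complex.Re q) Phi phi &
           (nonzero_L2 phi <-> exists n, Phi n != 0)]) /\
  (forall phi : R -> R[i]%C, L2_solution q phi ->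
     exists Phi : nat -> R[i]%C,
       [/\ matrix_solution q Phi,
           laguerre_sum (complex.Re q) Phi phi &
           (nonzero_L2 phi <-> exists n, Phi n != 0)]).
Proof.
have to_phi Phi : matrix_solution q Phi -> exists phi : R -> R[i],
    [/\ L2_solution q phi, laguerre_sum (Re q) Phi phi &
        (nonzero_L2 phi <-> exists n, Phi n != 0)].
  move=> [l2 eqs]; have [phi h] := expands_exists xi_gt0 l2; exists phi; split.
  - exact/(expands_solution xi_gt0 q_neq h).
  - exact: expands_laguerre_sum.
  - exact: (expands_nonzero xi_gt0 h).
have to_Phi phi : L2_solution q phi -> exists Phi : nat -> R[i],
    [/\ matrix_solution q Phi, laguerre_sum (Re q) Phi phi &
        (nonzero_L2 phi <-> exists n, Phi n != 0)].
  move=> sol; have /in_L2P hphi := sol.1.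
  have [Phi [h l2]] := coefficients_exist xi_gt0 hphi; exists Phi; split.
  - by split; [|exact/(expands_solution xi_gt0 q_neq h)].
  - exact: expands_laguerre_sum.
  - exact: (expands_nonzero xi_gt0 h).
(* Both correspondences preserve being nonzero, so the equivalence of solvability follows from
   them. *)
split; last by split.
split=> [[phi [/to_Phi[Phi [sol _ nz]] /nz h]]|[Phi [/to_phi[phi [sol _ nz]] /nz h]]].
  by exists Phi.
by exists phi.
Qed.
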